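(* Let $x\ne0$, let $n,t\in\mathbb{N}$ with $1\le t\le n$, and let $\lambda\vdash n-t$. Then $$\operatorname{ind}_{n+1}\big(\mathscr{M}_{\mathbb{A}_n}(\lambda)\big)\cong\operatorname{res}_{n+1}\big(\mathscr{M}_{\mathbb{A}_{n+2}}(\lambda)\big)$$ as $\mathbb{A}_{n+1}$-modules, and there is an exact sequence of $\mathbb{A}_{n+1}$-modules $$0\longrightarrow\bigoplus_{\alpha\sqsubseteq\lambda}\mathscr{M}_{\mathbb{A}_{n+1}}(\alpha)\longrightarrow\operatorname{ind}_{n+1}\big(\mathscr{M}_{\mathbb{A}_n}(\lambda)\big)\longrightarrow\bigoplus_{\lambda\sqsubset\beta}\mathscr{M}_{\mathbb{A}_{n+1}}(\beta)\longrightarrow0.$$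
   Context: Let $K$ be a field, $x$ an element transcendental or algebraic over $K$, $F=K(x)$ of characteristic zero. $\mathscr{A}_n$ is the set of graphs on $\{1,\dots,n\}\cup\{1',\dots,n'\}$ (top row $1..n$, bottom row $1'..n'$) with all vertex degrees $0$ or $1$; degree-$0$ vertices carry loops; arcs within a row are horizontal, between rows vertical. Product: stack $\mathfrak a$ above $\mathfrak b$ identifying bottom vertex $i'$ of $\mathfrak a$ with top vertex $i$ of $\mathfrak b$; $\ell(\mathfrak a,\mathfrak b)$ = number of components lying entirely in the middle row; $G'(\mathfrak a,\mathfrak b)$ = diagram on the outer rows joining two vertices iff connected by a path; $\mathfrak a\mathfrak b=x^{\ell(\mathfrak a,\mathfrak b)}G'(\mathfrak a,\mathfrak b)$. This gives the algebra $\mathbb{A}_n$ with basis $\mathscr{A}_n$. $S_n$ = diagrams with $n$ vertical arcs; $S_{n-t}\subset S_n$ = permutations fixing $n-t+1,\dots,n$. $\epsilon_{n+1}\colon\mathbb{A}_n\to\mathbb{A}_{n+1}$ adds vertices $n+1,(n+1)'$ joined by a vertical arc; $\operatorname{res}_{n+1}$ denotes restriction of an $\mathbb{A}_{n+2}$-module to $\mathbb{A}_{n+1}$ along $\epsilon_{n+2}$, and $\operatorname{ind}_{n+1}(M)=\mathbb{A}_{n+1}\otimes_{\mathbb{A}_n}M$. $\mathbb{A}_n^m$ = span of diagrams with at most $m$ vertical arcs ($\mathbb{A}_n^{-1}=0$), $\mathbb{I}_n^m=\mathbb{A}_n^m/\mathbb{A}_n^{m-1}$. $\mathfrak u_{n,t}$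 = diagram with arcs $(i,i')$, $1\le i\le n-t$, other vertices isolated. For $\lambda\vdash n-t$ ($0\le t\le n$), Specht module $S^\lambda$ over $F$, and $x\ne0$: $\mathscr{M}_{\mathbb{A}_n}(\lambda)=\mathbb{I}_n^{n-t}\mathfrak u_{n,t}\otimes_{F[S_{n-t}]}S^\lambda$ with action $\mathfrak b\cdot(\mathfrak a\otimes v)=(\mathfrak b\mathfrak a)\otimes v$ (product in $\mathbb{I}_n^{n-t}$). $\alpha\sqsubset\lambda$: $\alpha$ obtained from $\lambda$ by removing one box; $\lambda\sqsubset\beta$: $\beta$ obtained from $\lambda$ by adding one box; $\alpha\sqsubseteq\lambda$: $\alpha\sqsubset\lambda$ or $\alpha=\lambda$. *)

(* Defs.v *)
From HB Require Import structures.
From mathcomp Require Import all_boot all_algebra all_fingroup.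
Set Implicit Arguments. Unset Strict Implicit. Unset Printing Implicit Defensive.
Import GRing.Theory.
Local Open Scope ring_scope.

(* Diagrams.  Vertex set of A_n: inl i = top vertex i, inr i = bottom
   vertex i' (0-based).  A diagram (all degrees 0 or 1) is an involution
   d of the vertex set: d v = w <> v means an arc {v,w}, d v = v means v
   is isolated (carries a loop). *)
Notation vtx n := ('I_n + 'I_n)%type.
Notation diag n := {f : {ffun vtx n -> vtx n} | [forall v, f (f v) == v]}.

Lemma empty_invol n : [forall v : vtx n, [ffun v => v] ([ffun v => v] v) == v].
Proof. by apply/forallP => v; rewrite !ffunE. Qed.

Definition diag_empty n : diag n := @exist _ (fun f : {ffun vtx n -> vtx n} => is_true [forall v, f (f v) == v]) [ffun v => v] (empty_invol n).

(* the diagram given by an involution f (f is always an involution in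
   the uses below; the fallback is never reached) *)
Definition mkdiag n (f : vtx n -> vtx n) : diag n :=
  insubd (diag_empty n) [ffun v => f v].

Definition nvert n (d : diag n) : nat :=
  #|[set i : 'I_n | [exists j : 'I_n, val d (inl i) == inr j]]|.

(* ---- stacking: three rows r0 (top of a), r1 (middle), r2 (bottom of b) *)
Definition r0 : 'I_3 := Ordinal (isT : (0 < 3)%N).
Definition r1 : 'I_3 := Ordinal (isT : (1 < 3)%N).
Definition r2 : 'I_3 := Ordinal (isT : (2 < 3)%N).

Definition embA n (v : vtx n) : 'I_3 * 'I_n :=
  match v with inl i => (r0, i) | inr i => (r1, i) end.
Definition embB n (v : vtx n) : 'I_3 * 'I_n :=
  match v with inl i => (r1, i) | inr i => (r2, i) end.
Definition embO n (v : vtx n) : 'I_3 * 'I_n :=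
  match v with inl i => (r0, i) | inr i => (r2, i) end.

Definition edge_of n (emb : vtx n -> 'I_3 * 'I_n) (d : diag n)
  (w w' : 'I_3 * 'I_n) : bool :=
  [exists v, [&& emb v == w, emb (val d v) == w' & val d v != v]].

Definition stack_rel n (a b : diag n) : rel ('I_3 * 'I_n) :=
  [rel w w' | edge_of (@embA n) a w w' || edge_of (@embB n) b w w'].

Definition comps n (a b : diag n) : {set {set 'I_3 * 'I_n}} :=
  [set [set w' | connect (stack_rel a b) w w'] | w : 'I_3 * 'I_n].

Definition ell n (a b : diag n) : nat :=
  #|[set C in comps a b | C \subset [set w : 'I_3 * 'I_n | w.1 == r1]]|.

Definition Gfun n (a b : diag n) (v : vtx n) : vtx n :=
  odflt v [pick v' | (v' != v) && connect (stack_rel a b) (embO v) (embO v')].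
Definition Gp n (a b : diag n) : diag n := mkdiag (Gfun a b).

Definition pdiag n (s : 'S_n) : diag n :=
  mkdiag (fun v => match v with inl i => inr (s i) | inr j => inl ((s^-1)%g j) end).

Definition udiag n (m : nat) : diag n :=
  mkdiag (fun v => match v with
                   | inl i => if (i < m)%N then inr i else inl i
                   | inr i => if (i < m)%N then inl i else inr i end).

Definition liftv n (v : vtx n) : vtx n.+1 :=
  match v with inl j => inl (lift ord_max j) | inr j => inr (lift ord_max j) end.
Definition eps n (d : diag n) : diag n.+1 :=
  mkdiag (fun v => match v with
    | inl i => match unlift ord_max i with
               | Some j => liftv (val d (inl j)) | None => inr ord_max end
    | inr i => match unlift ord_max i with
               | Some j => liftv (val d (inr j)) | None => inl ord_max end end).

Definition ispart (l : seq nat) : bool := sorted geq l && all (fun k => 0 < k)%N l.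
Definition is_partition (m : nat) (l : seq nat) : bool := ispart l && (sumn l == m).
Definition sqsubset (a l : seq nat) : bool :=
  [&& ispart a, ispart l & [exists i : 'I_(size l), incr_nth a i == l]].
Definition sqsubseteq (a l : seq nat) : bool := sqsubset a l || (a == l).

Notation tabloid n := {ffun 'I_n -> option 'I_n}.

Section Modules.
Variable F : fieldType.
Variable x : F.

Notation vec X := {ffun X -> F^o}.

Definition delta (X : finType) (i : X) : vec X := [ffun j => (j == i)%:R].
Definition tens (A X : finType) (y : vec A) (v : vec X) : vec (A * X)%type :=
  [ffun p => y p.1 * v p.2].

Definition prodA n (a b : diag n) : vec (diag n) := x ^+ ell a b *: delta (Gp a b).
(* product in I_n^m = A_n^m / A_n^{m-1} (basis: diagrams with m vertical arcs) *)
Definition prodI n (m : nat) (a b : diag n) : vec (diag n) :=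
  if nvert (Gp a b) == m then prodA a b else 0.
Definition rmulI n (m : nat) (y : vec (diag n)) (c : diag n) : vec (diag n) :=
  \sum_d y d *: prodI m d c.

(* ---- Specht modules, inside the permutation module on "tabloids".
   For lambda |- m (m <= n), entries are 0..m-1 in 'I_n; S_m is the
   subgroup of 'S_n fixing m..n-1.  A tableau t places entry k < m in the
   box t k = (row, column). *)
Definition isbox n (l : seq nat) (b : 'I_n * 'I_n) : bool :=
  (b.1 < size l)%N && (b.2 < nth 0%N l b.1)%N.
Definition istab n (l : seq nat) (t : {ffun 'I_n -> 'I_n * 'I_n}) : bool :=
  [forall k : 'I_n, (k < sumn l)%N ==> isbox l (t k)] &&
  [forall k : 'I_n, forall k' : 'I_n,
     [&& (k < sumn l)%N, (k' < sumn l)%N & t k == t k'] ==> (k == k')].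
Definition rowtab n (l : seq nat) (t : {ffun 'I_n -> 'I_n * 'I_n}) : tabloid n :=
  [ffun k : 'I_n => if (k < sumn l)%N then Some (t k).1 else None].
Definition colgrp n (l : seq nat) (t : {ffun 'I_n -> 'I_n * 'I_n}) : {set 'S_n} :=
  [set s : 'S_n | [forall k : 'I_n,
     if (k < sumn l)%N then (t (s k)).2 == (t k).2 else s k == k]].
(* left action of 'S_n (product (s*t) k = t (s k)) on tabloids *)
Definition permtab n (s : 'S_n) (r : tabloid n) : tabloid n := [ffun k : 'I_n => r (s k)].
Definition permact n (s : 'S_n) (w : vec (tabloid n)) : vec (tabloid n) :=
  \sum_r w r *: delta (permtab s r).
Definition polytab n (l : seq nat) (t : {ffun 'I_n -> 'I_n * 'I_n}) : vec (tabloid n) :=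
  \sum_(s in colgrp l t) ((-1) ^+ odd_perm s) *: delta (permtab s (rowtab l t)).
Definition polys n (l : seq nat) : seq (vec (tabloid n)) :=
  [seq polytab l t | t <- enum [pred t : {ffun 'I_n -> 'I_n * 'I_n} | istab l t]].
Definition specht n (l : seq nat) : {vspace vec (tabloid n)} := <<polys n l>>%VS.
Definition Ssub n (m : nat) : {set 'S_n} :=
  [set s : 'S_n | [forall k : 'I_n, (m <= k)%N ==> (s k == k)]].

(* Finite-dimensional A_n-modules presented as subquotients V/W of the
   coordinate space vec X; sact b i is the action of the diagram b on the
   basis vector delta i of the ambient space (extended linearly). *)
Record smod (n : nat) (X : finType) := SMod {
  sact : diag n -> X -> vec X;
  sV : {vspace vec X};
  sW : {vspace vec X} }.

Definition actv n X (M : smod n X) (b : diag n) (v : vec X) : vec X :=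
  \sum_i v i *: sact M b i.

(* M_{A_n}(lambda) = I_n^m u_{n,t} (x)_{F[S_m]} S^lambda, m = n - t = |lambda| *)
Definition Mmod n (l : seq nat) : smod n (diag n * tabloid n)%type :=
  let m := sumn l in
  let u := udiag n m in
  let ys : seq (vec (diag n)) := [seq prodI m a u | a <- enum {: diag n}] in
  let gV : seq (vec (diag n * tabloid n)%type) :=
    [seq tens y s | y <- ys, s <- polys n l] in
  let gW : seq (vec (diag n * tabloid n)%type) :=
    [seq tens (rmulI m y.1 (pdiag y.2.1)) y.2.2 - tens y.1 (permact y.2.1 y.2.2)
       | y <- [seq (y, q) | y <- ys,
                 q <- [seq (s, w) | s <- enum (Ssub n m), w <- polys n l]]] in
  SMod (fun b p => tens (prodI m b p.1) (delta p.2)) <<gV>>%VS <<gW>>%VS.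

(* ind_{n+1} M = A_{n+1} (x)_{A_n} M  (A_{n+1} a right A_n-module via eps) *)
Definition ind n X (M : smod n X) : smod n.+1 (diag n.+1 * X)%type :=
  let gV : seq (vec (diag n.+1 * X)%type) :=
    [seq tens (delta a) v | a <- enum {: diag n.+1}, v <- vbasis (sV M)] in
  let gW1 : seq (vec (diag n.+1 * X)%type) :=
    [seq tens (delta a) w | a <- enum {: diag n.+1}, w <- vbasis (sW M)] in
  let gW2 : seq (vec (diag n.+1 * X)%type) :=
    [seq tens (prodA q.1 (eps q.2.1)) q.2.2 - tens (delta q.1) (actv M q.2.1 q.2.2)
      | q <- [seq (a, r) | a <- enum {: diag n.+1},
                r <- [seq (b, v) | b <- enum {: diag n}, v <- vbasis (sV M)]]] in
  SMod (fun c p => tens (prodA c p.1) (delta p.2)) <<gV>>%VS <<gW1 ++ gW2>>%VS.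

Definition res n X (M : smod n.+2 X) : smod n.+1 X :=
  SMod (fun b i => sact M (eps b) i) (sV M) (sW M).

Definition smod0 n X : smod n X := SMod (fun _ _ => 0) 0%VS 0%VS.
Definition injk (X : finType) (N : nat) (k : 'I_N) (v : vec X) : vec ('I_N * X)%type :=
  [ffun p => if p.1 == k then v p.2 else 0].
Definition dsum n X (s : seq (smod n X)) : smod n ('I_(size s) * X)%type :=
  let gV : seq (vec ('I_(size s) * X)%type) :=
    [seq injk k v | k <- enum 'I_(size s), v <- vbasis (sV (nth (smod0 n X) s k))] in
  let gW : seq (vec ('I_(size s) * X)%type) :=
    [seq injk k v | k <- enum 'I_(size s), v <- vbasis (sW (nth (smod0 n X) s k))] in
  SMod (fun b p => injk p.1 (sact (nth (smod0 n X) s p.1) b p.2)) <<gV>>%VS <<gW>>%VS.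

(* module homomorphisms V1/W1 -> V2/W2 induced by a linear map f *)
Definition ishom n X Y (M : smod n X) (N : smod n Y) (f : 'Hom(vec X, vec Y)) : Prop :=
  [/\ (f @: sV M <= sV N)%VS, (f @: sW M <= sW N)%VS &
      forall b v, v \in sV M -> f (actv M b v) - actv N b (f v) \in sW N].
Definition injq n X Y (M : smod n X) (N : smod n Y) (f : 'Hom(vec X, vec Y)) : Prop :=
  forall v, v \in sV M -> f v \in sW N -> v \in sW M.
Definition surjq n X Y (M : smod n X) (N : smod n Y) (f : 'Hom(vec X, vec Y)) : Prop :=
  (sV N <= f @: sV M + sW N)%VS.

Definition smod_iso n X Y (M : smod n X) (N : smod n Y) : Prop :=
  exists f : 'Hom(vec X, vec Y), [/\ ishom M N f, injq M N f & surjq M N f].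

Definition short_exact n X Y Z (M1 : smod n X) (M2 : smod n Y) (M3 : smod n Z) : Prop :=
  exists (f : 'Hom(vec X, vec Y)) (g : 'Hom(vec Y, vec Z)),
    [/\ ishom M1 M2 f, ishom M2 M3 g, injq M1 M2 f, surjq M2 M3 g &
        forall v, v \in sV M2 -> (g v \in sW M3 <-> v \in (f @: sV M1 + sW M2)%VS)].

End Modules.

(* Main.v *)
From HB Require Import structures.
Require Import Defs.
From mathcomp Require Import all_boot all_algebra all_fingroup zify.
Set Implicit Arguments.
Unset Strict Implicit.
Unset Printing Implicit Defensive.
Import GRing.Theory.

(* Write m = |l|. A module M_n(l) is spanned by tensors d (x) s, where the diagrams d have
   bottom vertices m..n-1 isolated and all the others joined to the top, and s lies in the
   Specht module of l. Let Q be spanned in the same way by the diagrams on n+1 points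
   whose bottom vertices m..n-1 are isolated and in which no two of the bottom vertices
   0..m-1 are joined, the bottom vertex n being free. The map a (x) (d (x) s) |->
   a (eps d) (x) s identifies the induced module with Q, and so does moving the last top
   vertex of a diagram on n+2 points to the bottom row for the restricted one.

   In a diagram of Q the bottom vertex n is isolated, or joined to a bottom vertex below m,
   or joined to the top. The first two kinds span the submodule that is the sum of the
   M_(n+1)(a), where an arc at n is traded for the restriction of S^l to S_(m-1); the
   last kind gives a quotient with m+1 vertical arcs, hence the induction of S^l to S_(m+1).
   The branching rules come from explicit maps between polytabloid spans for the removal of
   a corner, Schur's lemma, and a dimension count based on the identity DU - UD = 1 in
   Young's lattice. *)

(** * Components of graphs *)

(** Modules are subquotients V/W of coordinate spaces: a map is defined on the ambient basis, and
    its properties are checked on generators of V and modulo W. Isomorphisms are therefore given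
    with explicit inverses, and no dimension of a module over the diagram algebra is computed. The
    scalar x enters through d u = x^(n-m) d for a half diagram d and u = [udiag n m]. Inverting this
    power makes every half diagram a generator and turns a (x) d into a multiple of a eps(d) (x) u.
    A bottom vertex below m that is isolated or joined to another one among the first n must give 0:
    that defect can be copied to the other side of the tensor sign, where too few vertical arcs
    remain. For the symmetric groups, a corner yields only a split embedding of Specht modules, and
    Schur's lemma makes the embeddings for different corners orthogonal. That they exhaust the
    restriction or the induction is read off from dimensions, so no basis of standard tableaux is
    required. Characteristic zero makes averages available, and it keeps the scalars c in the
    induction different from 0, because each is tied to the trace of a nonzero idempotent. *)

Section Graphs.

Lemma connect_hom (T : finType) (T' : Type) (e : rel T) (R : rel T') (f : T -> T') :
  reflexive R -> transitive R -> (forall x y, e x y -> R (f x) (f y)) ->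
  forall x y, connect e x y -> R (f x) (f y).
Proof.
move=> Rr Rt eR x y /connectP[p]; elim: p x => [|z p IH] x /= => [_ ->|] //.
by case/andP=> /eR xz /IH zp /zp; apply: Rt.
Qed.

Lemma connect_ind (T : finType) (e : rel T) (P : T -> Prop) x y :
  P x -> (forall u v, P u -> e u v -> P v) -> connect e x y -> P y.
Proof.
move=> + Pe /connectP[s]; elim: s x => [|z s IH] x Px /= => [_ ->|] //.
by case/andP=> /(Pe _ _ Px)/IH.
Qed.

Lemma leq_card_imset_ker (T T1 T2 : finType) (A : {set T}) (f : T -> T1) (g : T -> T2) :
  {in A &, forall u v, f u = f v -> g u = g v} -> #|g @: A| <= #|f @: A|.
Proof.
move=> fg; have [->|/set0Pn[x0 Ax0]] := eqVneq A set0; first by rewrite !imset0 cards0.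
pose h B := g (odflt x0 [pick u in A | f u == B]).
suff -> : g @: A = h @: (f @: A) by apply: leq_imset_card.
rewrite -imset_comp; apply: eq_in_imset => u Au /=; rewrite /h.
case: pickP => [v /andP[Av /eqP fv]|/(_ u)] /=; first exact: fg.
by rewrite Au eqxx.
Qed.

Lemma card_imset_ker (T T1 T2 : finType) (A : {set T}) (f : T -> T1) (g : T -> T2) :
  {in A &, forall u v, (f u == f v) = (g u == g v)} -> #|f @: A| = #|g @: A|.
Proof.
move=> fg; apply/eqP; rewrite eqn_leq; apply/andP.
by split; apply: leq_card_imset_ker => u v Au Av /eqP uv; apply/eqP; rewrite ?fg // -fg.
Qed.

(** Counts the components that meet [I]. The sets of inner vertices to which it is applied are
    unions of components, so meeting such a set and lying in it agree. *)
Definition ncl (T : finType) (e : rel T) (I : {set T}) :=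
  #|[set [set y | connect e x y] | x in I]|.

Lemma cls_eq (T : finType) (e : rel T) x y : connect_sym e ->
  ([set z | connect e x z] == [set z | connect e y z]) = connect e x y.
Proof.
move=> se; apply/eqP/idP=> [/setP/(_ y)|xy]; first by rewrite !inE connect0.
apply/setP=> z; rewrite !inE; apply/idP/idP; last exact: connect_trans.
by apply: connect_trans; rewrite se.
Qed.

Lemma ncl_transfer (T1 T2 : finType) (e1 : rel T1) (e2 : rel T2) (psi : T2 -> T1)
    (I1 : {set T1}) (I2 : {set T2}) : connect_sym e1 -> connect_sym e2 ->
  {in I2, forall u, psi u \in I1} ->
  {in I2 &, forall u v, connect e1 (psi u) (psi v) = connect e2 u v} ->
  {in I1, forall x, exists2 u, u \in I2 & connect e1 x (psi u)} ->
  ncl e1 I1 = ncl e2 I2.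
Proof.
move=> s1 s2 psiI psic surj; rewrite /ncl.
rewrite -(@card_imset_ker _ _ _ I2 (fun u => [set y | connect e1 (psi u) y])); last first.
  by move=> u v Iu Iv; rewrite !cls_eq // psic.
congr #|pred_of_set _|; apply/setP=> B; apply/imsetP/imsetP=> [[x Ix ->]|[u Iu ->]].
  by have [u Iu xu] := surj x Ix; exists u => //; apply/eqP; rewrite cls_eq.
by exists (psi u) => //; apply: psiI.
Qed.

Lemma ncl_split (T : finType) (e : rel T) (I J : {set T}) : connect_sym e ->
  (forall x y, x \in I -> connect e x y -> y \in I) ->
  ncl e J = ncl e (J :&: I) + ncl e (J :\: I).
Proof.
move=> se cI; rewrite /ncl -[in LHS](setID J I) imsetU cardsU.
rewrite [X in _ - X]eq_card0 ?subn0 // => B; rewrite inE; apply/negP.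
case/andP=> /imsetP[x /setIP[_ Ix] ->] /imsetP[y /setDP[_ Iy] /eqP].
by rewrite cls_eq // => /(cI _ _ Ix); rewrite (negPf Iy).
Qed.

(** [None] marks a forgotten vertex. It is related only to [None], so a partial map that respects
    edges forgets whole components at a time. *)
Definition oconn (T : finType) (R : rel T) (x y : option T) : bool :=
  match x, y with Some u, Some v => R u v | None, None => true | _, _ => false end.

Lemma oconn_refl (T : finType) (R : rel T) : reflexive R -> reflexive (oconn R).
Proof. by move=> rR [u|] /=. Qed.

Lemma oconn_trans (T : finType) (R : rel T) : transitive R -> transitive (oconn R).
Proof. by move=> tR [v|] [u|] [w|] //=; apply: tR. Qed.

Lemma oconn_sym (T : finType) (R : rel T) : symmetric R -> symmetric (oconn R).
Proof. by move=> sR [v|] [u|] /=. Qed.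

Section Transfer.
Variables (T1 T2 : finType) (e1 : rel T1) (e2 : rel T2).
Variables (psi : T2 -> T1) (phi : T1 -> option T2) (D : pred T2).
Hypothesis psiE : forall x y, e2 x y -> connect e1 (psi x) (psi y).
Hypothesis phiE : forall x y, e1 x y -> oconn (connect e2) (phi x) (phi y).
Hypothesis psiK : forall w, D w -> oconn (connect e2) (phi (psi w)) (Some w).
Hypothesis sym2 : connect_sym e2.

Lemma psi_conn w w' : connect e2 w w' -> connect e1 (psi w) (psi w').
Proof. by apply: (connect_hom (R := connect e1)) => // [z1 z2 z3]; apply: connect_trans. Qed.

Let Tr := oconn_trans (@connect_trans _ e2).

Lemma phi_conn w w' : connect e1 w w' -> oconn (connect e2) (phi w) (phi w').
Proof.
have R := oconn_refl (connect0 e2).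
exact: (connect_hom R Tr phiE).
Qed.

Lemma phi_psi_conn w z : D w -> connect e1 (psi w) z -> oconn (connect e2) (Some w) (phi z).
Proof. by rewrite (oconn_sym sym2) => /psiK Dw /phi_conn; rewrite (oconn_sym sym2) => /Tr; apply. Qed.

(** [phi] is a partial retraction of [psi] up to connectivity, so it carries a path between two
    images back to a path between the original vertices. *)
Lemma conn_transfer w w' : D w -> D w' -> connect e1 (psi w) (psi w') = connect e2 w w'.
Proof.
move=> Dw /psiK Dw'; apply/idP/idP; last exact: psi_conn.
by move/(phi_psi_conn Dw)/Tr => /(_ _ Dw').
Qed.

End Transfer.

End Graphs.

(** * Paths along two involutions *)

Section TwoEnds.
Variables (T : finType) (p q : T -> T).
Hypotheses (pK : involutive p) (qK : involutive q).

Let f x := q (p x).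
Let f_inj : injective f. Proof. exact: inj_comp (inv_inj qK) (inv_inj pK). Qed.

Lemma iter_fixed_order x i : iter i f x = x -> fingraph.order f x %| i.
Proof.
move=> fix_i; set N := fingraph.order f x.
have N0 : 0 < N by apply: fingraph.order_gt0.
have fN k : iter (k * N) f x = x.
  by elim: k => // k IH; rewrite mulSn iterD IH iter_order.
have := fix_i; rewrite (divn_eq i N) addnC iterD fN => fixm.
have := findex_iter (ltn_pmod i N0); rewrite fixm findex0 => /esym m0.
by rewrite m0 dvdn_addr // dvdn_mull.
Qed.

(** Both involutions conjugate f = q p to its inverse. Hence q sends f^k x to f^(-k) x and p sends
    it to f^(-k-1) x; the negative powers are moved to the other side. *)
Lemma invol_reflect x k : q x = x ->
  (iter k f (q (iter k f x)) = x) /\ (iter k.+1 f (p (iter k f x)) = x).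
Proof.
move=> qx; elim: k => [|k [IH1 IH2]]; first by rewrite /= /f pK qx.
have E : q (f (iter k f x)) = p (iter k f x) by rewrite /f qK.
split; first by rewrite [iter k.+1 f x]iterS E.
by rewrite [iter k.+1 f x]iterS iterSr {2}/f pK E.
Qed.

(* The orbit of a fixed point x of q under the group generated by the
   involutions p, q is its orbit under q p, on which p and q act as
   reflections; such a path has only one end besides x. *)
Lemma two_ends (e : rel T) x y z :
  (forall u v, e u v -> v = p u \/ v = q u) -> q x = x ->
  connect e x y -> connect e x z -> x != y -> x != z ->
  (p y = y \/ q y = y) -> (p z = z \/ q z = z) -> y = z.
Proof.
move=> eP qx xy xz; set N := fingraph.order f x.
have orb w : connect e x w -> exists2 k, k < N & w = iter k f x.
  move=> xw; suff fw : fconnect f x w.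
    by exists (findex f x w); rewrite ?findex_max ?iter_findex.
  apply: (connect_ind (P := fun w => fconnect f x w) _ _ xw) => // u v fu /eP uv.
  have [u1 u2] := invol_reflect (findex f x u) qx.
  rewrite (fconnect_sym f_inj); rewrite (iter_findex fu) in u1 u2.
  move: (findex f x u) u1 u2 => k u1 u2.
  by case: uv => ->; [rewrite -u2 | rewrite -u1]; apply: fconnect_iter.
(* A fixed point f^k x of q or p gives f^(2k) x = x or f^(2k+1) x = x. As 0 < k < N, the multiple of
   N in question is N itself, so k is half of N, rounded down, in both cases. *)
have half k : k < N -> x != iter k f x -> 
    p (iter k f x) = iter k f x \/ q (iter k f x) = iter k f x -> k = N./2.
  move=> kN xk; have [q1 q2] := invol_reflect k qx.
  have k0 : 0 < k by case: k xk {q1 q2 kN} => //=; rewrite eqxx.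
  case=> fix_k; [move: q2|move: q1]; rewrite fix_k -iterD => /iter_fixed_order /dvdnP[[|[|c]]];
    rewrite -/N; lia.
case: (orb _ xy) => k kN -> {y xy}; case: (orb _ xz) => l lN -> {z xz}.
by move=> xk xl /(half _ kN xk)-> /(half _ lN xl)->.
Qed.

End TwoEnds.

(** * Products of diagrams *)

(* Sealed copies of Gp and ell: without them, unification compares two products
   by unfolding the stacked graphs. *)
Fact mul_seal : {f : (forall n, diag n -> diag n -> diag n) | f = Gp}.
Proof. by exists Gp. Qed.
Definition dmul n : diag n -> diag n -> diag n := sval mul_seal n.
Lemma dmulE n (a b : diag n) : dmul a b = Gp a b.
Proof. by rewrite /dmul (svalP mul_seal). Qed.

Fact loops_seal : {f : (forall n, diag n -> diag n -> nat) | f = ell}.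
Proof. by exists ell. Qed.
Definition loops n : diag n -> diag n -> nat := sval loops_seal n.
Lemma loopsE n (a b : diag n) : loops a b = ell a b.
Proof. by rewrite /loops (svalP loops_seal). Qed.

Section Diagrams.
Variable n : nat.
Implicit Types (a b c d : diag n) (u v : vtx n) (w : 'I_3 * 'I_n).

Lemma diagK d : involutive (val d).
Proof. by move=> v; case: d => f /= /forallP/(_ v)/eqP. Qed.

Lemma diag_inj d : injective (val d).
Proof. exact: inv_inj (diagK d). Qed.

Lemma diag_ext d d' : val d =1 val d' -> d = d'.
Proof. by move=> dd; apply/val_inj/ffunP. Qed.

Lemma mkdiagE (f : vtx n -> vtx n) : involutive f -> val (mkdiag f) =1 f.
Proof.
move=> fK v; rewrite /mkdiag val_insubd.
by rewrite (introT forallP) ?ffunE // => u; rewrite !ffunE fK.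
Qed.

(** Reflexive on purpose: it is the trace on the outer vertices of the connectivity relation of a
    stacked graph, and it determines the diagram. *)
Definition lnk d u v := (v == u) || (val d u == v).

Lemma lnk_refl d : reflexive (lnk d).
Proof. by move=> u; rewrite /lnk eqxx. Qed.

Lemma lnk_val d u : lnk d u (val d u).
Proof. by rewrite /lnk eqxx orbT. Qed.

Lemma lnk_trans d : transitive (lnk d).
Proof.
move=> v u w /orP[/eqP->//|/eqP<-] /orP[/eqP->|/eqP<-].
  by rewrite /lnk eqxx orbT.
by rewrite diagK lnk_refl.
Qed.

Lemma lnk_sym d : symmetric (lnk d).
Proof.
by move=> u v; rewrite /lnk eq_sym; congr orb; apply/eqP/eqP=> <-; rewrite diagK.
Qed.

Lemma lnk_ext d d' : lnk d =2 lnk d' -> d = d'.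
Proof.
move=> ll; apply: diag_ext => u; have := ll u (val d u); rewrite /lnk eqxx orbT => /esym.
case/orP=> [/eqP du|/eqP //]; have := ll u (val d' u); rewrite /lnk eqxx orbT.
by rewrite du => /orP[] /eqP.
Qed.

Lemma stack_rowP w : [\/ exists i, w = (r0, i), exists i, w = (r1, i) | exists i, w = (r2, i)].
Proof.
case: w => [[[|[|[|//]]] k] i]; [constructor 1|constructor 2|constructor 3]; exists i.
all: by congr pair; apply: val_inj.
Qed.

Lemma embO_inj : injective (@embO n).
Proof. by case=> i [j|j] [] // ->. Qed.

Definition conn a b := connect (stack_rel a b).

Lemma edge_ofP (emb : vtx n -> 'I_3 * 'I_n) d w w' :
  edge_of emb d w w' -> exists2 v, w = emb v & w' = emb (val d v).
Proof. by case/existsP=> v /and3P[/eqP<- /eqP<- _]; exists v. Qed.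

Lemma edge_sym (emb : vtx n -> 'I_3 * 'I_n) d : symmetric (edge_of emb d).
Proof.
move=> w w'; apply/existsP/existsP=> -[v /and3P[/eqP e1 /eqP e2 dv]]; exists (val d v).
all: by rewrite diagK e1 e2 !eqxx eq_sym dv.
Qed.

Lemma stack_sym a b : connect_sym (stack_rel a b).
Proof. by apply: sym_connect_sym => w w' /=; congr orb; apply: edge_sym. Qed.

Lemma conn_sym a b : symmetric (conn a b).
Proof. exact: stack_sym. Qed.

Lemma stack_relP a b w w' : stack_rel a b w w' ->
  (exists2 v, w = embA v & w' = embA (val a v)) \/
  (exists2 v, w = embB v & w' = embB (val b v)).
Proof. by case/orP=> /edge_ofP; [left|right]. Qed.

Lemma edge_emb (emb : vtx n -> 'I_3 * 'I_n) d v :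
  val d v != v -> edge_of emb d (emb v) (emb (val d v)).
Proof. by move=> dv; apply/existsP; exists v; rewrite !eqxx. Qed.

Lemma connA a b v : conn a b (embA v) (embA (val a v)).
Proof.
have [->|av] := eqVneq (val a v) v; first exact: connect0.
by apply: connect1; apply/orP; left; apply: edge_emb.
Qed.

Lemma connB a b v : conn a b (embB v) (embB (val b v)).
Proof.
have [->|bv] := eqVneq (val b v) v; first exact: connect0.
by apply: connect1; apply/orP; right; apply: edge_emb.
Qed.

Definition unA w : option (vtx n) :=
  if w.1 == r0 then Some (inl w.2) else if w.1 == r1 then Some (inr w.2) else None.
Definition unB w : option (vtx n) :=
  if w.1 == r1 then Some (inl w.2) else if w.1 == r2 then Some (inr w.2) else None.
Definition stepA a w := if unA w is Some v then embA (val a v) else w.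
Definition stepB b w := if unB w is Some v then embB (val b v) else w.

Lemma embAK v : unA (embA v) = Some v. Proof. by case: v. Qed.
Lemma embBK v : unB (embB v) = Some v. Proof. by case: v. Qed.

Lemma unA_emb w v : unA w = Some v -> w = embA v.
Proof. by case: (stack_rowP w) => -[i ->] //= [<-]. Qed.

Lemma unB_emb w v : unB w = Some v -> w = embB v.
Proof. by case: (stack_rowP w) => -[i ->] //= [<-]. Qed.

Lemma stepA_invol a : involutive (stepA a).
Proof.
move=> w; rewrite /stepA; case E: (unA w) => [v|]; last by rewrite E.
by rewrite embAK diagK -(unA_emb E).
Qed.

Lemma stepB_invol b : involutive (stepB b).
Proof.
move=> w; rewrite /stepB; case E: (unB w) => [v|]; last by rewrite E.
by rewrite embBK diagK -(unB_emb E).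
Qed.

(** [stepA] and [stepB] extend a and b by the identity to all three rows. An outer vertex is fixed
    by one of them, hence is an end of its component, and [two_ends] leaves room for only one other
    end. *)
Lemma conn_ends a b u v v' : conn a b (embO u) (embO v) -> conn a b (embO u) (embO v') ->
  u != v -> u != v' -> v = v'.
Proof.
move=> uv uv' nv nv'; apply: embO_inj.
have step w w' : stack_rel a b w w' -> w' = stepA a w \/ w' = stepB b w.
  by case/stack_relP=> -[z -> ->]; [left; rewrite /stepA embAK|right; rewrite /stepB embBK].
have fixO z : stepA a (embO z) = embO z \/ stepB b (embO z) = embO z.
  by case: z => i; [right|left].
case: u => i in uv uv' nv nv' *.
  by apply: (two_ends (stepA_invol a) (stepB_invol b) step _ uv uv') => //;
     rewrite (inj_eq embO_inj).
have step' w w' : stack_rel a b w w' -> w' = stepB b w \/ w' = stepA a w.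
  by move/step; case; [right|left].
by apply: (two_ends (stepB_invol b) (stepA_invol a) step' _ uv uv') => //;
   rewrite ?(inj_eq embO_inj) 1?or_comm.
Qed.

(** By [conn_ends] the choice in [Gfun] has at most one candidate, so [Gfun] is an involution and
    the default value of [mkdiag] does not occur. *)
Lemma GpE a b : val (dmul a b) =1 Gfun a b.
Proof.
move=> w; rewrite dmulE; move: w; apply: mkdiagE => v; rewrite /Gfun; case: pickP => [u /andP[uv vu]|none] /=; last first.
  by case: pickP => // u; rewrite none.
case: pickP => [u' /andP[uu' u'u]|/(_ v)] /=; last by rewrite eq_sym uv stack_sym vu.
by apply/esym; apply: conn_ends _ u'u _ _; rewrite /conn 1?stack_sym // eq_sym.
Qed.

Lemma Gp_lnk a b u v : conn a b (embO u) (embO v) = lnk (dmul a b) u v.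
Proof.
rewrite /lnk GpE /Gfun; case: eqVneq => [->|vu] /=; first exact: connect0.
case: pickP => [u' /andP[uu' u'u]|/(_ v)] /=; last first.
  by rewrite vu /= -/(conn a b _ _) => ->; rewrite eq_sym (negPf vu).
apply/idP/eqP=> [uv|<-] //; apply: (conn_ends u'u uv) => //; by rewrite eq_sym.
Qed.

Lemma conn_Gp a b u : conn a b (embO u) (embO (val (dmul a b) u)).
Proof. by rewrite Gp_lnk lnk_val. Qed.

Definition inner a b := [set w | [forall w', conn a b w w' ==> (w'.1 == r1)]].

Lemma innerP a b w : reflect (forall w', conn a b w w' -> w'.1 = r1) (w \in inner a b).
Proof.
rewrite inE; apply: (iffP forallP) => [H w' /(implyP (H w'))/eqP //|H w'].
by apply/implyP=> /H->.
Qed.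

Lemma ellE a b : loops a b = ncl (stack_rel a b) (inner a b).
Proof.
rewrite loopsE /ell /ncl; congr #|pred_of_set _|; apply/setP=> C; rewrite inE.
apply/andP/imsetP=> [[/imsetP[w _ ->] /subsetP sub]|[w /innerP iw ->]].
  by exists w => //; apply/innerP=> w' ww'; apply/eqP; have := sub w'; rewrite !inE => ->.
split; first exact: imset_f.
by apply/subsetP=> w'; rewrite !inE => /iw ->.
Qed.

Lemma ell0 a b : (forall j, exists u, conn a b (r1, j) (embO u)) -> loops a b = 0.
Proof.
move=> H; rewrite ellE /ncl; apply/eqP; rewrite cards_eq0 imset_eq0; apply/eqP/setP=> w.
rewrite in_set0; apply/negP=> iw; have w1 := innerP _ _ _ iw w (connect0 _ _).
case: w w1 iw => r j /= -> /innerP iw; have [u /iw] := H j.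
by case: u.
Qed.

End Diagrams.

Section Char.
Variable n : nat.
Implicit Types (a b c d : diag n) (u v : vtx n) (w : 'I_3 * 'I_n).

(* phi carries the stacked graph onto c, forgetting the vertices it sends to None. *)
Lemma Gp_char a b c (phi : 'I_3 * 'I_n -> option (vtx n)) :
  (forall u, phi (embO u) = Some u) ->
  (forall v, oconn (lnk c) (phi (embA v)) (phi (embA (val a v)))) ->
  (forall v, oconn (lnk c) (phi (embB v)) (phi (embB (val b v)))) ->
  (forall u, conn a b (embO u) (embO (val c u))) ->
  dmul a b = c.
Proof.
move=> phiO phiA phiB cc; apply: lnk_ext => u v; rewrite -Gp_lnk; apply/idP/idP.
  have R := oconn_refl (@lnk_refl _ c); have Tr := oconn_trans (@lnk_trans _ c).
  move/(connect_hom R Tr (f := phi)); rewrite !phiO; apply=> w w'.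
  by case/stack_relP=> -[z -> ->].
by case/orP=> [/eqP->|/eqP<-]; [exact: connect0|].
Qed.

End Char.

Section StackTransfer.
Variables n1 n2 : nat.
Variables (a1 b1 : diag n1) (a2 b2 : diag n2).
Variables (psi : 'I_3 * 'I_n2 -> 'I_3 * 'I_n1) (phi : 'I_3 * 'I_n1 -> option ('I_3 * 'I_n2)).
Variable D : pred ('I_3 * 'I_n2).
Hypothesis psiA : forall v, conn a1 b1 (psi (embA v)) (psi (embA (val a2 v))).
Hypothesis psiB : forall v, conn a1 b1 (psi (embB v)) (psi (embB (val b2 v))).
Hypothesis phiA : forall v, oconn (conn a2 b2) (phi (embA v)) (phi (embA (val a1 v))).
Hypothesis phiB : forall v, oconn (conn a2 b2) (phi (embB v)) (phi (embB (val b1 v))).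
Hypothesis psiK : forall w, D w -> phi (psi w) = Some w.

Let psiE x y : stack_rel a2 b2 x y -> connect (stack_rel a1 b1) (psi x) (psi y).
Proof. by case/stack_relP=> -[v -> ->]; [apply: psiA|apply: psiB]. Qed.

Let phiE x y : stack_rel a1 b1 x y -> oconn (connect (stack_rel a2 b2)) (phi x) (phi y).
Proof. by case/stack_relP=> -[v -> ->]; [apply: phiA|apply: phiB]. Qed.

Let psiK' w : D w -> oconn (connect (stack_rel a2 b2)) (phi (psi w)) (Some w).
Proof. by move=> Dw; rewrite (psiK Dw) /= connect0. Qed.

Lemma stack_transfer w w' : D w -> D w' -> conn a1 b1 (psi w) (psi w') = conn a2 b2 w w'.
Proof. exact: (conn_transfer psiE phiE psiK' (stack_sym a2 b2)). Qed.

(** A middle vertex of the first graph that [psi] misses is connected to an outer vertex and lies in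
    no loop. So [psi] induces a bijection between the components inside the middle rows. *)
Lemma ell_transfer :
  (forall w, w.1 = r1 -> D w) ->
  (forall w w', phi w = Some w' -> w'.1 = r1 -> w.1 = r1) ->
  (forall w, (psi w).1 = r1 -> w.1 = r1) ->
  (forall i, (exists j, psi (r1, j) = (r1, i)) \/ (exists u, conn a1 b1 (r1, i) (embO u))) ->
  loops a1 b1 = loops a2 b2.
Proof.
move=> D1 phi1 psi1 cover; rewrite !ellE.
have inD w : w \in inner a2 b2 -> D w.
  by move/innerP=> iw; apply/D1/iw; apply: connect0.
apply: (ncl_transfer (psi := psi)); [exact: stack_sym|exact: stack_sym|..].
- move=> w iw; apply/innerP=> z /(phi_psi_conn phiE psiK' (stack_sym a2 b2) (inD _ iw)).
  by case E : (phi z) => [z'|] //= /(innerP _ _ _ iw); apply: phi1.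
- by move=> u v /inD Du /inD Dv; apply: stack_transfer.
- move=> [r i] ii; have /= r1 := innerP _ _ _ ii (r, i) (connect0 _ _).
  rewrite {r}r1 in ii *; case: (cover i) => [[j pj]|[u iu]]; last first.
    by have := innerP _ _ _ ii _ iu; case: u {iu}.
  exists (r1, j); last by rewrite pj connect0.
  apply/innerP=> w jw; apply: psi1; apply: (innerP _ _ _ ii).
  by rewrite -pj; apply: (psi_conn psiE).
Qed.

End StackTransfer.

(** * Contracting two stacked diagrams to their product *)

Section Contraction.
Variables (n : nat) (T : finType) (p q c : diag n) (e3 : rel ('I_3 * 'I_n)) (e4 : rel T).
Variables (embX embY : vtx n -> 'I_3 * 'I_n) (chi psi : 'I_3 * 'I_n -> T) (mid : pred T).
Hypothesis sym3 : connect_sym e3.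
Hypothesis sym4 : connect_sym e4.
Hypothesis e3X : forall v, connect e3 (embX v) (embX (val (dmul p q) v)).
Hypothesis e3Y : forall v, connect e3 (embY v) (embY (val c v)).
Hypothesis e3P : forall x y, e3 x y -> (exists2 v, x = embX v & y = embX (val (dmul p q) v)) \/
  (exists2 v, x = embY v & y = embY (val c v)).
Hypothesis e4chi : forall x y, stack_rel p q x y -> connect e4 (chi x) (chi y).
Hypothesis e4Y : forall v, connect e4 (psi (embY v)) (psi (embY (val c v))).
Hypothesis e4P : forall x y, e4 x y ->
  (exists x' y', [/\ x = chi x', y = chi y' & conn p q x' y']) \/
  (exists2 v, x = psi (embY v) & y = psi (embY (val c v))).
Hypothesis chi_inj : injective chi.
Hypothesis psi_inj : injective psi.
Hypothesis chiO : forall v, chi (embO v) = psi (embX v).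
Hypothesis chi_psi : forall x y, chi x = psi y -> exists v, x = embO v /\ y = embX v.
Hypothesis cover : forall z, (exists y, z = psi y) \/ (exists j, z = chi (r1, j)).
Hypothesis mid_psi : forall y, mid (psi y) = (y.1 == r1).
Hypothesis mid_chi : forall j, mid (chi (r1, j)).

(** Here e4 is the graph of three stacked diagrams, [chi] places the stack of p and q in it, and
    [psi] places the stack in which p and q are replaced by their product. The arcs of the product
    summarize the paths of e4 through p and q. *)
Lemma contract_conn w w' : connect e4 (psi w) (psi w') = connect e3 w w'.
Proof.
(* A vertex between p and q is moved to an outer vertex of its component, and forgotten when its
   component is a loop. *)
pose ph x := omap embX [pick u | conn p q x (embO u)].
pose phi z := if [pick y | z == psi y] is Some y then Some y
              else if [pick x | z == chi x] is Some x then ph x else None.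
have phpsi y : phi (psi y) = Some y.
  rewrite /phi; case: pickP => [y' /eqP/psi_inj->//|/(_ y)]; by rewrite eqxx.
have phE x y : conn p q x y -> oconn (connect e3) (ph x) (ph y).
  move=> xy; rewrite /ph; case: pickP => [u xu|nx]; case: pickP => [v yv|ny] //=; last first.
  - by have : conn p q x (embO v) := connect_trans xy yv; rewrite nx.
  - have yx : conn p q y x by rewrite conn_sym.
    by have : conn p q y (embO u) := connect_trans yx xu; rewrite ny.
  have : conn p q (embO u) (embO v).
    by rewrite conn_sym; apply: connect_trans xu; rewrite stack_sym; apply: connect_trans yv.
  by rewrite Gp_lnk => /orP[/eqP->|/eqP<-].
have phchi x : oconn (connect e3) (phi (chi x)) (ph x).
  rewrite /phi; case: pickP => [y /eqP/chi_psi[v [-> ->]]|_].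
    rewrite /ph; case: pickP => [u /=|/(_ v)]; last by rewrite /conn connect0.
    by rewrite Gp_lnk => /orP[/eqP->|/eqP<-].
  case: pickP => [x' /eqP/chi_inj->|/(_ x)]; last by rewrite eqxx.
  by apply: oconn_refl => z; apply: connect0.
have Tr := oconn_trans (@connect_trans _ e3).
apply: (@conn_transfer _ _ e4 e3 psi phi predT _ _ _ sym3) => //.
- move=> x y /e3P[] [v -> ->]; last exact: e4Y.
  by rewrite -!chiO; apply: (psi_conn e4chi); apply: conn_Gp.
- move=> x y /e4P[[x' [y' [-> -> xy]]]|[v -> ->]]; last by rewrite !phpsi; apply: e3Y.
  apply: (Tr _ _ _ (phchi x')); rewrite (oconn_sym sym3); apply: (Tr _ _ _ (phchi y')).
  by rewrite (oconn_sym sym3); apply: phE.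
- by move=> z _; rewrite phpsi /= connect0.
Qed.

Let In4 := [set z | [forall z', connect e4 z z' ==> mid z']].
Let In3 := [set w | [forall w', connect e3 w w' ==> (w'.1 == r1)]].

Let in4P z : reflect (forall z', connect e4 z z' -> mid z') (z \in In4).
Proof.
by rewrite inE; apply: (iffP forallP) => H z'; apply/implyP; apply: H.
Qed.

Let in3P w : reflect (forall w', connect e3 w w' -> w'.1 = r1) (w \in In3).
Proof.
by rewrite inE; apply: (iffP forallP) => H w'; [move/(implyP (H w'))/eqP|apply/implyP=> /H->].
Qed.

(** An inner component of e4 that meets the image of [psi] is an inner component of the contracted
    stack; one that avoids it is a loop already closed in the product of p and q. The set [I]
    separates the two kinds. *)
Lemma contract_ncl : ncl e4 In4 = ncl e3 In3 + loops p q.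
Proof.
pose I := [set z | [exists y, connect e4 z (psi y)]].
rewrite (@ncl_split _ _ I) //; last first.
  move=> x y; rewrite !inE => /existsP[z xz] xy; apply/existsP; exists z.
  by apply: connect_trans xz; rewrite sym4.
congr addn.
  apply: (ncl_transfer (psi := psi)) => // [u /in3P iu|u v _ _|x].
  - rewrite inE; apply/andP; split; last by rewrite inE; apply/existsP; exists u; apply: connect0.
    apply/in4P=> z; case: (cover z) => [[y ->]|[j ->]] //.
    by rewrite contract_conn mid_psi => /iu ->.
  - exact: contract_conn.
  - case/setIP=> /in4P ix; rewrite inE => /existsP[y xy]; exists y => //.
    apply/in3P=> w; rewrite -contract_conn => /(connect_trans xy)/ix.
    by rewrite mid_psi => /eqP.
rewrite ellE; apply: (ncl_transfer (psi := chi)) => //; first exact: stack_sym.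
- have out u z : u \in inner p q -> connect e4 (chi u) z -> exists2 z', z = chi z' & conn p q u z'.
    move=> iu; apply: (connect_ind (P := fun z => exists2 z', z = chi z' & conn p q u z')).
      by exists u => //; apply: connect0.
    move=> x y [x' -> ux] /e4P[[x1 [y1 [/chi_inj<- -> xy]]]|[v /chi_psi[o [xo _]] _]].
      by exists y1 => //; apply: connect_trans ux xy.
    by have := innerP _ _ _ iu _ ux; rewrite xo; case: (o).
  move=> u iu; rewrite inE; apply/andP; split.
    rewrite inE; apply/existsP=> -[y /(out _ _ iu)[z' /esym/chi_psi[v [-> _]]]].
    by move/(innerP _ _ _ iu); case: v.
  apply/in4P=> z /(out _ _ iu)[[r j] -> /(innerP _ _ _ iu) /= ->]; exact: mid_chi.
- move=> u v iu iv; apply/idP/idP; last exact: (psi_conn e4chi).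
  suff : connect e4 (chi u) (chi v) -> exists2 z', chi v = chi z' & conn p q u z'.
    by move=> H /H[z' /chi_inj <-].
  apply: (connect_ind (P := fun z => exists2 z', z = chi z' & conn p q u z')).
    by exists u => //; apply: connect0.
  move=> x y [x' -> ux] /e4P[[x1 [y1 [/chi_inj<- -> xy]]]|[w /chi_psi[o [xo _]] _]].
    by exists y1 => //; apply: connect_trans ux xy.
  by have := innerP _ _ _ iu _ ux; rewrite xo; case: (o).
- move=> x /setDP[_]; rewrite inE => nx; case: (cover x) nx => [[y ->]|[j ->]] nx.
    by case/existsP: nx; exists y; apply: connect0.
  exists (r1, j); last exact: connect0.
  apply/innerP=> w jw; apply/eqP; apply: contraNT nx => w1; apply/existsP.
  have [v vw] : exists v, w = embO v.
    by case: (stack_rowP w) w1 => -[i ->] //; [exists (inl i)|exists (inr i)].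
  by exists (embX v); rewrite -chiO -vw; apply: (psi_conn e4chi).
Qed.

End Contraction.

(** * Associativity of the product and of the loop count *)

Section Assoc.
Variable n : nat.
Implicit Types (a b c d : diag n) (u v : vtx n).

(** In the four rows of a over b over c, omitting row 3 or row 0 leaves the stack of a, b or of b,
    c. Omitting row 1 or row 2 leaves the stack of ab over c or of a over bc. *)
Definition skip_row (k : 'I_4) (w : 'I_3 * 'I_n) : 'I_4 * 'I_n := (lift k w.1, w.2).

Lemma skip_row_inj k : injective (skip_row k).
Proof.
by case=> r i [r' i'] E; have /= -> := congr1 snd E; have /= /lift_inj -> := congr1 fst E.
Qed.

Local Notation k1 := (Ordinal (isT : 1 < 4)).
Local Notation k2 := (Ordinal (isT : 2 < 4)).

Definition rel4 a b c : rel ('I_4 * 'I_n) := [rel z z' |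
  [|| [exists v, (z == skip_row ord_max (embA v)) && (z' == skip_row ord_max (embA (val a v)))],
      [exists v, (z == skip_row ord_max (embB v)) && (z' == skip_row ord_max (embB (val b v)))] |
      [exists v, (z == skip_row k1 (embB v)) && (z' == skip_row k1 (embB (val c v)))]]].

Definition mid4 (z : 'I_4 * 'I_n) := 0 < z.1 < 3.

Lemma skip_eqs v :
  [/\ skip_row ord0 (embA v) = skip_row ord_max (embB v),
      skip_row ord0 (embB v) = skip_row k1 (embB v),
      skip_row k2 (embA v) = skip_row ord_max (embA v),
      skip_row k1 (embA v) = skip_row ord_max (embO v) &
      skip_row k2 (embB v) = skip_row ord0 (embO v)].
Proof. by case: v => i; split; congr pair; apply: val_inj. Qed.

Lemma rel4_sym a b c : connect_sym (rel4 a b c).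
Proof.
apply: sym_connect_sym => z z' /=.
have H (f : vtx n -> 'I_4 * 'I_n) d x y :
    [exists v, (x == f v) && (y == f (val d v))] = [exists v, (y == f v) && (x == f (val d v))].
  by apply/existsP/existsP=> -[v /andP[/eqP-> /eqP->]]; exists (val d v); rewrite diagK !eqxx.
congr [|| _, _ | _].
- exact: (H (fun v => skip_row ord_max (embA v))).
- exact: (H (fun v => skip_row ord_max (embB v))).
- exact: (H (fun v => skip_row k1 (embB v))).
Qed.

Lemma rel4P a b c z z' : rel4 a b c z z' ->
  [\/ exists2 v, z = skip_row ord_max (embA v) & z' = skip_row ord_max (embA (val a v)),
      exists2 v, z = skip_row ord_max (embB v) & z' = skip_row ord_max (embB (val b v)) |
      exists2 v, z = skip_row k1 (embB v) & z' = skip_row k1 (embB (val c v))].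
Proof.
case/or3P=> /existsP[v /andP[/eqP-> /eqP->]].
by constructor 1; exists v. by constructor 2; exists v. by constructor 3; exists v.
Qed.

Lemma rel4A a b c v :
  rel4 a b c (skip_row ord_max (embA v)) (skip_row ord_max (embA (val a v))).
Proof. by apply/or3P; constructor 1; apply/existsP; exists v; rewrite !eqxx. Qed.

Lemma rel4B a b c v :
  rel4 a b c (skip_row ord_max (embB v)) (skip_row ord_max (embB (val b v))).
Proof. by apply/or3P; constructor 2; apply/existsP; exists v; rewrite !eqxx. Qed.

Lemma rel4C a b c v :
  rel4 a b c (skip_row k1 (embB v)) (skip_row k1 (embB (val c v))).
Proof. by apply/or3P; constructor 3; apply/existsP; exists v; rewrite !eqxx. Qed.

Lemma skip_max_1 w w' : skip_row ord_max w = skip_row k1 w' ->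
  exists v, w = embO v /\ w' = embA v.
Proof.
move=> E; have := congr1 (fun z => val z.1) E; have := congr1 snd E; clear E.
case: (stack_rowP w) (stack_rowP w') => -[i ->] [] [j ->] //= -> _.
  by exists (inl j).
by exists (inr j).
Qed.

Lemma skip_0_2 w w' : skip_row ord0 w = skip_row k2 w' ->
  exists v, w = embO v /\ w' = embB v.
Proof.
move=> E; have := congr1 (fun z => val z.1) E; have := congr1 snd E; clear E.
case: (stack_rowP w) (stack_rowP w') => -[i ->] [] [j ->] //= -> _.
  by exists (inl j).
by exists (inr j).
Qed.

Lemma row4P (z : 'I_4 * 'I_n) :
  [\/ z = skip_row k1 (r0, z.2), z = skip_row k2 (r1, z.2),
      z = skip_row k1 (r1, z.2) | z = skip_row k1 (r2, z.2)].
Proof.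
case: z => [[[|[|[|[|//]]]] k] i];
  [constructor 1|constructor 2|constructor 3|constructor 4]; congr pair; exact: val_inj.
Qed.

Section Contract.
Variables a b c : diag n.
Let R := rel4 a b c.

Lemma contract_left :
  (forall w w', connect R (skip_row k1 w) (skip_row k1 w') = conn (dmul a b) c w w') /\
  ncl R [set z | [forall z', connect R z z' ==> mid4 z']] = loops (dmul a b) c + loops a b.
Proof.
have e4chi x y : stack_rel a b x y -> connect R (skip_row ord_max x) (skip_row ord_max y).
  by case/stack_relP=> -[v -> ->]; apply: connect1; [apply: rel4A|apply: rel4B].
have e4P x y : R x y ->
  (exists x' y', [/\ x = skip_row ord_max x', y = skip_row ord_max y' & conn a b x' y']) \/
  (exists2 v, x = skip_row k1 (embB v) & y = skip_row k1 (embB (val c v))).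
  case/rel4P=> -[v -> ->]; [left|left|right]; last by exists v.
    by exists (embA v), (embA (val a v)); split=> //; apply: connA.
  by exists (embB v), (embB (val b v)); split=> //; apply: connB.
have chiO v : skip_row ord_max (embO v) = skip_row k1 (embA v) by case: (skip_eqs v).
have e4Y v : connect R (skip_row k1 (embB v)) (skip_row k1 (embB (val c v))).
  exact/connect1/rel4C.
split.
  move=> w w'; apply: (contract_conn (stack_sym (dmul a b) c) (connA (dmul a b) c)
    (connB (dmul a b) c) (@stack_relP _ _ _) e4chi e4Y e4P) => //; try exact: skip_row_inj.
  exact: skip_max_1.
rewrite ellE; apply: (contract_ncl (stack_sym (dmul a b) c) (rel4_sym a b c) (connA (dmul a b) c)
    (connB (dmul a b) c) (@stack_relP _ _ _) e4chi e4Y e4P) => //; try exact: skip_row_inj.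
- exact: skip_max_1.
- move=> z; case: (row4P z) => zE; last 2 first.
  + by left; exists (r1, z.2).
  + by left; exists (r2, z.2).
  + by left; exists (r0, z.2).
  + by right; exists z.2; rewrite zE; congr pair; apply: val_inj.
- by move=> y; case: (stack_rowP y) => -[i ->].
Qed.

Lemma contract_right :
  (forall w w', connect R (skip_row k2 w) (skip_row k2 w') = conn a (dmul b c) w w') /\
  ncl R [set z | [forall z', connect R z z' ==> mid4 z']] = loops a (dmul b c) + loops b c.
Proof.
have qA v : skip_row ord0 (embA v) = skip_row ord_max (embB v) by case: (skip_eqs v).
have qB v : skip_row ord0 (embB v) = skip_row k1 (embB v) by case: (skip_eqs v).
have qC v : skip_row k2 (embA v) = skip_row ord_max (embA v) by case: (skip_eqs v).
have e4chi x y : stack_rel b c x y -> connect R (skip_row ord0 x) (skip_row ord0 y).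
  case/stack_relP=> -[v -> ->]; apply: connect1; rewrite ?qA ?qB;
    [apply: rel4B|apply: rel4C].
have e4P x y : R x y ->
  (exists x' y', [/\ x = skip_row ord0 x', y = skip_row ord0 y' & conn b c x' y']) \/
  (exists2 v, x = skip_row k2 (embA v) & y = skip_row k2 (embA (val a v))).
  case/rel4P=> -[v -> ->]; [right|left|left]; first by exists v; rewrite qC.
    by exists (embA v), (embA (val b v)); rewrite !qA; split=> //; apply: connA.
  by exists (embB v), (embB (val c v)); rewrite !qB; split=> //; apply: connB.
have chiO v : skip_row ord0 (embO v) = skip_row k2 (embB v) by case: (skip_eqs v).
have e4Y v : connect R (skip_row k2 (embA v)) (skip_row k2 (embA (val a v))).
  by rewrite !qC; apply/connect1/rel4A.
have sP x y : stack_rel a (dmul b c) x y ->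
    (exists2 v, x = embB v & y = embB (val (dmul b c) v)) \/
    (exists2 v, x = embA v & y = embA (val a v)).
  by case/stack_relP; [right|left].
split.
  move=> w w'; apply: (contract_conn (stack_sym a (dmul b c)) (connB a (dmul b c))
    (connA a (dmul b c)) sP e4chi e4Y e4P) => //; try exact: skip_row_inj.
  exact: skip_0_2.
rewrite ellE; apply: (contract_ncl (stack_sym a (dmul b c)) (rel4_sym a b c) (connB a (dmul b c))
    (connA a (dmul b c)) sP e4chi e4Y e4P) => //; try exact: skip_row_inj.
- exact: skip_0_2.
- move=> z; case: (row4P z) => zE.
  + by left; exists (r0, z.2); rewrite zE; congr pair; apply: val_inj.
  + by left; exists (r1, z.2).
  + by right; exists z.2; rewrite zE; congr pair; apply: val_inj.
  + by left; exists (r2, z.2); rewrite zE; congr pair; apply: val_inj.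
- by move=> y; case: (stack_rowP y) => -[i ->].
Qed.

End Contract.

Lemma GpA a b c : dmul (dmul a b) c = dmul a (dmul b c).
Proof.
apply: lnk_ext => u v; rewrite -!Gp_lnk -(proj1 (contract_left a b c)) -(proj1 (contract_right a b c)).
congr connect; [case: u|case: v] => i; congr pair; exact: val_inj.
Qed.

(** Both sides count the inner components of the same four-row graph, which is the exponent of x in
    the triple product. *)
Lemma ellA a b c : loops a b + loops (dmul a b) c = loops b c + loops a (dmul b c).
Proof. rewrite addnC [RHS]addnC; by rewrite -(proj2 (contract_left a b c)) (proj2 (contract_right a b c)). Qed.

End Assoc.

(** * Adding and moving vertices *)

Section Eps.
Variable n : nat.
Implicit Types (a b d : diag n) (v : vtx n).

Lemma vtxSP (w : vtx n.+1) :
  [\/ exists v, w = liftv v, w = inl ord_max | w = inr ord_max].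
Proof.
case: w => i; case: (unliftP ord_max i) => [j ->|->].
- by constructor 1; exists (inl j).
- by constructor 2.
- by constructor 1; exists (inr j).
- by constructor 3.
Qed.

Definition eps_fun d (w : vtx n.+1) : vtx n.+1 :=
  match w with
    | inl i => match unlift ord_max i with
               | Some j => liftv (val d (inl j)) | None => inr ord_max end
    | inr i => match unlift ord_max i with
               | Some j => liftv (val d (inr j)) | None => inl ord_max end end.

Lemma eps_fun_lift d v : eps_fun d (liftv v) = liftv (val d v).
Proof. by case: v => i /=; rewrite liftK. Qed.

Lemma epsE d : val (eps d) =1 eps_fun d.
Proof.
apply: (mkdiagE (f := eps_fun d)) => w; case: (vtxSP w) => [[v ->]|->|->].
- by rewrite !eps_fun_lift diagK.
- by rewrite /eps_fun unlift_none /= unlift_none.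
- by rewrite /eps_fun unlift_none /= unlift_none.
Qed.

Lemma eps_lift d v : val (eps d) (liftv v) = liftv (val d v).
Proof. by rewrite epsE eps_fun_lift. Qed.

Lemma eps_top d : val (eps d) (inl ord_max) = inr ord_max.
Proof. by rewrite epsE /eps_fun unlift_none. Qed.

Lemma eps_bot d : val (eps d) (inr ord_max) = inl ord_max.
Proof. by rewrite epsE /eps_fun unlift_none. Qed.

Lemma liftv_inj : injective (@liftv n).
Proof.
by case=> i [j|j] // [] E; congr (_ _); apply: (@lift_inj _ ord_max); apply: val_inj.
Qed.

Lemma liftv_max v : (liftv v != inl ord_max) * (liftv v != inr ord_max).
Proof.
have H (i : 'I_n) : lift ord_max i <> ord_max by apply/eqP; rewrite eq_sym neq_lift.
by split; apply/eqP; case: v => i // E; apply: (H i); apply: val_inj; case: E.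
Qed.

Definition lift_col (w : 'I_3 * 'I_n) : 'I_3 * 'I_n.+1 := (w.1, lift ord_max w.2).
Definition unlift_col (w : 'I_3 * 'I_n.+1) : option ('I_3 * 'I_n) :=
  omap (pair w.1) (unlift ord_max w.2).

Lemma lift_colA v : lift_col (embA v) = embA (liftv v). Proof. by case: v. Qed.
Lemma lift_colB v : lift_col (embB v) = embB (liftv v). Proof. by case: v. Qed.
Lemma lift_colO v : lift_col (embO v) = embO (liftv v). Proof. by case: v. Qed.
Lemma lift_colK w : unlift_col (lift_col w) = Some w.
Proof. by case: w => r i; rewrite /unlift_col /= liftK. Qed.

Section Mul.
Variables a b : diag n.

Let psiA v : conn (eps a) (eps b) (lift_col (embA v)) (lift_col (embA (val a v))).
Proof. by rewrite !lift_colA -eps_lift; apply: connA. Qed.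

Let psiB v : conn (eps a) (eps b) (lift_col (embB v)) (lift_col (embB (val b v))).
Proof. by rewrite !lift_colB -eps_lift; apply: connB. Qed.

Let phiA w : oconn (conn a b) (unlift_col (embA w)) (unlift_col (embA (val (eps a) w))).
Proof.
case: (vtxSP w) => [[v ->]|->|->].
- by rewrite eps_lift -!lift_colA !lift_colK; apply: connA.
- by rewrite eps_top /unlift_col /= unlift_none.
- by rewrite eps_bot /unlift_col /= unlift_none.
Qed.

Let phiB w : oconn (conn a b) (unlift_col (embB w)) (unlift_col (embB (val (eps b) w))).
Proof.
case: (vtxSP w) => [[v ->]|->|->].
- by rewrite eps_lift -!lift_colB !lift_colK; apply: connB.
- by rewrite eps_top /unlift_col /= unlift_none.
- by rewrite eps_bot /unlift_col /= unlift_none.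
Qed.

Let colK w : predT w -> unlift_col (lift_col w) = Some w.
Proof. by rewrite lift_colK. Qed.

Let conn_max : conn (eps a) (eps b) (r1, ord_max) (embO (inl ord_max)).
Proof. by have := connA (eps a) (eps b) (inr ord_max); rewrite eps_bot. Qed.

Let conn_max2 : conn (eps a) (eps b) (r1, ord_max) (embO (inr ord_max)).
Proof. by have := connB (eps a) (eps b) (inl ord_max); rewrite eps_top. Qed.

Let conn_io : conn (eps a) (eps b) (embO (inl ord_max)) (embO (inr ord_max)).
Proof. by apply: connect_trans conn_max2; rewrite stack_sym; apply: conn_max. Qed.

(** The last column of the stack is a path of its own from top to bottom. [unlift_col] forgets it,
    and the remaining columns form the stack of a and b. *)
Lemma Gp_eps : dmul (eps a) (eps b) = eps (dmul a b).
Proof.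
have mx (u v : vtx n.+1) : lnk (dmul (eps a) (eps b)) u v -> u != v -> val (dmul (eps a) (eps b)) u = v.
  by rewrite /lnk eq_sym => /orP[->|/eqP].
apply: diag_ext => w; case: (vtxSP w) => [[v ->]|->|->].
- rewrite eps_lift; have [E|ne] := eqVneq (val (dmul a b) v) v; last first.
    apply: mx; last by rewrite (inj_eq liftv_inj) eq_sym.
    rewrite -Gp_lnk -!lift_colO (stack_transfer psiA psiB phiA phiB colK) //.
    exact: conn_Gp.
  rewrite E; case: (vtxSP (val (dmul (eps a) (eps b)) (liftv v))) => [[u vu]|vu|vu].
  + have := conn_Gp (eps a) (eps b) (liftv v); rewrite vu -!lift_colO.
    rewrite (stack_transfer psiA psiB phiA phiB colK) // Gp_lnk /lnk E.
    by case/orP=> /eqP->.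
  + have := diagK (dmul (eps a) (eps b)) (liftv v); rewrite vu.
    rewrite (mx _ (inr ord_max)) //; last by rewrite -Gp_lnk.
    by move/esym/eqP; rewrite (negPf (liftv_max v).2).
  + have := diagK (dmul (eps a) (eps b)) (liftv v); rewrite vu.
    rewrite (mx _ (inl ord_max)) //; last by rewrite -Gp_lnk conn_sym.
    by move/esym/eqP; rewrite (negPf (liftv_max v).1).
- by rewrite eps_top; apply: mx; rewrite // -Gp_lnk.
- by rewrite eps_bot; apply: mx; rewrite // -Gp_lnk conn_sym.
Qed.

Lemma ell_eps : loops (eps a) (eps b) = loops a b.
Proof.
apply: (ell_transfer psiA psiB phiA phiB colK) => // [[r i] w|i].
  by rewrite /unlift_col /=; case: unliftP => [j _|//] /= [<-].
case: (unliftP ord_max i) => [j ->|->]; [left|right]; first by exists j.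
by exists (inl ord_max); apply: conn_max.
Qed.

End Mul.
End Eps.

Section Pull.
Variables (n n' : nat) (j : vtx n -> vtx n') (k : vtx n' -> option (vtx n)).
Hypothesis jK : forall v, k (j v) = Some v.
Hypothesis kK : forall w v, k w = Some v -> w = j v.

(** An arc that leaves the image of [j] is cut, and [push] isolates the vertices outside the image.
    The two are inverse to each other on diagrams satisfying [fixes_out]. *)
Definition pull (d : diag n') : diag n := mkdiag (fun v => odflt v (k (val d (j v)))).
Definition push (d : diag n) : diag n' := mkdiag (fun w => if k w is Some v then j (val d v) else w).

Lemma pullE d v : val (pull d) v = odflt v (k (val d (j v))).
Proof.
rewrite mkdiagE // => u; case E: (k _) => [u'|] /=; last by rewrite E.
by rewrite -(kK E) diagK jK.
Qed.

Lemma push_in d v : val (push d) (j v) = j (val d v).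
Proof.
rewrite mkdiagE ?jK // => u; case E: (k u) => [u'|]; last by rewrite E.
by rewrite jK diagK (kK E).
Qed.

Lemma push_out d w : k w = None -> val (push d) w = w.
Proof.
move=> kw; rewrite mkdiagE ?kw // => u; case E: (k u) => [u'|]; last by rewrite E.
by rewrite jK diagK (kK E).
Qed.

Definition fixes_out (d : diag n') := forall w, k w = None -> val d w = w.

Lemma pull_fix d v : fixes_out d -> j (val (pull d) v) = val d (j v).
Proof.
move=> fd; rewrite pullE; case E: (k _) => [u|] /=; first by rewrite -(kK E).
by have := fd _ E; rewrite diagK => <-.
Qed.

Let j_inj : injective j.
Proof. by move=> u v uv; apply: Some_inj; rewrite -!jK uv. Qed.

Lemma pull_push d : pull (push d) = d.
Proof. by apply: diag_ext => v; rewrite pullE push_in jK. Qed.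

Lemma push_pull d : fixes_out d -> push (pull d) = d.
Proof.
move=> fd; apply: diag_ext => w; case E: (k w) => [v|]; last by rewrite push_out // fd.
by rewrite (kK E) push_in pull_fix.
Qed.

Lemma pull_lnk (D : diag n') (C : diag n) : fixes_out D ->
  (forall u v, lnk D (j u) (j v) = lnk C u v) -> pull D = C.
Proof.
move=> fD H; apply: lnk_ext => u v; rewrite -H /lnk (inj_eq j_inj).
by rewrite -(inj_eq j_inj (val (pull D) u)) pull_fix.
Qed.

End Pull.

Section Bottoms.
Variable n : nat.
Implicit Types (a b d : diag n).

(** A bottom vertex has no edges but those of the lower factor. The case i = j says that isolated
    bottom vertices stay isolated. *)
Lemma Gp_bot a b i j : val b (inr i) = inr j -> val (dmul a b) (inr i) = inr j.
Proof.
move=> bi; have [ij|ij] := eqVneq i j; last first.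
  have : conn a b (embO (inr i)) (embO (inr j)).
    by have := connB a b (inr i); rewrite bi.
  by rewrite Gp_lnk /lnk => /orP[/eqP[E]|/eqP //]; rewrite E eqxx in ij.
rewrite -{}ij in bi *; have := conn_Gp a b (inr i).
suff H w : conn a b (embO (inr i)) w -> w = embO (inr i) by move/H/(@embO_inj _).
apply: (connect_ind (P := fun w => w = embO (inr i))) => // u v -> /stack_relP[] [] [z|z] // [<-].
by rewrite bi => ->.
Qed.

End Bottoms.

(** * Turning the last top vertex into a bottom vertex *)

Section Slide.
Variable n : nat.

Definition slv (v : vtx n.+1) : vtx n.+2 :=
  match v with
  | inl i => inl (lift ord_max i)
  | inr i => if unlift ord_max i is Some j then inr (lift ord_max (lift ord_max j))
             else inl ord_max
  end.

Definition slk (w : vtx n.+2) : option (vtx n.+1) :=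
  match w with
  | inl i => Some (if unlift ord_max i is Some j then inl j else inr ord_max)
  | inr i => if obind (unlift ord_max) (unlift ord_max i) is Some j
             then Some (inr (lift ord_max j)) else None
  end.

Lemma slvK v : slk (slv v) = Some v.
Proof.
case: v => i /=; first by rewrite liftK.
case: (unliftP ord_max i) => [j ->|->] /=; last by rewrite unlift_none.
by rewrite !liftK /= liftK.
Qed.

Lemma slkK w v : slk w = Some v -> w = slv v.
Proof.
case: w => i /=; first by case: (unliftP ord_max i) => [j ->|->] [<-] //=; rewrite unlift_none.
case: (unliftP ord_max i) => [j ->|->] //=.
by case: (unliftP ord_max j) => [l ->|->] //= [<-] /=; rewrite liftK.
Qed.

(* The top vertex n+1 becomes the bottom vertex n; the bottom vertices n, n+1,
   isolated in all uses, are dropped. *)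
Definition slide : diag n.+2 -> diag n.+1 := pull slv slk.
Definition unslide : diag n.+1 -> diag n.+2 := push slv slk.

Variables (b : diag n.+1) (d : diag n.+2).
Hypothesis fd : fixes_out slk d.

(** [eps b] joins the top and the middle vertex of the last column. [phi] sends both to the bottom
    vertex [ord_max], and [psi] selects the top one of the two. *)
Let psi (w : 'I_3 * 'I_n.+1) : 'I_3 * 'I_n.+2 :=
  if w.1 == r2 then embO (slv (inr w.2)) else (w.1, lift ord_max w.2).
Let phi (w : 'I_3 * 'I_n.+2) : option ('I_3 * 'I_n.+1) :=
  if w.1 == r2 then omap (@embO _) (slk (inr w.2))
  else Some (if unlift ord_max w.2 is Some j then (w.1, j) else (r2, ord_max)).

Let psi_embA v : psi (embA v) = embA (liftv v). Proof. by case: v. Qed.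
Let psi_embO v : psi (embO v) = embO (slv v). Proof. by case: v. Qed.
Let psi_embB v : conn (eps b) d (psi (embB v)) (embB (slv v)).
Proof.
case: v => i; first exact: connect0.
rewrite /psi /=; case: unliftP => [j _|_] /=; first exact: connect0.
by have := connA (eps b) d (inl ord_max); rewrite eps_top.
Qed.
Let phi_embB w : phi (embB w) = omap (@embB _) (slk w).
Proof.
by case: w => i; rewrite /phi /=; [|case: (obind _ _)] => //; case: unlift.
Qed.

Let psiA v : conn (eps b) d (psi (embA v)) (psi (embA (val b v))).
Proof. by rewrite !psi_embA -eps_lift; apply: connA. Qed.

Let psiB v : conn (eps b) d (psi (embB v)) (psi (embB (val (slide d) v))).
Proof.
apply: connect_trans (psi_embB v) _; rewrite stack_sym.
apply: connect_trans (psi_embB _) _; rewrite (pull_fix slvK slkK v fd) stack_sym.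
exact: connB.
Qed.

Let phiA w : oconn (conn b (slide d)) (phi (embA w)) (phi (embA (val (eps b) w))).
Proof.
have phiL v : phi (embA (liftv v)) = Some (embA v).
  by case: v => i; rewrite /phi /= liftK.
case: (vtxSP w) => [[v ->]|->|->].
- by rewrite eps_lift !phiL; apply: connA.
- by rewrite eps_top /phi /= !unlift_none /= /conn connect0.
- by rewrite eps_bot /phi /= !unlift_none /= /conn connect0.
Qed.

Let phiB w : oconn (conn b (slide d)) (phi (embB w)) (phi (embB (val d w))).
Proof.
rewrite !phi_embB; case E: (slk w) => [v|]; last by rewrite fd // E.
by rewrite (slkK E) -(pull_fix slvK slkK v fd) slvK; apply: connB.
Qed.

Let phiK w : predT w -> phi (psi w) = Some w.
Proof.
move=> _; case: (stack_rowP w) => -[i ->]; rewrite /phi /psi /= ?liftK //.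
case: (unliftP ord_max i) => [j ->|->] /=; last by rewrite unlift_none.
by rewrite liftK /= liftK.
Qed.

Lemma slide_fixes : fixes_out slk (dmul (eps b) d).
Proof. by case=> i // ki; apply: Gp_bot; apply: fd. Qed.

(** The last arc of [eps b] merely prolongs the last top vertex of d. Once this vertex is counted as
    a bottom vertex, [eps b] acts as b. *)
Lemma slide_Gp : slide (dmul (eps b) d) = dmul b (slide d).
Proof.
apply: (pull_lnk slvK slkK slide_fixes) => u v.
by rewrite -!Gp_lnk -!psi_embO (stack_transfer psiA psiB phiA phiB phiK).
Qed.

Lemma slide_ell : loops (eps b) d = loops b (slide d).
Proof.
apply: (ell_transfer psiA psiB phiA phiB phiK) => //.
- move=> w w'; case: (stack_rowP w) => -[i ->]; rewrite /phi //=.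
    by case: unliftP => [j _|_] [<-].
  by case: (obind _ _) => [j|] //= [<-].
- by move=> w; case: (stack_rowP w) => -[i ->] //; rewrite /psi /=; case: unlift.
- move=> i; case: (unliftP ord_max i) => [j ->|->]; [left|right]; first by exists j.
  by exists (inl ord_max); have := connA (eps b) d (inr ord_max); rewrite eps_bot.
Qed.

End Slide.

Definition isl (A B : Type) (v : A + B) := if v is inl _ then true else false.

(** * Right multiplication by permutations and by diagrams copying a bottom row *)

Section RightMul.
Variable N : nat.
Implicit Types (a b c d : diag N) (s : 'S_N) (u v : vtx N) (i j : 'I_N).

Lemma pdiagE s v : val (pdiag s) v = 
  match v with inl i => inr (s i) | inr j => inl ((s^-1)%g j) end.
Proof. by rewrite mkdiagE // => -[i|i]; rewrite ?permK ?permKV. Qed.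

Definition rl s v : vtx N := if v is inr j then inr (s j) else v.

Lemma rlK s : cancel (rl s) (rl s^-1).
Proof. by case=> i //=; rewrite permK. Qed.

Lemma rlVK s : cancel (rl s^-1) (rl s).
Proof. by case=> i //=; rewrite permKV. Qed.

Lemma Gp_pdiag d s u : val (dmul d (pdiag s)) (rl s u) = rl s (val d u).
Proof.
pose f v := rl s (val d (rl s^-1 v)).
have fK : involutive f by move=> v; rewrite /f rlK diagK rlVK.
have cE := mkdiagE fK; rewrite -/(mkdiag f) in cE.
pose phi (w : 'I_3 * 'I_N) := Some (if w.1 == r0 then inl w.2
   else if w.1 == r1 then inr (s w.2) else inr w.2 : vtx N).
have phiA' v : phi (embA v) = Some (rl s v) by case: v.
have conn1 v : conn d (pdiag s) (embA v) (embO (rl s v)).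
  case: v => i /=; first exact: connect0.
  by have := connB d (pdiag s) (inl i); rewrite pdiagE.
rewrite (Gp_char (c := mkdiag f) (phi := phi)) ?cE /f ?rlK //.
- by case.
- by move=> v; rewrite !phiA' /= /lnk cE /f rlK eqxx orbT.
- by case=> i; rewrite pdiagE /= /lnk ?permKV eqxx.
- move=> v; rewrite cE /f -{1}(rlVK s v).
  apply: connect_trans (conn1 _); rewrite stack_sym.
  by apply: connect_trans (conn1 _); rewrite stack_sym; apply: connA.
Qed.

Lemma ell_pdiag d s : loops d (pdiag s) = 0.
Proof.
by apply: ell0 => j; exists (inr (s j)); have := connB d (pdiag s) (inl j); rewrite pdiagE.
Qed.

(** The group product applies s first, as the stack does when read downwards, so permutations act on
    diagrams from the right without inverses. *)
Lemma Gp_pdiagM d s t : dmul (dmul d (pdiag s)) (pdiag t) = dmul d (pdiag (s * t)%g).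
Proof.
have E u : rl (s * t) u = rl t (rl s u) by case: u => //= i; rewrite permM.
apply: diag_ext => v; rewrite -[v](rlVK (s * t)%g); move: (rl _ v) => u.
by rewrite [RHS]Gp_pdiag !E (Gp_pdiag _ t) (Gp_pdiag _ s).
Qed.

Lemma Gp_pdiag1 d : dmul d (pdiag 1) = d.
Proof.
have E u : rl 1 u = u by case: u => //= i; rewrite perm1.
by apply: diag_ext => v; rewrite -{1}(E v) Gp_pdiag E.
Qed.

(* Here b copies the bottom row of c: it is vertical except on H, and on H its
   bottom row agrees with that of c. *)
Lemma Gp_copy c b (H : pred 'I_N) :
  (forall i, H i -> exists j, [/\ val c (inr i) = inr j, H j & val b (inr i) = inr j]) ->
  (forall i, H i -> exists2 j, val b (inl i) = inl j & H j) ->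
  (forall i, ~~ H i -> val b (inl i) = inr i) ->
  dmul c b = c.
Proof.
move=> h1 h2 h3.
pose phi (w : 'I_3 * 'I_N) := if w.1 == r0 then Some (inl w.2)
   else if w.1 == r1 then (if H w.2 then None else Some (inr w.2)) else Some (inr w.2 : vtx N).
have bV i : ~~ H i -> val b (inr i) = inl i by move/h3=> <-; rewrite diagK.
have conn1 i : ~~ H i -> conn c b (r1, i) (r2, i).
  by move=> Hi; have := connB c b (inl i); rewrite h3.
have cH i j : val c (inr i) = inr j -> H i = H j.
  move=> ci; apply/idP/idP=> [/h1[l []]|/h1[l []]]; rewrite ?ci; first by case=> <-.
  by rewrite -ci diagK => -[<-].
apply: (Gp_char (phi := phi)).
- by case.
- case=> i /=; case E : (val c _) => [j|j]; rewrite /phi /=.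
  + by rewrite /lnk E eqxx orbT.
  + case: ifP => [/h1[l []]|_]; last by rewrite /= /lnk E eqxx orbT.
    by have := diagK c (inl i); rewrite E => ->.
  + case: ifP => [/h1[l []]|_]; last by rewrite /= /lnk E eqxx orbT.
    by rewrite E.
  + by rewrite (cH _ _ E); case: ifP => //= _; rewrite /lnk E eqxx orbT.
- case=> i; have [Hi|Hi] := boolP (H i).
  + by have [j -> Hj] := h2 i Hi; rewrite /phi /= Hi Hj.
  + by rewrite h3 // /phi /= (negPf Hi) /= /lnk eqxx.
  + have [j [ci Hj ->]] := h1 i Hi; by rewrite /phi /= /lnk ci eqxx orbT.
  + by rewrite bV // /phi /= (negPf Hi) /= /lnk eqxx.
have half i : ~~ H i -> conn c b (r2, i) (embO (val c (inr i))).
  move=> Hi; have ci := connA c b (inr i).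
  have c2 : conn c b (r2, i) (embA (val c (inr i))).
    by apply: connect_trans ci; rewrite stack_sym; apply: conn1.
  case E : (val c (inr i)) => [j|j]; rewrite E in c2; first exact: c2.
  by apply: connect_trans c2 _; apply: conn1; rewrite -(cH _ _ E).
case=> i.
  have ci := connA c b (inl i); case E : (val c (inl i)) => [j|j]; rewrite E in ci.
    exact: ci.
  have Ej : val c (inr j) = inl i by rewrite -E diagK.
  rewrite conn_sym /= -[(r0, i)]/(embO (inl i)) -Ej; apply: half.
  by apply/negP=> /h1[l []]; rewrite Ej.
have [Hi|/half//] := boolP (H i).
by have [j [-> Hj bi]] := h1 i Hi; have := connB c b (inr i); rewrite bi.
Qed.

Lemma udiagE m v : val (udiag N m) v = match v with
    | inl i => if (i < m)%N then inr i else inl i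
    | inr i => if (i < m)%N then inl i else inr i end.
Proof.
rewrite mkdiagE // => u; case: u => i; case E: (i < m) => //=; rewrite E //.
Qed.

(** Each middle vertex in H is isolated on both sides and forms a loop alone; every other middle
    vertex reaches the bottom row through b. *)
Lemma ell_copy c b (H : pred 'I_N) :
  (forall i, H i -> val c (inr i) = inr i /\ val b (inl i) = inl i) ->
  (forall i, ~~ H i -> val b (inl i) = inr i) ->
  loops c b = #|[set i | H i]|.
Proof.
move=> h1 h2; rewrite ellE.
have E : inner c b = [set (r1, i) | i in [set i | H i]].
  have one i w : H i -> conn c b (r1, i) w -> w = (r1, i).
    move=> Hi; apply: (connect_ind (P := fun w => w = (r1, i))) => // u v ->.
    have [ci bi] := h1 i Hi.
    by case/stack_relP=> [] [] [z|z] // [<-] ->; rewrite ?ci ?bi.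
  apply/setP=> w; apply/idP/imsetP=> [iw|[i]].
    have := innerP _ _ _ iw w (connect0 _ _); case: w iw => r i iw /= r1E; subst r.
    exists i => //; rewrite inE; apply: contraT => /h2 bi.
    by have := connB c b (inl i); rewrite bi => /(innerP _ _ _ iw).
  by rewrite inE => Hi ->; apply/innerP=> w' /(one _ _ Hi) ->.
rewrite /ncl E -imset_comp card_in_imset // => i j; rewrite !inE /= => Hi Hj.
move/eqP; rewrite cls_eq; last exact: stack_sym.
have one w : conn c b (r1, i) w -> w = (r1, i).
  apply: (connect_ind (P := fun w => w = (r1, i))) => // u v ->.
  have [ci bi] := h1 i Hi.
  by case/stack_relP=> [] [] [z|z] // [<-] ->; rewrite ?ci ?bi.
by move/one=> [->].
Qed.

(** Exchanges the left action of S_m on the generator [udiag] with the right action, the one over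
    which the tensor product is taken. *)
Lemma Gp_pdiag_udiag s m : (forall i : 'I_N, m <= i -> s i = i) ->
  dmul (pdiag s) (udiag N m) = dmul (udiag N m) (pdiag s).
Proof.
move=> sm; set c := RHS.
have slt i : (s i < m) = (i < m).
  apply/idP/idP; apply: contraTT; rewrite -!leqNgt => mi; first by rewrite sm.
  by rewrite -(perm_inj (sm _ mi)).
have cE v : val c v = match v with
    | inl i => if (i < m)%N then inr (s i) else inl i
    | inr i => if (i < m)%N then inl (s^-1 i)%g else inr i end.
  rewrite -[v](rlVK s) Gp_pdiag udiagE; case: v => i /=; first by case: ifP.
  have := slt (s^-1 i)%g; rewrite permKV => ->; case: ifP => //=; by rewrite permKV.
pose phi (w : 'I_3 * 'I_N) := Some (if w.1 == r0 then inl w.2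
   else if w.1 == r1 then (if w.2 < m then inr w.2 else inl w.2) else inr w.2 : vtx N).
have up i : i < m -> conn (pdiag s) (udiag N m) (r0, i) (r2, s i).
  move=> im; have := connA (pdiag s) (udiag N m) (inl i); rewrite pdiagE => /connect_trans; apply.
  by have := connB (pdiag s) (udiag N m) (inl (s i)); rewrite udiagE slt im.
apply: (Gp_char (phi := phi)).
- by case.
- have A i : lnk c (inl i) (if s i < m then inr (s i) else inl (s i)).
    rewrite /lnk cE slt; case: ifP => [_|/negbT im]; rewrite ?eqxx ?orbT //.
    by rewrite sm ?eqxx // leqNgt.
  case=> i; rewrite pdiagE /phi /= //.
  by have := A (s^-1 i)%g; rewrite permKV lnk_sym.
- by case=> i; rewrite udiagE; case: ifP => im; rewrite /phi /= ?im /lnk eqxx.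
- case=> i; rewrite cE; case: ifP => im; try exact: connect0; first exact: up.
  rewrite conn_sym -{2}(permKV s i); apply: up.
  by rewrite -slt permKV.
Qed.

Lemma ell_pdiagl s d : loops (pdiag s) d = 0.
Proof.
apply: ell0 => j; exists (inl (s^-1 j)%g).
by have := connA (pdiag s) d (inr j); rewrite pdiagE.
Qed.

End RightMul.

(** * Cutting and adding arcs in the bottom row *)

Section Forget.
Variable N : nat.
Implicit Types (b d : diag N) (Y : pred 'I_N).

Definition bot Y (v : vtx N) := if v is inr i then Y i else false.

Definition forget Y d : diag N :=
  mkdiag (fun v => if bot Y v || bot Y (val d v) then v else val d v).

Lemma forgetE Y d v :
  val (forget Y d) v = if bot Y v || bot Y (val d v) then v else val d v.
Proof.
rewrite mkdiagE // => u.
case E: (bot Y u || bot Y (val d u)); first by rewrite E.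
by rewrite diagK orbC E.
Qed.

Definition closed_bot Y d := forall i, Y i -> exists2 j, Y j & val d (inr i) = inr j.

Lemma closed_botE Y d v : closed_bot Y d -> bot Y (val d v) = bot Y v.
Proof.
move=> cY; have H u : bot Y u -> bot Y (val d u).
  by case: u => // i /cY[j Yj ->].
by apply/idP/idP=> /H //; rewrite diagK.
Qed.

Lemma forget_out Y d v : closed_bot Y d -> ~~ bot Y v -> val (forget Y d) v = val d v.
Proof. by move=> cY Yv; rewrite forgetE closed_botE // orbb (negPf Yv). Qed.

Lemma closed_forget Y d : closed_bot Y (forget Y d).
Proof. by move=> i Yi; exists i; rewrite // forgetE /= Yi. Qed.

Lemma forget_unique Y (g g' : diag N) : closed_bot Y g ->
  (forall u, bot Y u -> val g' u = u) ->
  (forall u v, ~~ bot Y u -> ~~ bot Y v -> lnk g u v = lnk g' u v) -> g' = forget Y g.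
Proof.
move=> cY fixY L; apply: diag_ext => u; rewrite forgetE closed_botE // orbb.
case: ifP => [/fixY//|/negbT Yu].
have Yv : ~~ bot Y (val g u) by rewrite closed_botE.
have := L _ _ Yu Yv; rewrite lnk_val => /esym/orP[/eqP E|/eqP //].
have Yv' : ~~ bot Y (val g' u).
  by apply/negP=> Yg'; have := fixY _ Yg'; rewrite diagK => E'; rewrite E' Yg' in Yu.
by have := L _ _ Yu Yv'; rewrite lnk_val => /orP[/eqP->|/eqP //].
Qed.

Lemma closed_Gp Y b d : closed_bot Y d -> closed_bot Y (dmul b d).
Proof. by move=> cY i /cY[j Yj dj]; exists j => //; apply: Gp_bot. Qed.

Section Transfer.
Variables (Y : pred 'I_N) (b d : diag N).
Hypothesis cY : closed_bot Y d.

Let D (w : 'I_3 * 'I_N) := ~~ ((w.1 == r2) && Y w.2).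
Let phi (w : 'I_3 * 'I_N) := if D w then Some w else None.

Let psiA v : conn b d (id (embA v)) (id (embA (val b v))). Proof. exact: connA. Qed.
Let psiB v : conn b d (id (embB v)) (id (embB (val (forget Y d) v))).
Proof. by rewrite forgetE; case: ifP => _; [apply: connect0|apply: connB]. Qed.
Let DA v : D (embA v). Proof. by case: v. Qed.
Let DB v : D (embB v) = ~~ bot Y v. Proof. by case: v. Qed.
Let DO v : D (embO v) = ~~ bot Y v. Proof. by case: v. Qed.
Let phiA v : oconn (conn b (forget Y d)) (phi (embA v)) (phi (embA (val b v))).
Proof. by rewrite /phi !DA; apply: connA. Qed.
Let phiB v : oconn (conn b (forget Y d)) (phi (embB v)) (phi (embB (val d v))).
Proof.
rewrite /phi !DB closed_botE //; case: ifP => // Yv.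
have := connB b (forget Y d) v.
by rewrite forgetE closed_botE // orbb (negPf Yv).
Qed.
Let phiK w : D w -> phi (id w) = Some w. Proof. by rewrite /phi => ->. Qed.

Lemma ell_forget : loops b (forget Y d) = loops b d.
Proof.
apply/esym; apply: (ell_transfer psiA psiB phiA phiB phiK) => //.
- by move=> w w1; rewrite /D w1.
- by move=> w w'; rewrite /phi; case: ifP => // _ [->].
- by move=> i; left; exists i.
Qed.

(** Arcs inside a closed set of bottom vertices of the lower factor lie on no path to other
    vertices, so cutting them commutes with left multiplication. *)
Lemma Gp_forget : dmul b (forget Y d) = forget Y (dmul b d).
Proof.
apply: (forget_unique (closed_Gp b cY)) => [u|u v Yu Yv].
  by case: u => // i Yi; apply: Gp_bot; rewrite forgetE Yi.
rewrite -!Gp_lnk -[embO u]/(id (embO u)) -[embO v]/(id (embO v)).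
by rewrite (stack_transfer psiA psiB phiA phiB phiK) ?DO.
Qed.

End Transfer.

(** [forget] first detaches i and j from their partners, which makes this an involution for every
    d. *)
Definition arc_fun (i j : 'I_N) d (v : vtx N) : vtx N :=
  if v == inr i then inr j else if v == inr j then inr i else val (forget (pred2 i j) d) v.

Definition addarc i j d : diag N := mkdiag (arc_fun i j d).

Lemma addarcE i j d v : val (addarc i j d) v = arc_fun i j d v.
Proof.
have Y2 (u : vtx N) : bot (pred2 i j) u = (u == inr i) || (u == inr j) by case: u.
rewrite mkdiagE // => u; rewrite /arc_fun.
have [->|ui] := eqVneq u (inr i); first by rewrite eqxx; case: eqVneq => // ->.
have [->|uj] := eqVneq u (inr j); first by rewrite eqxx.
have : ~~ bot (pred2 i j) (val (forget (pred2 i j) d) u).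
  rewrite forgetE; case: ifPn => [_|]; last by rewrite negb_or => /andP[].
  by rewrite Y2 (negPf ui) (negPf uj).
by rewrite Y2 negb_or => /andP[/negPf-> /negPf->]; rewrite diagK.
Qed.

Lemma bot2 i j u : bot (pred2 i j) u = (u == inr i) || (u == inr j).
Proof. by case: u. Qed.

Lemma addarc_forget i j d : val d (inr i) = inr j -> addarc i j (forget (pred2 i j) d) = d.
Proof.
move=> dij; have dji : val d (inr j) = inr i by rewrite -dij diagK.
apply: diag_ext => u; rewrite addarcE /arc_fun.
have [->//|ui] := eqVneq u (inr i); have [->//|uj] := eqVneq u (inr j).
have cY : closed_bot (pred2 i j) d.
  by move=> l /pred2P[]->; [exists j|exists i]; rewrite //= eqxx ?orbT.
have Yu : ~~ bot (pred2 i j) u by rewrite bot2 negb_or ui uj.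
by rewrite (forget_out (@closed_forget _ d) Yu) forget_out.
Qed.

Lemma forget_addarc i j d : val d (inr i) = inr i -> val d (inr j) = inr j ->
  forget (pred2 i j) (addarc i j d) = d.
Proof.
move=> di dj; apply: diag_ext => u; rewrite forgetE addarcE /arc_fun bot2.
have [->//|ui] := eqVneq u (inr i); have [->//|uj] := eqVneq u (inr j).
have cY : closed_bot (pred2 i j) d.
  by move=> l /pred2P[]->; [exists i|exists j]; rewrite //= eqxx ?orbT.
have Yu : ~~ bot (pred2 i j) u by rewrite bot2 negb_or ui uj.
have Yd : ~~ bot (pred2 i j) (val d u) by rewrite closed_botE.
by rewrite /= forget_out // (negPf Yd).
Qed.

Lemma closed_addarc i j d : closed_bot (pred2 i j) (addarc i j d).
Proof.
move=> l /pred2P[]->; [exists j|exists i]; rewrite //= ?eqxx ?orbT // addarcE /arc_fun eqxx //.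
by case: eqVneq => // ->.
Qed.

Lemma Gp_addarc i j b d : val d (inr i) = inr i -> val d (inr j) = inr j ->
  dmul b (addarc i j d) = addarc i j (dmul b d) /\ loops b (addarc i j d) = loops b d.
Proof.
move=> di dj; have cY := @closed_addarc i j d.
have := Gp_forget b cY; have := ell_forget b cY; rewrite forget_addarc // => -> ->.
have gij : val (dmul b (addarc i j d)) (inr i) = inr j.
  by apply: Gp_bot; rewrite addarcE /arc_fun eqxx.
by rewrite addarc_forget.
Qed.

End Forget.

Local Open Scope ring_scope.

(** * Linear maps on coordinate vectors *)

Notation vec F X := {ffun X -> (F : fieldType)^o}.

Section Linear.
Variable F : fieldType.

Lemma scale_reg (a : F) (b : F^o) : a *: b = a * (b : F). Proof. by []. Qed.

Lemma vec_delta (X : finType) (v : vec F X) : v = \sum_i v i *: delta F i.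
Proof.
apply/ffunP=> j; rewrite sum_ffunE (bigD1 j) //= !ffunE eqxx scale_reg mulr1.
by rewrite big1 ?addr0 // => i ij; rewrite !ffunE eq_sym (negPf ij) scale_reg mulr0.
Qed.

Lemma deltaE (X : finType) (i j : X) : delta F i j = (j == i)%:R.
Proof. by rewrite ffunE. Qed.

Section Lext.
Variables (X : finType) (V : vectType F) (f : X -> V).

Definition lext_fun (v : vec F X) : V := \sum_i v i *: f i.

Fact lext_linear : linear lext_fun.
Proof.
move=> a u v; rewrite /lext_fun scaler_sumr -big_split; apply: eq_bigr => i _.
by rewrite !ffunE scalerDl scalerA.
Qed.

HB.instance Definition _ := GRing.isLinear.Build F _ _ _ lext_fun lext_linear.

Definition lext : 'Hom(vec F X, V) := linfun lext_fun.

Lemma lextE v : lext v = \sum_i v i *: f i.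
Proof. exact: lfunE. Qed.

Lemma lext_delta i : lext (delta F i) = f i.
Proof.
rewrite lextE (bigD1 i) //= deltaE eqxx scale1r big1 ?addr0 // => j ji.
by rewrite deltaE (negPf ji) scale0r.
Qed.
End Lext.

Lemma hom_sum_delta (X : finType) (V : vectType F) (f : 'Hom(vec F X, V)) v :
  f v = \sum_i v i *: f (delta F i).
Proof. by rewrite [in LHS](vec_delta v) linear_sum; apply: eq_bigr => i _; rewrite linearZ. Qed.

Lemma hom_delta_eq (X : finType) (V : vectType F) (f g : 'Hom(vec F X, V)) :
  (forall i, f (delta F i) = g (delta F i)) -> forall v, f v = g v.
Proof. by move=> fg v; rewrite !hom_sum_delta; apply: eq_bigr => i _; rewrite fg. Qed.

Lemma span_mem (V W : vectType F) (f : 'Hom(V, W)) (U : {vspace W}) (s : seq V) :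
  {in s, forall u, f u \in U} -> {in <<s>>%VS, forall v, f v \in U}.
Proof.
move=> sU v sv; have : (f @: <<s>> <= U)%VS.
  by rewrite limg_span; apply/span_subvP=> _ /mapP[u /sU fu ->].
by move/subvP; apply; apply: memv_img.
Qed.

Lemma span_eq (V W : vectType F) (f g : 'Hom(V, W)) (s : seq V) :
  {in s, forall u, f u = g u} -> {in <<s>>%VS, forall v, f v = g v}.
Proof.
move=> fg v sv; apply/eqP; rewrite -subr_eq0 -memv0.
have := @span_mem _ _ (f - g) 0%VS s _ v sv; rewrite add_lfunE opp_lfunE; apply=> u /fg.
by rewrite add_lfunE opp_lfunE => ->; rewrite subrr mem0v.
Qed.

Lemma span_memB (V W : vectType F) (f g : 'Hom(V, W)) (U : {vspace W}) (s : seq V) :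
  {in s, forall u, f u - g u \in U} -> {in <<s>>%VS, forall v, f v - g v \in U}.
Proof.
move=> fg v sv; have := @span_mem _ _ (f - g) U s _ v sv; rewrite add_lfunE opp_lfunE; apply=> u /fg.
by rewrite add_lfunE opp_lfunE.
Qed.

Lemma hom_sum (V W : vectType F) (f : 'Hom(V, W)) I (r : seq I) (P : pred I) (G : I -> V) :
  f (\sum_(i <- r | P i) G i) = \sum_(i <- r | P i) f (G i).
Proof. exact: linear_sum. Qed.

Lemma homZ (V W : vectType F) (f : 'Hom(V, W)) a v : f (a *: v) = a *: f v.
Proof. exact: linearZ. Qed.

Lemma hom0 (V W : vectType F) (f : 'Hom(V, W)) : f 0 = 0.
Proof. exact: linear0. Qed.

Lemma comp3_lfunE (V1 V2 V3 V4 : vectType F) (f : 'Hom(V3, V4)) (g : 'Hom(V2, V3))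
  (h : 'Hom(V1, V2)) v : (f \o (g \o h))%VF v = f (g (h v)).
Proof. by rewrite !comp_lfunE. Qed.

End Linear.

(** * Specht modules *)

Section Perm.
Variables (F : fieldType) (N : nat).
Notation E := (vec F (tabloid N)).
Implicit Types (s : 'S_N) (r : tabloid N) (m : nat).

Definition permL s : 'End(E) := lext (fun r => delta F (permtab s r)).

Lemma permactE s (v : E) : permact s v = permL s v.
Proof. by rewrite lextE. Qed.

Lemma permL_delta s r : permL s (delta F r) = delta F (permtab s r).
Proof. exact: lext_delta. Qed.

Lemma permtabM s s' r : permtab s (permtab s' r) = permtab (s * s')%g r.
Proof. by apply/ffunP=> k; rewrite !ffunE permM. Qed.

Lemma permtab1 r : permtab 1 r = r.
Proof. by apply/ffunP=> k; rewrite ffunE perm1. Qed.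

Lemma permLM s s' v : permL s (permL s' v) = permL (s * s')%g v.
Proof.
rewrite -comp_lfunE; apply: hom_delta_eq => r.
by rewrite comp_lfunE !permL_delta permtabM.
Qed.

Lemma permL1 v : permL 1 v = v.
Proof.
rewrite -[RHS]id_lfunE; apply: hom_delta_eq => r.
by rewrite id_lfunE permL_delta permtab1.
Qed.

Lemma permLK s : cancel (permL s) (permL s^-1).
Proof. by move=> v; rewrite permLM mulVg permL1. Qed.

Lemma permLVK s : cancel (permL s^-1) (permL s).
Proof. by move=> v; rewrite permLM mulgV permL1. Qed.

Lemma SsubP m s : reflect (forall k : 'I_N, (m <= k)%N -> s k = k) (s \in Ssub N m).
Proof.
rewrite inE; apply: (iffP forallP) => H k; first by move=> mk; apply/eqP/(implyP (H k)).
by apply/implyP=> /H->.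
Qed.

Lemma Ssub1 m : 1%g \in Ssub N m.
Proof. by apply/SsubP=> k _; rewrite perm1. Qed.

Lemma SsubM m s s' : s \in Ssub N m -> s' \in Ssub N m -> (s * s')%g \in Ssub N m.
Proof. by move=> /SsubP H /SsubP H'; apply/SsubP=> k mk; rewrite permM H ?H'. Qed.

Lemma SsubV m s : s \in Ssub N m -> (s^-1)%g \in Ssub N m.
Proof. by move=> /SsubP H; apply/SsubP=> k mk; rewrite -{1}(H k mk) permK. Qed.

Lemma Ssub_lt m s (k : 'I_N) : s \in Ssub N m -> (s k < m)%N = (k < m)%N.
Proof.
move/SsubP=> sm; apply/idP/idP; apply: contraTT; rewrite -!leqNgt => mi; first by rewrite sm.
by rewrite -(perm_inj (sm _ mi)).
Qed.

Lemma Ssub_sub m m' : (m <= m')%N -> {subset Ssub N m <= Ssub N m'}.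
Proof. by move=> mm s /SsubP H; apply/SsubP=> k mk; rewrite H // (leq_trans mm). Qed.

Definition equivariant m (h : 'End(E)) :=
  forall s, s \in Ssub N m -> forall v, h (permL s v) = permL s (h v).

Definition stable m (U : {vspace E}) :=
  forall s, s \in Ssub N m -> forall v, v \in U -> permL s v \in U.

Lemma equivariant_comp m (h k : 'End(E)) :
  equivariant m h -> equivariant m k -> equivariant m (h \o k)%VF.
Proof. by move=> eh ek s ms v; rewrite !comp_lfunE /= ek // eh. Qed.

Hypothesis charF : [pchar F] =i pred0.

Lemma natF_neq0 k : (0 < k)%N -> k%:R != 0 :> F.
Proof. by rewrite lt0n; move: charF => /pcharf0P/(_ k) ->. Qed.

Lemma card_Ssub m : #|Ssub N m|%:R != 0 :> F.
Proof. by apply: natF_neq0; apply/card_gt0P; exists 1%g; apply: Ssub1. Qed.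

(** The Reynolds operator of S_m on endomorphisms. *)
Definition avg m (h : 'End(E)) : 'End(E) :=
  (#|Ssub N m|%:R)^-1 *: \sum_(s in Ssub N m) (permL s \o (h \o permL s^-1))%VF.

Lemma avgE m h v :
  avg m h v = (#|Ssub N m|%:R)^-1 *: \sum_(s in Ssub N m) permL s (h (permL s^-1 v)).
Proof.
rewrite scale_lfunE sum_lfunE; congr (_ *: _); apply: eq_bigr => s _.
by rewrite !comp_lfunE.
Qed.

Lemma avg_equivariant m h : equivariant m (avg m h).
Proof.
move=> s ms v; rewrite !avgE linearZ /=; congr (_ *: _); rewrite linear_sum /=.
rewrite (reindex_inj (mulgI s)); apply: eq_big => s'.
  apply/idP/idP=> [H|]; last exact: SsubM.
  by rewrite -(mulKg s s'); apply: SsubM => //; apply: SsubV.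
by move=> _; rewrite invMg -(permLM s s') -(permLM s'^-1 s^-1) (permLK s).
Qed.

Lemma avg_const m v w (h : 'End(E)) :
  (forall s, s \in Ssub N m -> permL s (h (permL s^-1 v)) = w) -> avg m h v = w.
Proof.
move=> H; rewrite avgE (eq_bigr (fun _ => w)) // sumr_const -scaler_nat scalerA.
by rewrite mulVf ?scale1r // card_Ssub.
Qed.

(** Maschke's argument: the average of a linear projection onto a stable subspace is an equivariant
    projection onto it. *)
Lemma equivariant_proj m U : stable m U -> exists p : 'End(E),
  [/\ equivariant m p, forall v, p v \in U & forall v, v \in U -> p v = v].
Proof.
move=> sU; exists (avg m (projv U)); split=> [|v|v Uv]; first exact: avg_equivariant.
  by rewrite avgE; apply: rpredZ; apply: rpred_sum => s ms; apply: sU => //; apply: memv_proj.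
by apply: avg_const => s ms; rewrite projv_id ?permLVK // sU // SsubV.
Qed.

(* A von Neumann inverse that commutes with the group, obtained by averaging one
   that does not. *)
Definition einv m (h : 'End(E)) := avg m h^-1%VF.

Lemma einvK m h v : equivariant m h -> h (einv m h (h v)) = h v.
Proof.
move=> eh; have : (h \o (einv m h \o h))%VF v = h v; last by rewrite !comp_lfunE.
rewrite comp_lfunE /= comp_lfunE /= avgE linearZ linear_sum /=.
rewrite (eq_bigr (fun _ => h v)) => [|s ms].
  by rewrite sumr_const -scaler_nat scalerA mulVf ?scale1r // card_Ssub.
rewrite -eh ?SsubV // eh // limg_lfunVK ?memv_img ?memvf //.
by rewrite eh ?SsubV // permLVK.
Qed.

End Perm.

(** * Partitions as sequences of row lengths *)

Section Partitions.
Local Open Scope nat_scope.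

Lemma nth_le_sumn (l : seq nat) j : nth 0 l j <= sumn l.
Proof.
elim: l j => [|a l IH] [|j] //=; first exact: leq_addr.
exact: leq_trans (IH j) (leq_addl _ _).
Qed.

Lemma ispart_size l : ispart l -> size l <= sumn l.
Proof.
case/andP=> _; elim: l => //= a l IH /andP[a0 /IH H].
by rewrite -add1n leq_add.
Qed.

Lemma ispart_nth l i j : ispart l -> i <= j -> nth 0 l j <= nth 0 l i.
Proof.
case/andP=> s _ ij; have [jl|lj] := ltnP j (size l); last by rewrite nth_default.
have tr : transitive geq by move=> y x z /= yx zy; apply: leq_trans zy yx.
have rr : reflexive geq by move=> x /=.
by apply: (sorted_leq_nth tr rr) => //; rewrite inE // (leq_ltn_trans ij jl).
Qed.

Lemma ispart_gt0 l i : ispart l -> (i < size l) = (0 < nth 0 l i).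
Proof.
case/andP=> _ /allP pos; apply/idP/idP=> [il|]; first by apply/pos/mem_nth.
by apply: contraTT; rewrite -leqNgt => li; rewrite nth_default.
Qed.

Lemma ispart_ext l l' : ispart l -> ispart l' -> nth 0 l =1 nth 0 l' -> l = l'.
Proof.
move=> pl pl' ll; apply: (eq_from_nth (x0 := 0)) => [|i _]; last exact: ll.
apply/eqP; rewrite eqn_leq; apply/andP; split; rewrite leqNgt; apply/negP.
  by rewrite (ispart_gt0 _ pl) ll -(ispart_gt0 _ pl') ltnn.
by rewrite (ispart_gt0 _ pl') -ll -(ispart_gt0 _ pl) ltnn.
Qed.

Lemma sumn_nth l K : size l <= K -> sumn l = \sum_(i < K) nth 0 l i.
Proof.
move=> lK; rewrite sumnE (big_nth 0) -(big_mkord predT (nth 0 l)).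
rewrite (big_cat_nat (n := size l) (p := K)) //= [X in _ = _ + X]big_nat_cond.
by rewrite [X in _ = _ + X]big1 ?addn0 // => i /andP[/andP[li _] _]; rewrite nth_default.
Qed.

End Partitions.

(** * Tableaux and the dominance order *)

Section Tableaux.
Variable N : nat.
Implicit Types (l mu : seq nat) (t : {ffun 'I_N -> 'I_N * 'I_N}) (k : 'I_N) (s : 'S_N).

Lemma istabP l t : reflect
  ((forall k, (k < sumn l)%N -> isbox l (t k)) /\
   (forall k k', (k < sumn l)%N -> (k' < sumn l)%N -> t k = t k' -> k = k')) (istab l t).
Proof.
apply: (iffP andP) => [[/forallP H1 /forallP H2]|[H1 H2]]; split.
- by move=> k; apply/implyP.
- move=> k k' kl kl' tt; have /forallP/(_ k')/implyP := H2 k.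
  by rewrite kl kl' tt eqxx => /(_ isT)/eqP.
- by apply/forallP=> k; apply/implyP/H1.
- apply/forallP=> k; apply/forallP=> k'; apply/implyP=> /and3P[kl kl' /eqP tt].
  exact/eqP/H2.
Qed.

Lemma card_ord_lt n m : (m <= n)%N -> #|[set i : 'I_n | (i < m)%N]| = m.
Proof.
move=> mn; rewrite -[RHS]card_ord -(@card_imset _ _ (widen_ord mn)); last by move=> i j [/val_inj].
apply: eq_card => i; rewrite inE; apply/idP/imsetP=> [im|[j _ ->]] //=.
by exists (Ordinal im) => //; apply: val_inj.
Qed.

Section Fixed.
Variable l : seq nat.
Hypotheses (pl : ispart l) (lN : (sumn l <= N)%N).

Lemma isboxE (b : 'I_N * 'I_N) : isbox l b = (b.2 < nth 0%N l b.1)%N.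
Proof.
rewrite /isbox; apply: andb_idl => H; rewrite ispart_gt0 //; exact: leq_ltn_trans H.
Qed.

Lemma card_row (r : 'I_N) : #|[set b : 'I_N * 'I_N | isbox l b & b.1 == r]| = nth 0%N l r.
Proof.
rewrite -[RHS](@card_ord_lt N) ?(leq_trans (nth_le_sumn _ _)) //.
rewrite -(card_imset [set i : 'I_N | _] (f := pair r)); last by move=> i j [].
apply: eq_card => -[r' c]; rewrite inE isboxE /=; apply/andP/imsetP=> [[H /eqP rr]|[c' + [-> ->]]].
  by exists c; rewrite ?inE -?rr.
by rewrite inE.
Qed.

Lemma card_boxes : #|[set b : 'I_N * 'I_N | isbox l b]| = sumn l.
Proof.
rewrite (@sumn_nth l N) ?(leq_trans (ispart_size pl)) //.
rewrite -sum1_card (partition_big (fun b : 'I_N * 'I_N => b.1) predT) //=.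
apply: eq_bigr => r _; rewrite -card_row -sum1_card; apply: eq_bigl => b.
by rewrite !inE.
Qed.

Lemma tab_surj t (b : 'I_N * 'I_N) : istab l t -> isbox l b -> exists2 k : 'I_N, (k < sumn l)%N & t k = b.
Proof.
move=> /istabP[H1 H2] lb.
pose D := [set k : 'I_N | (k < sumn l)%N].
have E : t @: D = [set b | isbox l b].
  apply/eqP; rewrite eqEcard card_boxes card_in_imset ?card_ord_lt // ?leqnn ?andbT.
    by apply/subsetP=> _ /imsetP[k + ->]; rewrite !inE => /H1.
  by move=> k k'; rewrite !inE => kl kl'; apply: H2.
have : b \in t @: D by rewrite E inE.
by case/imsetP=> k + ->; rewrite inE => kl; exists k.
Qed.

Lemma tab_row t i : istab l t ->
  #|[set k : 'I_N | (k < sumn l)%N & (t k).1 == i :> nat]| = nth 0%N l i.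
Proof.
move=> tl; have [H1 H2] := istabP _ _ tl.
have [iN|Ni] := ltnP i N; last first.
  rewrite nth_default ?(leq_trans (ispart_size pl)) ?(leq_trans lN) //.
  apply: eq_card0 => k; rewrite inE; apply/andP=> -[_ /eqP ti].
  by have := ltn_ord (t k).1; rewrite ti ltnNge Ni.
rewrite -[i]/(val (Ordinal iN)) -card_row.
rewrite -(@card_in_imset _ _ t [set k : 'I_N | _ & _]); last first.
  by move=> k k'; rewrite !inE => /andP[kl _] /andP[kl' _]; apply: H2.
apply: eq_card => b; rewrite inE; apply/imsetP/andP=> [[k]|[lb bi]].
  by rewrite inE => /andP[/H1 ? ?] ->.
have [k kl tk] := tab_surj tl lb; exists k => //; rewrite inE kl tk.
by rewrite (eqP bi) /=.
Qed.

End Fixed.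

Definition colrow (m : nat) t t' (c : 'I_N) i :=
  [set k : 'I_N | [&& (k < m)%N, (t k).2 == c & ((t' k).1 < i)%N]].

(** The hypothesis of the basic combinatorial lemma: a column of t and a row of t' share at most one
    entry. *)
Definition transverse m t t' :=
  forall k k', (k < m)%N -> (k' < m)%N -> (t k).2 = (t k').2 -> (t' k).1 = (t' k').1 -> k = k'.

(** By transversality a column of t has at most i entries in the first i rows of t', and at most its
    own length. The tableau t itself attains the smaller of these two bounds. *)
Lemma colrow_le l t t' c i : ispart l -> (sumn l <= N)%N -> istab l t ->
  transverse (sumn l) t t' ->
  (#|colrow (sumn l) t t' c i| <= #|colrow (sumn l) t t c i|)%N.
Proof.
move=> pl lN tl tr; have [H1 H2] := istabP _ _ tl.
have [/forallP all_lt|] := boolP [forall k : 'I_N, [&& (k < sumn l)%N & (t k).2 == c] ==> ((t k).1 < i)%N].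
  apply/subset_leq_card/subsetP=> k; rewrite !inE => /and3P[kl kc _].
  by rewrite kl kc (implyP (all_lt k)) // kl kc.
case/forallPn=> k0; rewrite negb_imply -leqNgt => /andP[/andP[k0l k0c] ik0].
have iN : (i <= N)%N by apply: leq_trans ik0 (ltnW (ltn_ord _)).
apply: (@leq_trans i).
  rewrite -[leqRHS](@card_ord_lt N) // -(@card_in_imset _ _ (fun k => (t' k).1)).
    by apply/subset_leq_card/subsetP=> _ /imsetP[k + ->]; rewrite !inE => /and3P[].
  move=> k k'; rewrite !inE => /and3P[kl /eqP kc _] /and3P[kl' /eqP kc' _].
  by apply: tr; rewrite ?kc.
rewrite -[leqLHS](@card_ord_lt N) //; apply: leq_trans (leq_imset_card (fun k => (t k).1) _).
apply/subset_leq_card/subsetP=> r; rewrite inE => ri.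
have lb : isbox l (r, c).
  rewrite isboxE //= (leq_trans _ (ispart_nth (j := (t k0).1) pl _)) //; last first.
    exact: leq_trans (ltnW ri) ik0.
  by have := H1 _ k0l; rewrite isboxE // (eqP k0c).
have [k kl tk] := tab_surj pl lN tl lb.
by apply/imsetP; exists k; rewrite ?inE ?kl ?tk //= eqxx.
Qed.

Definition rows_lt m t i := #|[set k : 'I_N | (k < m)%N & ((t k).1 < i)%N]|.

Lemma rows_lt_colrow m t t' i : rows_lt m t' i = (\sum_c #|colrow m t t' c i|)%N.
Proof.
rewrite /rows_lt -sum1_card (partition_big (fun k => (t k).2) predT) //=.
apply: eq_bigr => c _; rewrite -sum1_card; apply: eq_bigl => k.
by rewrite !inE -andbA; congr andb; rewrite andbC.
Qed.

(** Dominance: for tableaux, the numbers [rows_lt] are the partial sums of the row lengths of the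
    shape. *)
Lemma rows_lt_le l t t' i : ispart l -> (sumn l <= N)%N -> istab l t ->
  transverse (sumn l) t t' -> (rows_lt (sumn l) t' i <= rows_lt (sumn l) t i)%N.
Proof.
move=> pl lN tl tr; rewrite (rows_lt_colrow _ t t') (rows_lt_colrow _ t t).
by apply: leq_sum => c _; apply: colrow_le.
Qed.

Lemma rows_ltS l t i : ispart l -> (sumn l <= N)%N -> istab l t ->
  rows_lt (sumn l) t i.+1 = (rows_lt (sumn l) t i + nth 0%N l i)%N.
Proof.
move=> pl lN tl; rewrite -(tab_row pl lN i tl) /rows_lt -cardsUI.
rewrite [X in (_ + X)%N]eq_card0 ?addn0; last first.
  by move=> k; rewrite !inE; apply/negP; case/andP=> /andP[_ H] /andP[_ /eqP E]; rewrite E ltnn in H.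
by apply: eq_card => k; rewrite !inE ltnS [((t k).1 <= _)%N]leq_eqVlt andb_orr orbC.
Qed.

Lemma transverse_eq l mu t t' : ispart l -> ispart mu -> sumn l = sumn mu -> (sumn l <= N)%N ->
  istab l t -> istab mu t' ->
  (forall i, rows_lt (sumn l) t' i = rows_lt (sumn l) t i) -> l = mu.
Proof.
move=> pl pm lm lN tl tm H; apply: ispart_ext => // i.
have := rows_ltS i pl lN tl; rewrite -!H lm.
by rewrite (rows_ltS i pm _ tm) -?lm // => /addnI.
Qed.

(* In the equality case t' is, up to the order inside its rows, a column
   permutation of t. *)
Lemma transverse_perm l t t' : ispart l -> (sumn l <= N)%N -> istab l t -> istab l t' ->
  transverse (sumn l) t t' ->
  exists2 s, s \in colgrp l t & rowtab l t' = permtab s (rowtab l t).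
Proof.
move=> pl lN tl tl' tr; have [H1 H2] := istabP _ _ tl.
have rows i : rows_lt (sumn l) t' i = rows_lt (sumn l) t i.
  by elim: i => [|i IH]; [rewrite /rows_lt !eq_card0 // => k; rewrite inE andbF|rewrite !rows_ltS // IH].
(* The sums over all columns agree since t and t' have the same shape, so the inequality [colrow_le]
   is an equality in each column. *)
have cols c i : #|colrow (sumn l) t t' c i| = #|colrow (sumn l) t t c i|.
  have := rows i; rewrite (rows_lt_colrow _ t t') (rows_lt_colrow _ t t) => sumE.
  have := leqif_sum (fun c (_ : predT c) => leqif_geq (colrow_le c i pl lN tl tr)).
  by case=> _; rewrite sumE eqxx => /esym/forallP/(_ c)/= H; apply/eqP; rewrite eqn_leq colrow_le.
have ex k : (k < sumn l)%N -> exists2 k2 : 'I_N, (k2 < sumn l)%N & t k2 = ((t' k).1, (t k).2).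
  move=> kl; apply: (tab_surj pl lN tl); rewrite isboxE //=.
  have sub (u : {ffun 'I_N -> 'I_N * 'I_N}) c i : colrow (sumn l) t u c i \subset colrow (sumn l) t u c i.+1.
    by apply/subsetP=> k2; rewrite !inE => /and3P[-> -> /ltnW].
  set c := (t k).2; set i := (t' k).1.
  have : (0 < #|colrow (sumn l) t t c i.+1 :\: colrow (sumn l) t t c i|)%N.
    rewrite cardsDS ?sub // -!cols -cardsDS ?sub //; apply/card_gt0P; exists k.
    by rewrite !inE kl eqxx /= ltnn ltnSn.
  case/card_gt0P=> k2; rewrite !inE => /andP[+ /and3P[k2l /eqP k2c k2i]].
  rewrite k2l k2c eqxx /= -leqNgt => ik2.
  have := H1 _ k2l; rewrite isboxE // k2c; congr (_ < nth _ _ _)%N.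
  by apply/eqP; rewrite eqn_leq ik2 -ltnS k2i.
(* The column permutation sought: k goes to the entry of t in the same column and in the row that t'
   assigns to k. Entries outside the tableau are fixed. *)
pose f k := if [pick k2 : 'I_N | (k2 < sumn l)%N && (t k2 == ((t' k).1, (t k).2))] is Some k2
            then (if (k < sumn l)%N then k2 else k) else k.
have fE k : (k < sumn l)%N -> (f k < sumn l)%N /\ t (f k) = ((t' k).1, (t k).2).
  move=> kl; rewrite /f kl; case: pickP => [k2 /andP[? /eqP] //|none].
  by have [k2 ? tk2] := ex k kl; have := none k2; rewrite tk2 eqxx andbT => /negP.
have fN k : (k < sumn l)%N = false -> f k = k by rewrite /f => ->; case: pickP.
have f_inj : injective f.
  move=> k k' ff; have [kl|kl] := boolP (k < sumn l)%N; have [kl'|kl'] := boolP (k' < sumn l)%N.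
  - by have [_] := fE k kl; have [_] := fE k' kl'; rewrite ff => -> [] E1 E2; apply: tr.
  - by have [+ _] := fE k kl; rewrite ff fN ?(negPf kl').
  - by have [+ _] := fE k' kl'; rewrite -ff fN ?(negPf kl).
  - by move: ff; rewrite !fN ?(negPf kl) ?(negPf kl').
exists (perm f_inj).
  rewrite inE; apply/forallP=> k; rewrite permE; case: ifP => kl; last by rewrite fN.
  by have [_ ->] := fE k kl.
apply/ffunP=> k; rewrite !ffunE permE; case: ifP => kl; last by rewrite fN // kl.
by have [-> ->] := fE k kl.
Qed.

End Tableaux.

(** * Polytabloids and Schur's lemma *)

Section Polytabloids.
Variables (F : fieldType) (N : nat).
Notation E := (vec F (tabloid N)).
Notation tab := {ffun 'I_N -> 'I_N * 'I_N}.
Implicit Types (s : 'S_N) (r : tabloid N) (l mu : seq nat) (t : tab) (k : 'I_N).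

Definition tact s t : tab := [ffun k => t (s k)].

Lemma colgrpP l t s : reflect
  ((forall k, (k < sumn l)%N -> (t (s k)).2 = (t k).2) /\ s \in Ssub N (sumn l))
  (s \in colgrp l t).
Proof.
rewrite [s \in colgrp _ _]inE; apply: (iffP forallP) => [H|[H1 /SsubP H2] k].
  split=> [k kl|]; first by have := H k; rewrite kl => /eqP.
  by apply/SsubP=> k; have := H k; rewrite ltnNge; case: leqP => // _ /eqP.
by case: ltnP => kl; apply/eqP; [apply: H1|apply: H2].
Qed.

Lemma colgrp1 l t : 1%g \in colgrp l t.
Proof. by apply/colgrpP; split=> [k|]; rewrite ?perm1 ?Ssub1. Qed.

Lemma colgrpM l t s s' : s \in colgrp l t -> s' \in colgrp l t -> (s * s')%g \in colgrp l t.
Proof.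
move=> /colgrpP[H1 H2] /colgrpP[H1' H2']; apply/colgrpP; split; last exact: SsubM.
by move=> k kl; rewrite permM H1' ?H1 // (Ssub_lt _ H2).
Qed.

Lemma colgrpV l t s : s \in colgrp l t -> (s^-1)%g \in colgrp l t.
Proof.
move=> /colgrpP[H1 H2]; apply/colgrpP; split; last exact: SsubV.
by move=> k kl; rewrite -[in RHS](permKV s k) H1 // (Ssub_lt _ (SsubV H2)).
Qed.

(** The signed column sum of t; it produces the polytabloid from the tabloid of t. *)
Definition kap l t : 'End(E) := \sum_(s in colgrp l t) (-1) ^+ odd_perm s *: permL F s.

Lemma kapE l t v : kap l t v = \sum_(s in colgrp l t) (-1) ^+ odd_perm s *: permL F s v.
Proof. by rewrite sum_lfunE; apply: eq_bigr => s _; rewrite scale_lfunE. Qed.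

Lemma polytabE l t : polytab F l t = kap l t (delta F (rowtab l t)).
Proof. by rewrite kapE; apply: eq_bigr => s _; rewrite permL_delta. Qed.

Lemma kap_perm l t s v : s \in colgrp l t ->
  kap l t (permL F s v) = (-1) ^+ odd_perm s *: kap l t v.
Proof.
move=> cs; rewrite !kapE scaler_sumr (reindex_inj (mulIg (s^-1)%g)).
apply: eq_big => s'.
  apply/idP/idP=> [H|H]; last by apply: colgrpM => //; apply: colgrpV.
  by rewrite -(mulgKV s s'); apply: colgrpM.
by move=> _; rewrite permLM mulgKV odd_permM odd_permV signr_addb scalerA mulrC.
Qed.

Lemma perm_kap l t s v : s \in colgrp l t ->
  permL F s (kap l t v) = (-1) ^+ odd_perm s *: kap l t v.
Proof.
move=> cs; rewrite !kapE scaler_sumr linear_sum [RHS](reindex_inj (mulgI s)).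
apply: eq_big => s'.
  apply/idP/idP=> [H|H]; first exact: colgrpM.
  by rewrite -(mulKg s s'); apply: colgrpM => //; apply: colgrpV.
move=> _; rewrite linearZ /= permLM odd_permM signr_addb scalerA mulrA.
by rewrite -signr_addb addbb mul1r.
Qed.

Lemma kap_kap l t v : kap l t (kap l t v) = #|colgrp l t|%:R *: kap l t v.
Proof.
rewrite [in LHS]kapE (eq_bigr (fun _ => kap l t v)) ?sumr_const ?scaler_nat // => s cs.
by rewrite perm_kap // scalerA -signr_addb addbb scale1r.
Qed.

Lemma permtab_rowtab l s t : s \in Ssub N (sumn l) -> permtab s (rowtab l t) = rowtab l (tact s t).
Proof. by move=> sl; apply/ffunP=> k; rewrite !ffunE (Ssub_lt _ sl). Qed.

Lemma istab_tact l s t : s \in Ssub N (sumn l) -> istab l t -> istab l (tact s t).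
Proof.
move=> sl /istabP[H1 H2]; apply/istabP; split=> [k kl|k k' kl kl'].
  by rewrite ffunE H1 // (Ssub_lt _ sl).
by rewrite !ffunE => /H2 H; apply: (@perm_inj _ s); apply: H; rewrite (Ssub_lt _ sl).
Qed.

Lemma permL_polytab l s t : s \in Ssub N (sumn l) ->
  permL F s (polytab F l t) = polytab F l (tact s t).
Proof.
move=> sl; rewrite !polytabE -permtab_rowtab // -permL_delta !kapE linear_sum.
rewrite (reindex_inj (conjg_inj s)).
apply: eq_big => s' => [|_]; last by rewrite linearZ /= !permLM odd_permJ conjgCV conjgK.
have tactK k : (tact s t) ((s' : 'S_N) k) = t ((s' ^ s)%g (s k)) by rewrite ffunE -permM -conjgC permM.
apply/colgrpP/colgrpP=> -[H1 H2]; split.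
- by move=> k kl; rewrite tactK H1 ?ffunE // (Ssub_lt _ sl).
- by rewrite -(conjgK s s') conjgE; do !apply: SsubM => //; rewrite ?invgK //; apply: SsubV.
- move=> k kl; rewrite -[k](permKV s) -tactK H1 ?ffunE // (Ssub_lt _ (SsubV sl)) //.
- by rewrite conjgE; do !apply: SsubM => //; apply: SsubV.
Qed.

Lemma specht_polytab l t : istab l t -> polytab F l t \in specht F N l.
Proof. by move=> tl; apply/memv_span/map_f; rewrite mem_enum. Qed.

Lemma specht_ind (V : vectType F) (U : {vspace V}) l (f : 'Hom(E, V)) :
  (forall t, istab l t -> f (polytab F l t) \in U) -> {in specht F N l, forall v, f v \in U}.
Proof.
move=> H; apply: span_mem => _ /mapP[t + ->]; rewrite mem_enum; exact: H.
Qed.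

Lemma specht_stable l : stable (sumn l) (specht F N l).
Proof.
move=> s sl; apply: specht_ind => t tl.
by rewrite permL_polytab // specht_polytab // istab_tact.
Qed.

Hypothesis charF : [pchar F] =i pred0.

Lemma card_colgrp l t : #|colgrp l t|%:R != 0 :> F.
Proof. by apply: natF_neq0 => //; apply/card_gt0P; exists 1%g; apply: colgrp1. Qed.

(** The transposition of two entries in one column of t and one row of t' fixes the tabloid of t'
    and changes the sign of [kap]. The image then equals its own negative and vanishes. *)
Lemma kap_transverse l mu t t' : sumn l = sumn mu ->
  kap l t (delta F (rowtab mu t')) != 0 -> transverse (sumn l) t t'.
Proof.
move=> lm nz k k' kl kl' kc kr; apply: contraNeq nz => kk'.
set r := rowtab mu t'; pose s := tperm k k'.
have ss : s \in Ssub N (sumn l).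
  by apply/SsubP=> i il; rewrite tpermD //; apply: contraTneq il => <-; rewrite -ltnNge.
have cs : s \in colgrp l t.
  by apply/colgrpP; split=> // i il; rewrite /s; case: tpermP => // ->.
have sr : permtab s r = r.
  apply/ffunP=> i; rewrite !ffunE -lm (Ssub_lt _ ss); case: ifP => // il; congr Some.
  by rewrite /s; case: tpermP => // ->.
have := kap_perm (delta F r) cs; rewrite permL_delta sr odd_tperm kk' expr1 scaleN1r.
move/eqP; rewrite -addr_eq0 -mulr2n -scaler_nat scaler_eq0.
by rewrite (negPf (natF_neq0 charF _)).
Qed.

Lemma kap_same l t t' : ispart l -> (sumn l <= N)%N -> istab l t -> istab l t' ->
  kap l t (delta F (rowtab l t')) \in <[polytab F l t]>%VS.
Proof.
move=> pl lN tl tl'; have [->|nz] := eqVneq (kap l t (delta F (rowtab l t'))) 0; first exact: mem0v.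
have [s cs ->] := transverse_perm pl lN tl tl' (kap_transverse erefl nz).
by rewrite -permL_delta kap_perm // -polytabE memvZ // memv_line.
Qed.

Lemma kap_specht_ind l mu (U : {vspace E}) t : 
  (forall t', istab mu t' -> kap l t (delta F (rowtab mu t')) \in U) ->
  {in specht F N mu, forall v, kap l t v \in U}.
Proof.
move=> H; apply: specht_ind => t' tm; rewrite polytabE kapE linear_sum.
apply: rpred_sum => s /colgrpP[_ sm]; rewrite linearZ /= rpredZ // permL_delta.
by rewrite permtab_rowtab //; apply/H/istab_tact.
Qed.

Lemma equivariant_kap l t h v : equivariant (sumn l) h -> h (kap l t v) = kap l t (h v).
Proof.
move=> eh; rewrite !kapE linear_sum; apply: eq_bigr => s /colgrpP[_ sl].
by rewrite linearZ /= eh.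
Qed.

(** [kap] multiplies its own polytabloid by the order of the column group, so the image of a
    polytabloid under h is again a value of [kap], where [kap_transverse] applies. *)
Lemma equivariant_polytab l t h : equivariant (sumn l) h ->
  h (polytab F l t) = #|colgrp l t|%:R^-1 *: kap l t (h (polytab F l t)).
Proof.
move=> eh; rewrite -equivariant_kap // {2}polytabE kap_kap linearZ /= scalerA.
by rewrite mulVf ?card_colgrp // scale1r polytabE.
Qed.

(** Endomorphisms are scalars over any field of characteristic zero: [kap] maps the Specht module
    into the line of one polytabloid, so h scales that polytabloid, and the group moves it to all
    the others. *)
Lemma specht_end l h : ispart l -> (sumn l <= N)%N -> equivariant (sumn l) h ->
  {in specht F N l, forall v, h v \in specht F N l} ->
  exists c, {in specht F N l, forall v, h v = c *: v}.
Proof.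
move=> pl lN eh hS.
have [t0 tl0|none] := pickP [pred t : tab | istab l t]; last first.
  exists 0 => v; rewrite scale0r => Sv; apply/eqP; rewrite -memv0; move: v Sv.
  by apply: specht_ind => t tl; have := none t; rewrite /= tl.
have : h (polytab F l t0) \in <[polytab F l t0]>%VS.
  rewrite equivariant_polytab // memvZ //.
  apply: (@kap_specht_ind l l); last by apply/hS/specht_polytab.
  by move=> t' tl'; apply: kap_same.
case/vlineP=> c hc; exists c => v Sv; apply/eqP; rewrite -subr_eq0 -memv0; move: v Sv.
have H v : (h - c *: \1)%VF v = h v - c *: v.
  by rewrite add_lfunE opp_lfunE scale_lfunE id_lfunE.
suff : {in specht F N l, forall v, (h - c *: \1)%VF v \in 0%VS} by move=> K v /K; rewrite H.
apply: specht_ind => t tl; rewrite H memv0 subr_eq0.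
have [H1 H2] := istabP _ _ tl; have [_ H2'] := istabP _ _ tl0.
have ex k : (k < sumn l)%N -> exists2 k2 : 'I_N, (k2 < sumn l)%N & t0 k2 = t k.
  by move=> /H1; apply: tab_surj.
(* The permutation that carries t0 to t on the entries below [sumn l]; the other entries are
   fixed. *)
pose f k := if [pick k2 : 'I_N | (k2 < sumn l)%N && (t0 k2 == t k)] is Some k2
            then (if (k < sumn l)%N then k2 else k) else k.
have fE k : (k < sumn l)%N -> (f k < sumn l)%N /\ t0 (f k) = t k.
  move=> kl; rewrite /f kl; case: pickP => [k2 /andP[? /eqP] //|no].
  by have [k2 ? tk2] := ex k kl; have := no k2; rewrite tk2 eqxx andbT => /negP.
have fN k : (k < sumn l)%N = false -> f k = k by rewrite /f => ->; case: pickP.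
have f_inj : injective f.
  move=> k k' ff; have [kl|kl] := boolP (k < sumn l)%N; have [kl'|kl'] := boolP (k' < sumn l)%N.
  - by have [_] := fE k kl; have [_] := fE k' kl'; rewrite ff => -> E1; apply: H2.
  - by have [+ _] := fE k kl; rewrite ff fN ?(negPf kl').
  - by have [+ _] := fE k' kl'; rewrite -ff fN ?(negPf kl).
  - by move: ff; rewrite !fN ?(negPf kl) ?(negPf kl').
have fS : perm f_inj \in Ssub N (sumn l).
  by apply/SsubP=> k; rewrite permE leqNgt => /negPf/fN.
suff -> : polytab F l t = permL F (perm f_inj) (polytab F l t0) by rewrite eh // hc linearZ.
rewrite permL_polytab // /polytab.
have tt k : (k < sumn l)%N -> tact (perm f_inj) t0 k = t k.
  by move=> kl; rewrite ffunE permE; case: (fE k kl).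
have -> : rowtab l (tact (perm f_inj) t0) = rowtab l t.
  by apply/ffunP=> k; rewrite [LHS]ffunE [RHS]ffunE; case: ifP => // /tt ->.
apply: eq_bigl => s; apply/colgrpP/colgrpP=> -[K1 K2]; split=> // k kl.
  by rewrite !tt ?K1 // (Ssub_lt _ K2).
by have := K1 k kl; rewrite !tt // (Ssub_lt _ K2).
Qed.

(** A map that is nonzero on a polytabloid must be detected by [kap] on some tabloid of shape mu,
    which is then transverse to t. Hence l dominates mu. *)
Lemma specht_hom_rows l mu h t : sumn l = sumn mu -> ispart l -> (sumn l <= N)%N ->
  istab l t -> equivariant (sumn l) h ->
  h (polytab F l t) \in specht F N mu -> h (polytab F l t) != 0 ->
  exists2 t' : tab, istab mu t' & forall i, (rows_lt (sumn l) t' i <= rows_lt (sumn l) t i)%N.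
Proof.
move=> lm pl lN tl eh hS nz.
have [t' /andP[tm nz']|none] := pickP [pred t' : tab | istab mu t' & kap l t (delta F (rowtab mu t')) != 0].
  by exists t' => // i; apply: rows_lt_le => //; apply: kap_transverse nz'.
case/negP: nz; rewrite equivariant_polytab // scaler_eq0 -memv0; apply/orP; right.
apply: (kap_specht_ind _ hS) => t' tm; rewrite memv0.
by have := none t'; rewrite /= tm /= => /negbFE.
Qed.

Lemma rows_lt_tab l t t' i : ispart l -> (sumn l <= N)%N -> istab l t -> istab l t' ->
  rows_lt (sumn l) t i = rows_lt (sumn l) t' i.
Proof.
move=> pl lN tl tl'; elim: i => [|i IH]; last by rewrite !rows_ltS // IH.
by rewrite /rows_lt !eq_card0 // => k; rewrite inE andbF.
Qed.

(** A nonzero h gives dominance in one direction only. An equivariant k' with k k' k = k on the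
    Specht module of l is a nonzero map back, which gives the other direction; dominance both ways
    forces l = mu. *)
Lemma specht_hom0 l mu h : sumn l = sumn mu -> ispart l -> ispart mu -> (sumn l <= N)%N ->
  l != mu -> equivariant (sumn l) h ->
  {in specht F N l, forall v, h v \in specht F N mu} -> {in specht F N l, forall v, h v = 0}.
Proof.
move=> lm pl pm lN neq eh hS.
pose m := sumn l.
have sl : stable m (specht F N l) by apply: specht_stable.
have sm : stable m (specht F N mu) by rewrite /m lm; apply: specht_stable.
have [el [eel elS el_id]] := equivariant_proj charF sl.
have [em [eem emS em_id]] := equivariant_proj charF sm.
pose k := (em \o (h \o el))%VF.
have ek : equivariant m k by do 2! [apply: equivariant_comp => //].
have kE v : k v = em (h (el v)) by apply: comp3_lfunE.
clearbody k.
have kh v : v \in specht F N l -> k v = h v.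
  by move=> lv; rewrite kE (el_id v lv) (em_id _ (hS _ lv)).
pose k' := (el \o (einv m k \o em))%VF.
have k'E v : k' v = el (einv m k (em v)) by apply: comp3_lfunE.
have ek' : equivariant m k'.
  by apply: equivariant_comp => //; apply: equivariant_comp => //; apply: avg_equivariant.
have kk' v : v \in specht F N l -> k (k' (k v)) = k v.
  move=> lv; have kS : k v \in specht F N mu by rewrite kE emS.
  have kp w : k (el w) = k w by rewrite !kE (el_id _ (elS w)).
  by rewrite k'E (em_id _ kS) kp einvK.
have [t /andP[tl nz]|none] := pickP [pred t : tab | istab l t & h (polytab F l t) != 0]; last first.
  move=> v lv; apply/eqP; rewrite -memv0; move: v lv; apply: specht_ind => t tl.
  by rewrite memv0; have := none t; rewrite /= tl /= => /negbFE.
have lt := specht_polytab tl.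
have [t' tm le1] := specht_hom_rows lm pl lN tl eh (hS _ lt) nz.
have nz2 : k' (k (polytab F l t)) != 0.
  by apply: contraNneq nz => E; rewrite -kh // -kk' // E linear0.
have [t2 /andP[tm2 nz3]|none] := pickP [pred t2 : tab | istab mu t2 & k' (polytab F mu t2) != 0]; last first.
  case/negP: nz2; rewrite -memv0; apply: (specht_ind (l := mu)); last by rewrite kh ?hS.
  by move=> t2 tm2; rewrite memv0; have := none t2; rewrite /= tm2 /= => /negbFE.
have k'S : k' (polytab F mu t2) \in specht F N l by rewrite k'E elS.
have ek2 : equivariant (sumn mu) k' by rewrite -lm.
have muN : (sumn mu <= N)%N by rewrite -lm.
have [t3 tl3 le2] := specht_hom_rows (esym lm) pm muN tm2 ek2 k'S nz3.
case/eqP: neq; apply: (transverse_eq pl pm lm lN tl tm) => i.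
apply/eqP; rewrite eqn_leq le1 /=; have := le2 i.
rewrite (rows_lt_tab i pm muN tm2 tm) -lm; congr (_ <= _)%N.
exact: rows_lt_tab.
Qed.

End Polytabloids.

(** * Removing a corner from a Specht module *)

Section Branch.
Variables (F : fieldType) (N : nat).
Hypothesis charF : [pchar F] =i pred0.
Notation E := (vec F (tabloid N)).
Notation tab := {ffun 'I_N -> 'I_N * 'I_N}.
Implicit Types (s : 'S_N) (t : tab) (k : 'I_N).

Section Step.
Variables (l b : seq nat) (x0 : 'I_N) (corner : 'I_N * 'I_N).
Hypotheses (pl : ispart l) (pb : ispart b) (bl : b = incr_nth l corner.1).
Hypotheses (x0l : x0 = sumn l :> nat) (cl : corner.2 = nth 0%N l corner.1 :> nat).

Let sb : sumn b = (sumn l).+1.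
Proof.
rewrite bl; elim: (l) (nat_of_ord corner.1) => [|a l' IH] [|i] //=; last by rewrite IH addnS.
by elim: i => //= i ->.
Qed.

Let lt_b k : (k < sumn b)%N = (k < sumn l)%N || (k == x0).
Proof. by rewrite sb ltnS leq_eqVlt orbC -val_eqE /= x0l. Qed.

Let lt_x0 k : (k < sumn l)%N -> k != x0.
Proof. by move=> kl; rewrite -val_eqE /= x0l ltn_eqF. Qed.

Let x0b : (x0 < sumn b)%N. Proof. by rewrite lt_b eqxx orbT. Qed.

Let isbox_b (bx : 'I_N * 'I_N) : isbox b bx = isbox l bx || (bx == corner).
Proof.
rewrite !isboxE // bl nth_incr_nth; case: bx => r c /=.
have -> : ((r, c) == corner) = (r == corner.1) && (c == corner.2) by [].
have [->|ne] := eqVneq r corner.1; last by rewrite eq_sym (negbTE (ne : nat_of_ord r != _)) orbF.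
by rewrite eqxx add1n ltnS leq_eqVlt orbC -[c == _]val_eqE /= cl.
Qed.

Let lN : (sumn l <= N)%N. Proof. by rewrite -x0l ltnW. Qed.

Definition remove_last (r : tabloid N) : tabloid N := [ffun k => if k == x0 then None else r k].

(** James's map from the proof of the branching theorem. *)
Definition theta : 'End(E) :=
  lext (fun r : tabloid N => if r x0 == Some corner.1 then delta F (remove_last r) else 0).

Lemma theta_equivariant : equivariant (sumn l) theta.
Proof.
move=> s /SsubP sl v; rewrite -comp_lfunE -[RHS]comp_lfunE; apply: hom_delta_eq => r.
rewrite !comp_lfunE permL_delta !lext_delta ffunE sl ?x0l //.
case: ifP => _; last by rewrite linear0.
rewrite permL_delta; congr delta; apply/ffunP=> k; rewrite !ffunE.
by rewrite -{2}(sl x0) ?x0l // (inj_eq perm_inj).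
Qed.

Lemma istab_corner t : istab b t -> t x0 = corner -> istab l t.
Proof.
move=> /istabP[H1 H2] tx; apply/istabP; split=> [k kl|k k' kl kl'].
  have := H1 k; rewrite lt_b kl isbox_b => /(_ isT)/orP[//|/eqP tk].
  have := lt_x0 kl; rewrite (H2 k x0) ?eqxx // ?lt_b ?kl ?eqxx ?orbT //.
  by rewrite tk tx.
by apply: H2; rewrite lt_b ?kl ?kl'.
Qed.

Definition add_corner t : tab := [ffun k => if k == x0 then corner else t k].

Lemma istab_add_corner t : istab l t -> istab b (add_corner t).
Proof.
move=> /istabP[H1 H2]; have nc k : (k < sumn l)%N -> t k != corner.
  move=> /H1 tk; apply: contraTneq tk => ->.
  by rewrite isboxE // cl ltnn.
apply/istabP; split=> [k|k k']; rewrite ?ffunE !lt_b.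
  by case: eqVneq => [_ _|_]; rewrite isbox_b ?eqxx ?orbT // orbF => /H1 ->.
case: (eqVneq k x0) => [->|_]; case: (eqVneq k' x0) => [->|_] //; rewrite ?orbF.
- by move=> _ /nc /eqP kc /esym.
- by move=> /nc /eqP.
- exact: H2.
Qed.

Lemma polytab_ext t t' : (forall k, (k < sumn l)%N -> t k = t' k) -> polytab F l t = polytab F l t'.
Proof.
move=> tt; rewrite /polytab.
have -> : rowtab l t = rowtab l t'.
  by apply/ffunP=> k; rewrite [LHS]ffunE [RHS]ffunE; case: ifP => // /tt ->.
apply: eq_bigl => s; apply/colgrpP/colgrpP=> -[K1 K2]; split=> // k kl.
  by rewrite -!tt ?K1 // (Ssub_lt _ K2).
by have := K1 k kl; rewrite -!tt // (Ssub_lt _ K2).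
Qed.

(** A column permutation keeps the last entry in the column of the corner. If it also leaves it in
    the row of the corner, it fixes that entry, so the surviving terms are those of the column group
    of the smaller tableau. *)
Lemma theta_polytab t : istab b t -> t x0 = corner -> theta (polytab F b t) = polytab F l t.
Proof.
move=> tb tx; have [H1 H2] := istabP _ _ tb.
rewrite !polytabE !kapE linear_sum /=.
rewrite (bigID (fun s : 'S_N => s x0 == x0)) /= [X in _ + X]big1 ?addr0 => [|s /andP[cs sx]]; last first.
  have [K1 K2] := colgrpP _ _ _ cs.
  rewrite linearZ /= permL_delta lext_delta !ffunE (Ssub_lt _ K2) x0b.
  case: eqP => [[E]|_]; last by rewrite scaler0.
  case/eqP: sx; apply: H2; rewrite ?(Ssub_lt _ K2) // tx.
  by rewrite [LHS]surjective_pairing E K1 // tx -surjective_pairing.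
apply: eq_big => s.
  apply/andP/colgrpP=> [[/colgrpP[K1 K2] /eqP sx]|[K1 K2]].
    split=> [k kl|]; first by rewrite K1 // lt_b kl.
    apply/SsubP=> k; rewrite leq_eqVlt => /orP[/eqP kx|]; last by rewrite -sb => /(SsubP _ _ K2).
    by have -> : k = x0 by apply: val_inj; rewrite /= x0l.
  have sx : s x0 = x0 by apply: (SsubP _ _ K2); rewrite x0l.
  split; last exact/eqP; apply/colgrpP; split.
    by move=> k; rewrite lt_b => /orP[/K1 //|/eqP->]; rewrite sx.
  by apply: Ssub_sub K2; rewrite sb.
case/andP=> /colgrpP[K1 K2] /eqP sx; rewrite linearZ /= !permL_delta lext_delta !ffunE sx x0b tx eqxx.
congr (_ *: delta _ _); apply/ffunP=> k; rewrite !ffunE.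
have [->|nk] := eqVneq k x0; first by rewrite sx x0l ltnn.
by rewrite lt_b -sx (inj_eq perm_inj) (negPf nk) orbF.
Qed.

Definition corner_span : {vspace E} :=
  <<[seq polytab F b t | t <- enum [pred t : tab | istab b t & t x0 == corner]]>>%VS.

Lemma corner_ind (V : vectType F) (U : {vspace V}) (f : 'Hom(E, V)) :
  (forall t, istab b t -> t x0 = corner -> f (polytab F b t) \in U) ->
  {in corner_span, forall v, f v \in U}.
Proof.
move=> H; apply: span_mem => _ /mapP[t + ->]; rewrite mem_enum => /andP[tb /eqP tx].
exact: H.
Qed.

Lemma corner_polytab t : istab b t -> t x0 = corner -> polytab F b t \in corner_span.
Proof.
by move=> tb tx; apply/memv_span/map_f; rewrite mem_enum; apply/andP; split=> //; apply/eqP.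
Qed.

Lemma corner_stable : stable (sumn l) corner_span.
Proof.
move=> s sl; apply: corner_ind => t tb tx.
have sb' : s \in Ssub N (sumn b) by apply: Ssub_sub sl; rewrite sb.
rewrite permL_polytab // corner_polytab ?istab_tact // ffunE.
by rewrite (SsubP _ _ sl) // x0l.
Qed.

(* On the span of the polytabloids with the last entry in the removed corner,
   theta is an equivariant surjection onto the smaller Specht module. *)
Lemma branch_maps : exists phi pi : 'End(E),
  [/\ equivariant (sumn l) phi, equivariant (sumn l) pi,
      {in specht F N l, forall v, phi v \in specht F N b},
      {in specht F N b, forall v, pi v \in specht F N l} &
      {in specht F N l, forall v, pi (phi v) = v}].
Proof.
pose m := sumn l.
have sl : stable m (specht F N l) by apply: specht_stable.
have sU : stable m corner_span by apply: corner_stable.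
have [el [eel elS el_id]] := equivariant_proj charF sl.
have [eU [eeU eUS eU_id]] := equivariant_proj charF sU.
(* The projections on both sides extend [theta] on the corner span to an equivariant endomorphism of
   the whole space with values in the smaller Specht module, so that [einv] provides a section. *)
pose k := (el \o (theta \o eU))%VF.
have ek : equivariant m k.
  by apply: equivariant_comp => //; apply: equivariant_comp => //; apply: theta_equivariant.
have kE v : k v = el (theta (eU v)) by apply: comp3_lfunE.
clearbody k.
pose phi := (eU \o (einv m k \o el))%VF.
have pE v : phi v = eU (einv m k (el v)) by apply: comp3_lfunE.
have kU t : istab b t -> t x0 = corner -> k (polytab F b t) = polytab F l t.
  move=> tb tx; rewrite kE (eU_id _ (corner_polytab tb tx)).
  by rewrite theta_polytab // (el_id (polytab F l t)) // specht_polytab // istab_corner.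
have kproj v : k (eU v) = k v by rewrite !kE (eU_id _ (eUS v)).
exists phi, k; split=> //.
- by apply: equivariant_comp => //; apply: equivariant_comp => //; apply: avg_equivariant.
- move=> v lv; have : phi v \in corner_span by rewrite pE eUS.
  rewrite -{2}[phi v]id_lfunE; move: (phi v); apply: corner_ind => t tb _.
  by rewrite id_lfunE specht_polytab.
- by move=> v _; rewrite kE elS.
- move=> v lv; rewrite pE kproj (el_id v lv).
  have := span_eq (f := (k \o einv m k)%VF) (g := \1%VF) _ lv.
  rewrite comp_lfunE id_lfunE; apply=> _ /mapP[t + ->].
  rewrite mem_enum comp_lfunE id_lfunE => tl.
  have tb := istab_add_corner tl; have tx : add_corner t x0 = corner by rewrite ffunE eqxx.
  have -> : polytab F l t = k (polytab F b (add_corner t)).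
    rewrite kU //; apply: polytab_ext => j jl.
    by rewrite ffunE (negPf (lt_x0 jl)).
  by rewrite einvK.
Qed.

End Step.

Lemma branch l b : sqsubset l b -> (sumn b <= N)%N -> exists phi pi : 'End(E),
  [/\ equivariant (sumn l) phi, equivariant (sumn l) pi,
      {in specht F N l, forall v, phi v \in specht F N b},
      {in specht F N b, forall v, pi v \in specht F N l} &
      {in specht F N l, forall v, pi (phi v) = v}].
Proof.
case/and3P=> pl pb /existsP[i /eqP bl] bN.
have sb : sumn b = (sumn l).+1.
  rewrite -bl; elim: (l) (nat_of_ord i) => [|a l' IH] [|j] //=; last by rewrite IH addnS.
  by elim: j => //= j ->.
have lN : (sumn l < N)%N by rewrite -sb.
have iN : (i < N)%N by apply: leq_trans (ltn_ord i) (leq_trans (ispart_size pb) bN).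
have cN : (nth 0%N l i < N)%N by apply: leq_ltn_trans (nth_le_sumn _ _) lN.
exact: (@branch_maps l b (Ordinal lN) (Ordinal iN, Ordinal cN)).
Qed.

End Branch.

(** * Young's lattice and the branching rules *)

Section Young.
Local Open Scope nat_scope.
Implicit Types (l a b : seq nat).

Lemma sumn_incr_nth l i : sumn (incr_nth l i) = (sumn l).+1.
Proof.
elim: l i => [|k l IH] [|i] //=; last by rewrite IH addnS.
by elim: i => //= i ->.
Qed.

Lemma ispart_of_nth K (f : nat -> nat) : (forall i, f i.+1 <= f i) -> f K = 0 ->
  ispart [seq k <- mkseq f K | 0 < k] /\ nth 0 [seq k <- mkseq f K | 0 < k] =1 f.
Proof.
move=> fS fK; have fm i j : i <= j -> f j <= f i.
  by move/subnKC<-; elim: (j - i) => [|k IH]; rewrite ?addn0 // addnS (leq_trans (fS _)).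
have srt : sorted geq (mkseq f K).
  apply/(sortedP 0) => i; rewrite size_mkseq => iK.
  by rewrite !nth_mkseq ?(ltnW iK) //=.
have tr : transitive geq by move=> y x z /= yx zy; apply: leq_trans zy yx.
split.
  apply/andP; split; first exact: sorted_filter.
  by apply/allP=> k; rewrite mem_filter => /andP[].
have H (s : seq nat) i : sorted geq s -> nth 0 [seq k <- s | 0 < k] i = nth 0 s i.
  elim: s i => //= k s IH i ks; have [k0|] := ltnP 0 k.
    by case: i => //= i; apply: IH; apply: path_sorted ks.
  rewrite leqn0 => /eqP k0; rewrite k0 in ks *.
  have s0 : all (pred1 0) s.
    have := order_path_min tr ks; apply: sub_all => j /=.
    by rewrite leqn0.
  rewrite (@eq_in_filter _ _ pred0 s) ?filter_pred0 ?nth_nil; last first.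
    by move=> j /(allP s0)/eqP->.
  case: i => //= i; have [il|li] := ltnP i (size s); last by rewrite nth_default.
  by have /eqP-> := allP s0 _ (mem_nth 0 il).
move=> i; rewrite H //; have [iK|Ki] := ltnP i K; first by rewrite nth_mkseq.
rewrite nth_default ?size_mkseq //; apply/esym/eqP; rewrite -leqn0 -fK; exact: fm.
Qed.

Definition addable l i := (i == 0) || (nth 0 l i < nth 0 l i.-1).
Definition removable l j := nth 0 l j.+1 < nth 0 l j.
Definition dn l j := [seq k <- mkseq (fun i => nth 0 l i - (i == j)) (size l) | 0 < k].

Lemma ispartP l : ispart l <->
  (forall i, nth 0 l i.+1 <= nth 0 l i) /\ (forall i, i < size l -> 0 < nth 0 l i).
Proof.
split=> [pl|[H1 H2]].
  split=> i; first exact: ispart_nth.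
  by rewrite ispart_gt0.
apply/andP; split; first by apply/(sortedP 0) => i _ /=; apply: H1.
by apply/(all_nthP 0).
Qed.

Lemma addable_size l i : addable l i -> i <= size l.
Proof.
case/orP=> [/eqP->//|]; rewrite [i <= _]leqNgt; apply: contraTN => li.
by rewrite -leqNgt [nth 0 l i.-1]nth_default //; case: i li.
Qed.

Lemma ispart_incr l i : ispart l -> ispart (incr_nth l i) = addable l i.
Proof.
move=> /ispartP[H1 H2]; apply/idP/idP=> [pb|ai].
  case: i pb => // i /ispartP[/(_ i) + _]; rewrite !nth_incr_nth eqxx.
  by rewrite [i.+1 == i]gtn_eqF // add0n add1n.
apply/ispartP; split=> j; rewrite !nth_incr_nth.
  have [ij|_] := eqVneq i j.+1; last by rewrite add0n (leq_trans (H1 _)) ?leq_addl.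
  by rewrite ij /= add1n -ij; move: ai; rewrite ij /addable /= [j.+1 == j]gtn_eqF.
rewrite size_incr_nth; have isz := addable_size ai.
have [->|ne] := eqVneq i j; first by rewrite add1n.
case: ifP => [_|_ ji]; rewrite add0n; first exact: H2.
by apply: H2; apply: leq_trans isz; rewrite ltn_neqAle eq_sym ne -ltnS.
Qed.

Lemma removable_size l j : removable l j -> j < size l.
Proof. by rewrite /removable; case: (ltnP j (size l)) => // lj; rewrite [nth 0 l j]nth_default. Qed.

Lemma dn_spec l j : ispart l -> removable l j ->
  ispart (dn l j) /\ (forall i, nth 0 (dn l j) i = nth 0 l i - (i == j)).
Proof.
move=> pl rj; apply: ispart_of_nth => [i|]; last first.
  by rewrite nth_default.
have H := ispart_nth pl (leqnSn i); have [ij|ij] := eqVneq i j.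
  by move: rj; rewrite /removable -ij eqn_leq ltnn /= subn0; lia.
by rewrite subn0 (leq_trans (leq_subr _ _)).
Qed.

Lemma incr_dn l j : ispart l -> removable l j -> incr_nth (dn l j) j = l.
Proof.
move=> pl rj; have [pd nd] := dn_spec pl rj.
have pi : ispart (incr_nth (dn l j) j).
  rewrite ispart_incr // /addable !nd eqxx; case: j rj {pd nd} => //= j rj.
  have := ispart_nth pl (leqnSn j); move: rj; rewrite /removable.
  by rewrite [j == j.+1]ltn_eqF //; lia.
apply: ispart_ext => // i; rewrite nth_incr_nth nd eq_sym.
by have [->|_] := eqVneq i j; move: rj; rewrite /removable; lia.
Qed.

Lemma incr_removable l i : ispart l -> addable l i -> removable (incr_nth l i) i.
Proof.
move=> pl ai; rewrite /removable !nth_incr_nth eqxx ltn_eqF // add0n add1n ltnS.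
exact: ispart_nth.
Qed.

Lemma dn_incr l i : ispart l -> addable l i -> dn (incr_nth l i) i = l.
Proof.
move=> pl ai; have pb : ispart (incr_nth l i) by rewrite ispart_incr.
have [pd nd] := dn_spec pb (incr_removable pl ai).
by apply: ispart_ext => // j; rewrite nd nth_incr_nth eq_sym; case: eqVneq => _; lia.
Qed.

Lemma swap_boxes l i j : ispart l -> i != j ->
  addable l i && removable (incr_nth l i) j = removable l j && addable (dn l j) i.
Proof.
move=> pl ij; apply/andP/andP=> -[].
  move=> ai; rewrite /removable !nth_incr_nth (negPf ij) add0n => rj.
  have rlj : removable l j by apply: leq_ltn_trans rj; apply: leq_addl.
  split=> //; have [_ nd] := dn_spec pl rlj.
  rewrite /addable !nd (negPf ij) subn0; case: i ai ij rj => //= i ai ij rj.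
  by move: ai; rewrite /addable /=; move: rj; rewrite eqSS; case: eqVneq => [->|_]; lia.
move=> rj; have [_ nd] := dn_spec pl rj.
rewrite {1}/addable !nd (negPf ij) subn0 => ai; split.
  by case: i ai ij => //= i ai ij; move: ai; rewrite /addable /=; lia.
rewrite /removable !nth_incr_nth (negPf ij) add0n; move: rj; rewrite /removable => rj.
have [ij1|_] := eqVneq i j.+1; last by rewrite add0n.
by move: ai; rewrite ij1 /= eqxx; lia.
Qed.

Lemma swap_boxes_eq l i j : ispart l -> i != j -> addable l i -> removable (incr_nth l i) j ->
  dn (incr_nth l i) j = incr_nth (dn l j) i.
Proof.
move=> pl ij ai rj; have pb : ispart (incr_nth l i) by rewrite ispart_incr.
have := swap_boxes pl ij; rewrite ai rj => /esym/andP[rl ad].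
have [pd nd] := dn_spec pb rj; have [pd' nd'] := dn_spec pl rl.
apply: ispart_ext => //; first by rewrite ispart_incr.
move=> k; rewrite nd !nth_incr_nth nd'.
by have [ik|_] := eqVneq i k; rewrite ?add0n // -ik (negPf ij) !subn0.
Qed.

Definition up l := [seq incr_nth l i | i <- iota 0 (size l).+1 & addable l i].
Definition down l := [seq dn l j | j <- iota 0 (size l) & removable l j].

Lemma big_up l K (g : seq nat -> nat) : size l < K ->
  \sum_(b <- up l) g b = \sum_(i < K | addable l i) g (incr_nth l i).
Proof.
move=> lK; rewrite big_map big_filter -(big_mkord (addable l) (fun i => g (incr_nth l i))).
rewrite (big_cat_nat (n := (size l).+1)) //= [X in _ = _ + X]big_nat_cond.
rewrite [X in _ = _ + X]big1 ?addn0; first by rewrite /index_iota subn0.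
by move=> i /andP[/andP[li _] /addable_size]; rewrite leqNgt li.
Qed.

Lemma big_down l K (g : seq nat -> nat) : size l <= K ->
  \sum_(b <- down l) g b = \sum_(i < K | removable l i) g (dn l i).
Proof.
move=> lK; rewrite big_map big_filter -(big_mkord (removable l) (fun i => g (dn l i))).
rewrite (big_cat_nat (n := size l)) //= [X in _ = _ + X]big_nat_cond.
rewrite [X in _ = _ + X]big1 ?addn0; first by rewrite /index_iota subn0.
by move=> i /andP[/andP[li _] /removable_size]; rewrite ltnNge li.
Qed.

(** Row 0 is always addable, and row i + 1 is addable exactly when row i is removable. *)
Lemma count_addable l K : ispart l -> size l < K ->
  \sum_(i < K | addable l i) 1 = (\sum_(j < K | removable l j) 1).+1.
Proof.
case: K => // K pl; rewrite ltnS => lK.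
rewrite big_mkcond big_ord_recl /= add1n; congr _.+1.
rewrite [RHS]big_mkcond big_ord_recr /= ifF ?addn0; last first.
  by apply/negbTE/negP=> /removable_size; rewrite ltnNge lK.
by apply: eq_bigr => i _; rewrite /addable /= /bump /=.
Qed.

(** Adding and removing in the same row contributes [f l] once per addable row on the left and once
    per removable row on the right; [count_addable] leaves one copy. The terms for different rows
    match by [swap_boxes]. *)
Lemma up_down l (f : seq nat -> nat) : ispart l ->
  \sum_(b <- up l) \sum_(a <- down b) f a = f l + \sum_(a <- down l) \sum_(b <- up a) f b.
Proof.
move=> pl; set K := (size l).+2.
have szi i : addable l i -> size (incr_nth l i) <= K.
  by move/addable_size=> il; rewrite size_incr_nth; case: ifP => _; rewrite /K; lia.
have szd j : size (dn l j) < K.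
  by rewrite size_filter (leq_ltn_trans (count_size _ _)) // size_mkseq.
rewrite (@big_up l K) // (@big_down l K); last by rewrite /K -addn2 leq_addr.
rewrite (eq_bigr (fun i : 'I_K => f l + \sum_(j < K | (i != j) && removable (incr_nth l i) j)
     f (dn (incr_nth l i) j))); last first.
  move=> i ai; rewrite (big_down _ (szi _ ai)) (bigD1 i) ?incr_removable //= dn_incr //.
  by congr addn; apply: eq_bigl => j; rewrite andbC -val_eqE eq_sym.
rewrite [X in _ = _ + X](eq_bigr (fun j : 'I_K => f l + \sum_(i < K | (i != j) && addable (dn l j) i)
     f (incr_nth (dn l j) i))); last first.
  move=> j rj; rewrite (big_up _ (szd j)) (bigD1 j) /=; last first.
    by rewrite -ispart_incr ?incr_dn //; case: (dn_spec pl rj).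
  by rewrite incr_dn //; congr addn; apply: eq_bigl => i; rewrite andbC.
rewrite !big_split /= addnA; congr addn.
  have := count_addable pl (ltnW (ltnSn (size l).+1)); rewrite -/K !sum1_card => cE.
  by rewrite !sum_nat_const cE mulSn.
rewrite !pair_big_dep /= [RHS](reindex (fun p : 'I_K * 'I_K => (p.2, p.1))) /=; last first.
  by exists (fun p => (p.2, p.1)) => -[].
apply: eq_big => [[i j]|[i j]] /=.
  have [->|ij] := eqVneq i j; first by rewrite /= !andbF.
  by rewrite /= swap_boxes.
by case/andP=> ai /andP[ij rj]; rewrite swap_boxes_eq.
Qed.

Lemma mem_up l b : ispart l -> (b \in up l) = sqsubset l b.
Proof.
move=> pl; apply/mapP/and3P=> [[i]|[_ pb /existsP[i /eqP ib]]].
  rewrite mem_filter => /andP[ai _] ->; rewrite ispart_incr //; split=> //.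
  have isz : i < size (incr_nth l i).
    by rewrite size_incr_nth; case: (ltnP i (size l)).
  by apply/existsP; exists (Ordinal isz).
have ai : addable l i by rewrite -ispart_incr // ib.
by exists (val i); rewrite ?ib // mem_filter ai mem_iota add0n ltnS addable_size.
Qed.

Lemma mem_down l a : ispart l -> (a \in down l) = sqsubset a l.
Proof.
move=> pl; apply/mapP/and3P=> [[j]|[pa _ /existsP[[i /= _] /eqP il]]].
  rewrite mem_filter => /andP[rj _] ->; have [pd _] := dn_spec pl rj; split=> //.
  by apply/existsP; exists (Ordinal (removable_size rj)); rewrite /= incr_dn.
have ai : addable a i by rewrite -ispart_incr // il.
have rj : removable l i by rewrite -il incr_removable.
exists i; last by rewrite -il dn_incr.
by rewrite mem_filter rj mem_iota add0n removable_size.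
Qed.

Lemma up_uniq l : uniq (up l).
Proof.
rewrite map_inj_uniq ?filter_uniq ?iota_uniq // => i j /(congr1 (fun s => nth 0 s i)).
by rewrite !nth_incr_nth eqxx; case: (eqVneq j i) => [->|_] //; lia.
Qed.

Lemma down_uniq l : ispart l -> uniq (down l).
Proof.
move=> pl; rewrite map_inj_in_uniq ?filter_uniq ?iota_uniq // => i j.
rewrite !mem_filter => /andP[ri _] /andP[rj _] E; have [_ ni] := dn_spec pl ri.
have [_ nj] := dn_spec pl rj; have := nj i; rewrite -E ni eqxx.
have : 0 < nth 0 l i by move: ri; rewrite /removable; lia.
by case: (eqVneq i j) => [->|_] //; lia.
Qed.

Lemma sqsubset_sumn a b : sqsubset a b -> sumn b = (sumn a).+1.
Proof. by case/and3P=> _ _ /existsP[i /eqP<-]; apply: sumn_incr_nth. Qed.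

Lemma down_ex b : ispart b -> 0 < sumn b -> exists a, sqsubset a b.
Proof.
move=> pb b0; have sb : 0 < size b by case: (b) b0.
have rj : removable b (size b).-1.
  rewrite /removable prednK // [nth 0 b (size b)]nth_default // -(ispart_gt0 _ pb).
  by rewrite ltn_predL.
exists (dn b (size b).-1); rewrite -mem_down //.
by apply/mapP; exists (size b).-1; rewrite ?mem_filter ?rj ?mem_iota ?add0n ?ltn_predL.
Qed.

End Young.

Import VectorInternalTheory.

(** * Traces of idempotents *)

Section Trace.
Variables (F : fieldType) (V : vectType F).
Implicit Types f g h : 'End(V).

Lemma v2r_lfun f v : v2r (f v) = v2r v *m f2mx f.
Proof. by rewrite unlock /= r2vK. Qed.

Lemma mulmx_ext n p (A B : 'M[F]_(n, p)) : (forall u : 'rV_n, u *m A = u *m B) -> A = B.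
Proof. by move=> H; apply/row_matrixP=> i; rewrite !rowE H. Qed.

Definition tr_end f := \tr (f2mx f).

Lemma f2mx_comp f g : f2mx (f \o g)%VF = f2mx g *m f2mx f.
Proof.
apply: mulmx_ext => u; rewrite -[u]r2vK -v2r_lfun comp_lfunE /= mulmxA.
by rewrite -v2r_lfun -v2r_lfun.
Qed.

Lemma f2mx_scale a f : f2mx (a *: f) = a *: f2mx f.
Proof.
apply: mulmx_ext => u; rewrite -[u]r2vK -v2r_lfun scale_lfunE -scalemxAr.
by rewrite -v2r_lfun linearZ.
Qed.

Lemma f2mx_add f g : f2mx (f + g) = f2mx f + f2mx g.
Proof.
apply: mulmx_ext => u; rewrite -[u]r2vK -v2r_lfun add_lfunE mulmxDr.
by rewrite -!v2r_lfun linearD.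
Qed.

Lemma tr_endC f g : tr_end (f \o g)%VF = tr_end (g \o f)%VF.
Proof. by rewrite /tr_end !f2mx_comp mxtrace_mulC. Qed.

Lemma tr_endZ a f : tr_end (a *: f) = a * tr_end f.
Proof. by rewrite /tr_end f2mx_scale mxtraceZ. Qed.

Lemma tr_end_sum (I : finType) (P : pred I) (f : I -> 'End(V)) :
  tr_end (\sum_(i | P i) f i) = \sum_(i | P i) tr_end (f i).
Proof.
apply: (big_morph tr_end) => [g h|].
  by rewrite /tr_end f2mx_add mxtraceD.
by rewrite -(scale0r (0 : 'End(V))) tr_endZ mul0r.
Qed.

(** The trace is the rank: in a rank factorization A = C R of an idempotent matrix, R C is the
    identity. *)
Lemma tr_end_idem f : (forall v, f (f v) = f v) -> f != 0 ->
  exists2 r : nat, (0 < r)%N & tr_end f = r%:R.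
Proof.
move=> ff f0; set A := f2mx f; exists (\rank A).
  rewrite lt0n mxrank_eq0; apply: contraNneq f0 => A0; apply/eqP/lfunP=> v.
  by apply: (can_inj v2rK); rewrite v2r_lfun -/A A0 mulmx0 zero_lfunE linear0.
have AA : A *m A = A.
  rewrite -f2mx_comp; congr f2mx; apply/lfunP=> v; by rewrite comp_lfunE.
rewrite /tr_end -/A; have := mulmx_base A; have := row_base_free A; have := col_base_full A.
move: (col_base A) (row_base A) => C R fC fR CR.
have RC : R *m C = 1%:M.
  apply: (row_free_inj fR); rewrite mul1mx; apply: (row_full_inj fC).
  by rewrite !mulmxA CR -mulmxA CR AA.
have -> : \tr A = \tr (R *m C) by rewrite mxtrace_mulC CR.
by rewrite RC mxtrace1.
Qed.

End Trace.

(** * Orthogonal retracts and a count of dimensions *)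

Section Retract.
Variables (F : fieldType) (V A : vectType F) (T : eqType).
Variables (s : seq T) (U : T -> {vspace V}) (K : T -> 'Hom(V, A)) (G : T -> 'Hom(A, V)).
Variable A0 : {vspace A}.
Hypothesis s_uniq : uniq s.
Hypothesis KU : forall b, b \in s -> forall v, v \in U b -> K b v \in A0.
Hypothesis GK : forall b b', b \in s -> b' \in s -> forall v, v \in U b ->
  G b' (K b v) = if b == b' then v else 0.

Let sumK : \dim (\sum_(b <- s) (K b @: U b)) = (\sum_(b <- s) \dim (U b))%N.
Proof.
elim: s s_uniq KU GK => [|b s' IH] /= => [_ _ _|/andP[bs us] KU' GK'].
  by rewrite !big_nil dimv0.
have KU2 b' : b' \in s' -> forall v, v \in U b' -> K b' v \in A0.
  by move=> b's; apply: KU'; rewrite inE b's orbT.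
have GK2 b1 b2 : b1 \in s' -> b2 \in s' -> forall v, v \in U b1 ->
    G b2 (K b1 v) = if b1 == b2 then v else 0.
  by move=> b1s b2s; apply: GK'; rewrite inE ?b1s ?b2s orbT.
rewrite !big_cons -(IH us KU2 GK2) dimv_disjoint_sum; last first.
  apply/eqP; rewrite -subv0; apply/subvP=> a /memv_capP[/memv_imgP[v vU ->]].
  move=> kv; have : G b (K b v) = 0.
    move: kv; move: (K b v) => w; rewrite big_seq; elim/big_ind: (_) w => [w|W1 W2 H1 H2 w|b' b's w].
    - by rewrite memv0 => /eqP->; rewrite linear0.
    - by case/memv_addP=> w1 /H1 e1 [w2 /H2 e2 ->]; rewrite linearD /= e1 e2 addr0.
    - case/memv_imgP=> v' v'U ->; rewrite GK' ?inE ?b's ?orbT ?eqxx //.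
      by rewrite (negPf (memPn bs _ b's)).
  by rewrite GK' ?inE ?eqxx // => ->; rewrite linear0 mem0v.
congr addn; apply: limg_dim_eq; apply/eqP; rewrite -subv0; apply/subvP=> v.
case/memv_capP=> vU; rewrite memv_ker => /eqP kv; rewrite memv0.
by have := GK' b b _ _ v vU; rewrite inE eqxx kv linear0 => /(_ isT isT) <-.
Qed.

Let sumA0 : (\sum_(b <- s) (K b @: U b) <= A0)%VS.
Proof.
rewrite big_seq; elim/big_ind: _ => [|W1 W2 H1 H2|b bs]; first exact: sub0v.
  by rewrite subv_add H1.
by apply/subvP=> _ /memv_imgP[v vU ->]; apply: KU.
Qed.

Lemma retract_dim : (\sum_(b <- s) \dim (U b) <= \dim A0)%N.
Proof. by rewrite -sumK; apply: dimvS. Qed.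

(** The maps [G] show that the images of the [U b] are independent copies inside [A0]. Once the
    dimensions add up these images fill [A0], and the sum of the K b G b is the identity on each of
    them. *)
Lemma retract_id : (\dim A0 <= \sum_(b <- s) \dim (U b))%N ->
  {in A0, forall a, \sum_(b <- s) K b (G b a) = a}.
Proof.
rewrite -sumK => le a aA.
have {le}/eqP defA : (\sum_(b <- s) (K b @: U b))%VS == A0 by rewrite eqEdim sumA0.
move: a aA; rewrite -{}defA.
suff H (s' : seq T) : {subset s' <= s} -> forall a, a \in (\sum_(b <- s') (K b @: U b))%VS ->
    \sum_(b <- s) K b (G b a) = a by apply: H.
elim: s' => [_ a|b s' IH sub a].
  by rewrite big_nil memv0 => /eqP->; rewrite big1 // => b _; rewrite !linear0.
rewrite big_cons => /memv_addP[_ /memv_imgP[v vU ->] [w wU ->]].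
have bs : b \in s by apply: sub; rewrite inE eqxx.
under eq_bigr do rewrite !linearD /=.
have sub' : {subset s' <= s} by move=> c cs; apply: sub; rewrite inE cs orbT.
rewrite big_split /= (IH sub' _ wU).
congr (_ + _); rewrite (bigD1_seq b) //= GK // eqxx big_seq_cond big1 ?addr0 //.
by move=> b' /andP[b's b'b]; rewrite GK // eq_sym (negPf b'b) linear0.
Qed.

End Retract.

Lemma seq_choice (T : eqType) (Y : Type) (y0 : Y) (s : seq T) (P : T -> Y -> Prop) :
  (forall a, a \in s -> exists y, P a y) -> exists f : T -> Y, forall a, a \in s -> P a (f a).
Proof.
elim: s => [|b s IH] H; first by exists (fun _ => y0).
have [f Pf] := IH (fun a as_ => H a (mem_behead (s := b :: s) as_)).
have [y Py] := H b (mem_head _ _).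
exists (fun a => if a == b then y else f a) => a; rewrite inE.
by case: eqVneq => [->|_] //=; apply: Pf.
Qed.

Section Coordinates.
Variables (F : fieldType) (V : vectType F) (I : finType).
Notation A := {ffun I -> V}.

Definition inj_fun (q : I) (v : V) : A := [ffun i => if i == q then v else 0].
Fact inj_fun_linear q : linear (inj_fun q).
Proof. by move=> a u v; apply/ffunP=> i; rewrite !ffunE; case: ifP => // _; rewrite scaler0 addr0. Qed.
HB.instance Definition _ q := GRing.isLinear.Build F _ _ _ (inj_fun q) (inj_fun_linear q).
Definition injA q : 'Hom(V, A) := linfun (inj_fun q).

Definition pr_fun (q : I) (a : A) : V := a q.
Fact pr_fun_linear q : linear (pr_fun q).
Proof. by move=> a u v; rewrite /pr_fun !ffunE. Qed.
HB.instance Definition _ q := GRing.isLinear.Build F _ _ _ (pr_fun q) (pr_fun_linear q).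
Definition prA q : 'Hom(A, V) := linfun (pr_fun q).

Lemma injAE q v i : injA q v i = if i == q then v else 0.
Proof. by rewrite lfunE ffunE. Qed.

Lemma prAE q a : prA q a = a q.
Proof. by rewrite lfunE. Qed.

Lemma dim_sum_injA (P : pred I) (U : {vspace V}) :
  (\dim (\sum_(q | P q) (injA q @: U)) <= #|[pred q | P q]| * \dim U)%N.
Proof.
rewrite -sum_nat_const; apply: leq_trans (dimv_leq_sum _ _ _) _; apply: leq_sum => q _.
by rewrite -(limg_ker_dim (injA q) U) leq_addl.
Qed.

End Coordinates.

(** * Restriction and induction between Specht modules *)

Section Branching.
Variables (F : fieldType) (N : nat).
Hypothesis charF : [pchar F] =i pred0.
Notation E := (vec F (tabloid N)).
Notation Sp l := (specht F N l).
Implicit Types (s : 'S_N) (l a b : seq nat).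

Definition branch_pair a b (phi pi : 'End(E)) :=
  [/\ equivariant (sumn a) phi, equivariant (sumn a) pi,
      {in Sp a, forall v, phi v \in Sp b}, {in Sp b, forall v, pi v \in Sp a} &
      {in Sp a, forall v, pi (phi v) = v}].

(** For different a and a' the composite is an equivariant map between Specht modules of different
    shapes, hence 0 by [specht_hom0]. *)
Lemma res_maps b (sa : seq (seq nat)) : ispart b -> (sumn b <= N)%N -> (forall a, (a \in sa) = sqsubset a b) ->
  exists phi pi : seq nat -> 'End(E),
    (forall a, a \in sa -> branch_pair a b (phi a) (pi a)) /\
    (forall a a', a \in sa -> a' \in sa -> forall v, v \in Sp a ->
       pi a' (phi a v) = if a == a' then v else 0).
Proof.
move=> pb bN saE.
have [f fP] : exists f : seq nat -> 'End(E) * 'End(E),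
    forall a, a \in sa -> branch_pair a b (f a).1 (f a).2.
  apply: (seq_choice (P := fun a y => branch_pair a b y.1 y.2) (0, 0)) => a; rewrite saE => /(branch charF)/(_ bN)[phi [pi H]].
  by exists (phi, pi).
exists (fun a => (f a).1), (fun a => (f a).2); split=> // a a' as_ as' v vS.
have [e1 e2 m1 m2 K] := fP a as_; have [e1' e2' m1' m2' K'] := fP a' as'.
have [aa|ne] := eqVneq a a'; first by rewrite -aa K.
have := as_; have := as'; rewrite !saE => sa1 sa2.
have [pa' _ _] := and3P sa1; have [pa _ _] := and3P sa2.
have sE : sumn a = sumn a' by apply: succn_inj; rewrite -(sqsubset_sumn sa1) -(sqsubset_sumn sa2).
rewrite -[LHS]comp_lfunE; apply: (specht_hom0 charF sE pa pa' _ ne) => //.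
- by apply: leq_trans bN; rewrite (sqsubset_sumn sa2).
- by apply: equivariant_comp; rewrite // sE.
by move=> w wS; rewrite comp_lfunE m2' ?m1.
Qed.

Section Induction.
Variables (m : nat) (x0 : 'I_N).
Hypothesis x0m : x0 = m :> nat.

Definition tau (q : 'I_N) : 'S_N := tperm q x0.

(** The relative trace from S_m to S_(m+1). The transpositions [tau q] are their own inverses, and q
    = x0 gives the identity. *)
Definition cosum (e : 'End(E)) : 'End(E) :=
  \sum_(q : 'I_N | (q <= m)%N) (permL F (tau q) \o (e \o permL F (tau q)))%VF.

Lemma cosumE e v :
  cosum e v = \sum_(q : 'I_N | (q <= m)%N) permL F (tau q) (e (permL F (tau q) v)).
Proof. by rewrite sum_lfunE; apply: eq_bigr => q _; rewrite comp3_lfunE. Qed.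

Lemma tau_Ssub (q : 'I_N) : (q <= m)%N -> tau q \in Ssub N m.+1.
Proof.
move=> qm; apply/SsubP=> k mk; rewrite /tau tpermD // -val_eqE /=.
  by rewrite neq_ltn (leq_ltn_trans qm).
by rewrite x0m neq_ltn mk.
Qed.

(* The transpositions (q m) represent the cosets of S_m in S_(m+1). *)
Lemma tau_coset s (q : 'I_N) : (q <= m)%N -> s \in Ssub N m.+1 ->
  (tau q * s * tau (s q))%g \in Ssub N m.
Proof.
move=> qm sm; apply/SsubP=> k; rewrite leq_eqVlt => /orP[/eqP mk|mk].
  have -> : k = x0 by apply: val_inj; rewrite /= x0m.
  by rewrite !permM /tau tpermR tpermL.
apply: (SsubP _ _ _ _ mk); rewrite !SsubM // tau_Ssub // -ltnS (Ssub_lt _ sm) //.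
Qed.

Lemma tau2 q : (tau q * tau q)%g = 1%g.
Proof. exact: tperm2. Qed.

Lemma cosum_equivariant e : equivariant m e -> equivariant m.+1 (cosum e).
Proof.
move=> ee s sm v; rewrite !cosumE linear_sum /= [RHS](reindex_inj (@perm_inj _ s)) /=.
apply: eq_big => q; first by rewrite -[(s q <= m)%N]ltnS (Ssub_lt _ sm).
move=> qm; have rm := tau_coset qm sm; set r := (tau q * s * tau (s q))%g in rm.
have E1 : (tau q * s)%g = (r * tau (s q))%g by rewrite /r -mulgA tau2 mulg1.
have E2 : (s * tau (s q))%g = (tau q * r)%g by rewrite /r !mulgA tau2 mul1g.
by rewrite permLM E1 -permLM ee // !permLM E2.
Qed.

Lemma cosum_specht (e : 'End(E)) b b' : sumn b = m.+1 -> sumn b' = m.+1 ->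
  {in Sp b, forall v, e v \in Sp b'} -> {in Sp b, forall v, cosum e v \in Sp b'}.
Proof.
move=> sb sb' eS v vS; rewrite cosumE; apply: rpred_sum => q qm.
have tq := tau_Ssub qm; apply: specht_stable; rewrite ?sb' //.
by apply/eS/specht_stable; rewrite ?sb.
Qed.

Lemma card_le_m : #|[pred q : 'I_N | (q <= m)%N]| = m.+1.
Proof.
have mN : (m < N)%N by rewrite -x0m.
by rewrite -[RHS](card_ord_lt mN); apply: eq_card => q; rewrite !inE.
Qed.

(** Take traces: the m + 1 conjugates of the nonzero idempotent phi pi have total trace (m + 1)
    times its rank, which is nonzero in F, while a scalar c = 0 would give trace 0. *)
Lemma cosum_neq0 l b phi pi c : sumn l = m -> sumn b = m.+1 -> branch_pair l b phi pi ->
  \dim (Sp l) != 0%N -> {in Sp b, forall v, cosum (phi \o pi)%VF v = c *: v} -> c != 0.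
Proof.
move=> sl sb [e1 e2 m1 m2 K] l0 cS.
have stl : stable m (Sp l) by rewrite -sl; apply: specht_stable.
have stb : stable m.+1 (Sp b) by rewrite -sb; apply: specht_stable.
have [pl [_ plS pl_id]] := equivariant_proj charF stl.
have [pb [epb pbS pb_id]] := equivariant_proj charF stb.
(* The projections turn phi pi into an idempotent of the whole space, on which the trace is
   defined. *)
pose e : 'End(E) := ((phi \o pl) \o (pi \o pb))%VF.
have eE v : e v = phi (pl (pi (pb v))) by rewrite !comp_lfunE.
have ee v : e (e v) = e v.
  by rewrite !eE pb_id ?m1 // K // pl_id.
have e0 : e != 0.
  apply: contraNneq l0 => E0; rewrite dimv_eq0 -subv0; apply/subvP=> v vS.
  have ev : e (phi v) = phi v by rewrite eE pb_id ?m1 // K // pl_id.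
  by rewrite memv0 -(K v vS) -ev E0 zero_lfunE linear0.
have [r r0 rE] := tr_end_idem ee e0.
have cE : cosum e = c *: pb.
  apply/lfunP=> v; rewrite scale_lfunE -cS // !cosumE; apply: eq_bigr => q qm.
  by rewrite eE -epb ?tau_Ssub // comp_lfunE pl_id // m2.
have : tr_end (cosum e) = c * tr_end pb by rewrite cE tr_endZ.
rewrite /cosum tr_end_sum (eq_bigr (fun _ => r%:R)) => [|q _]; last first.
  rewrite tr_endC -rE; congr tr_end; apply/lfunP=> v; rewrite !comp_lfunE.
  by rewrite permLM tau2 permL1.
rewrite sumr_const card_le_m -mulrnA; apply: contra_eq_neq => ->.
by rewrite mul0r natF_neq0 // muln_gt0 r0.
Qed.

(** The relative trace of phi b' after pi b is S_(m+1)-equivariant from S^b to S^b'. By Schur's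
    lemma it is a scalar if b = b' and 0 otherwise. *)
Lemma ind_maps l (sb : seq (seq nat)) : sumn l = m -> ispart l -> \dim (Sp l) != 0%N ->
  (forall b, (b \in sb) = sqsubset l b) ->
  exists (phi pi : seq nat -> 'End(E)) (c : seq nat -> F),
    (forall b, b \in sb -> branch_pair l b (phi b) (pi b) /\ c b != 0) /\
    (forall b b', b \in sb -> b' \in sb -> forall v, v \in Sp b ->
       cosum (phi b' \o pi b)%VF v = if b == b' then c b *: v else 0).
Proof.
move=> sl pl l0 sbE; have mN : (m < N)%N by rewrite -x0m.
have [f fP] : exists f : seq nat -> 'End(E) * 'End(E),
    forall b, b \in sb -> branch_pair l b (f b).1 (f b).2.
  apply: (seq_choice (P := fun b y => branch_pair l b y.1 y.2) (0, 0)) => b; rewrite sbE => lb.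
  have /(branch charF lb)[phi [pi H]] : (sumn b <= N)%N by rewrite (sqsubset_sumn lb) sl.
  by exists (phi, pi).
have sumb b : b \in sb -> sumn b = m.+1 by rewrite sbE => /sqsubset_sumn->; rewrite sl.
have partb b : b \in sb -> ispart b by rewrite sbE => /and3P[].
have eqv b b' : b \in sb -> b' \in sb -> equivariant m.+1 (cosum ((f b').1 \o (f b).2)%VF).
  move=> /fP[_ e2 _ _ _] /fP[e1 _ _ _ _]; apply: cosum_equivariant.
  by rewrite -sl; apply: equivariant_comp.
have mapsto b b' : b \in sb -> b' \in sb ->
    {in Sp b, forall v, cosum ((f b').1 \o (f b).2)%VF v \in Sp b'}.
  move=> bs bs'; apply: cosum_specht; try exact: sumb.
  have [_ _ _ m2 _] := fP b bs; have [_ _ m1 _ _] := fP b' bs'.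
  by move=> v vS; rewrite comp_lfunE m1 ?m2.
have [c cP] : exists c : seq nat -> F, forall b, b \in sb ->
    {in Sp b, forall v, cosum ((f b).1 \o (f b).2)%VF v = c b *: v}.
  apply: (seq_choice (P := fun b c => {in Sp b, forall v, cosum ((f b).1 \o (f b).2)%VF v = c *: v}) 0) => b bs; apply: specht_end => //; try exact: mapsto.
  - exact: partb.
  - by rewrite sumb.
  - by rewrite sumb //; apply: eqv.
exists (fun b => (f b).1), (fun b => (f b).2), c; split=> [b bs|b b' bs bs' v vS].
  by split; [exact: fP|apply: (cosum_neq0 sl (sumb b bs) (fP b bs) l0 (cP b bs))].
have [<-|ne] := eqVneq b b'; first exact: cP.
apply: (specht_hom0 charF _ (partb b bs) (partb b' bs') _ ne) vS; rewrite ?sumb //.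
  exact: eqv.
exact: mapsto.
Qed.

End Induction.
End Branching.

(** * Dimensions and completeness of the branching maps *)

Section Dims.
Variables (F : fieldType) (N : nat).
Hypothesis charF : [pchar F] =i pred0.
Notation E := (vec F (tabloid N)).
Notation Sp l := (specht F N l).
Notation f l := (\dim (Sp l)).
Implicit Types (s : 'S_N) (l a b : seq nat).

Section IndRetract.
Variables (m : nat) (x0 : 'I_N) (l : seq nat) (sb : seq (seq nat)).
Variables (phi pi : seq nat -> 'End(E)) (c : seq nat -> F).
Hypotheses (x0m : x0 = m :> nat) (sl : sumn l = m).
Hypothesis sbE : forall b, (b \in sb) = sqsubset l b.
Hypothesis bp : forall b, b \in sb -> branch_pair l b (phi b) (pi b) /\ c b != 0.
Hypothesis cos : forall b b', b \in sb -> b' \in sb -> forall v, v \in Sp b ->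
  cosum m x0 (phi b' \o pi b)%VF v = if b == b' then c b *: v else 0.

(** [A0] models the module induced from S^l to S_(m+1), with one copy of S^l for each coset
    representative [tau q]. [K b] and [G b] are the maps that Frobenius reciprocity attaches to
    [pi b] and [phi b], up to the scalar c b. *)
Let K b : 'Hom(E, {ffun 'I_N -> E}) :=
  \sum_(q : 'I_N | (q <= m)%N) (injA _ q \o (pi b \o permL F (tau x0 q)))%VF.
Let G b : 'Hom({ffun 'I_N -> E}, E) :=
  (c b)^-1 *: \sum_(q : 'I_N | (q <= m)%N) (permL F (tau x0 q) \o (phi b \o prA _ q))%VF.
Let A0 : {vspace {ffun 'I_N -> E}} := (\sum_(q : 'I_N | (q <= m)%N) (injA _ q @: Sp l))%VS.

Let KE b v q : K b v q = if (q <= m)%N then pi b (permL F (tau x0 q) v) else 0.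
Proof.
rewrite sum_lfunE sum_ffunE; case: ifP => qm.
  rewrite (bigD1 q) //= comp3_lfunE injAE eqxx big1 ?addr0 // => q' /andP[_ qq'].
  by rewrite comp3_lfunE injAE eq_sym (negPf qq').
rewrite big1 // => q' q'm; rewrite comp3_lfunE injAE; case: eqP => // qq'.
by rewrite qq' q'm in qm.
Qed.

Let GE b y : G b y = (c b)^-1 *: \sum_(q : 'I_N | (q <= m)%N) permL F (tau x0 q) (phi b (y q)).
Proof.
rewrite scale_lfunE sum_lfunE; congr (_ *: _); apply: eq_bigr => q _.
by rewrite comp3_lfunE prAE.
Qed.

Let sumb b : b \in sb -> sumn b = m.+1.
Proof. by rewrite sbE => /sqsubset_sumn->; rewrite sl. Qed.

Let KA b : b \in sb -> forall v, v \in Sp b -> K b v \in A0.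
Proof.
move=> bs v vS; have [[_ _ _ m2 _] _] := bp bs.
rewrite sum_lfunE; apply: memv_sumr => q qm; rewrite comp_lfunE memv_img // comp_lfunE m2 //.
by apply: specht_stable; rewrite // sumb // tau_Ssub.
Qed.

Let GK b b' : b \in sb -> b' \in sb -> forall v, v \in Sp b ->
  G b' (K b v) = if b == b' then v else 0.
Proof.
move=> bs bs' v vS; have := cos bs bs' vS; rewrite cosumE GE => H.
rewrite (eq_bigr (fun q => permL F (tau x0 q) ((phi b' \o pi b)%VF (permL F (tau x0 q) v)))).
  rewrite H; case: eqP => [<-|_]; last by rewrite scaler0.
  by rewrite scalerA mulVf ?scale1r //; have [] := bp bs.
by move=> q qm; rewrite KE qm comp_lfunE.
Qed.

Let dimA0 : (\dim A0 <= m.+1 * f l)%N.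
Proof. by rewrite -(card_le_m x0m); apply: dim_sum_injA. Qed.

Lemma ind_dim : uniq sb -> (\sum_(b <- sb) f b <= m.+1 * f l)%N.
Proof. by move=> us; apply: leq_trans dimA0; apply: (retract_dim us KA GK). Qed.

(** This is the completeness relation of [retract_id] for a vector in the copy q of S^l, read in the
    copy x0. *)
Lemma ind_complete : uniq sb -> (m.+1 * f l <= \sum_(b <- sb) f b)%N ->
  forall (q : 'I_N), (q <= m)%N -> forall v, v \in Sp l ->
  \sum_(b <- sb) (c b)^-1 *: pi b (permL F (tau x0 q) (phi b v)) = if q == x0 then v else 0.
Proof.
move=> us le q qm v vS.
have aA : injA _ q v \in A0.
  by rewrite /A0 (bigD1 q) //=; apply: subvP (addvSl _ _) _ _; apply: memv_img.
have /ffunP/(_ x0) := retract_id us KA GK (leq_trans dimA0 le) aA.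
rewrite injAE sum_ffunE eq_sym => <-; rewrite big_seq [RHS]big_seq; apply: eq_bigr => b bs.
rewrite KE x0m leqnn /tau tperm1 permL1 GE (bigD1 q) //= injAE eqxx big1 ?addr0 ?linearZ //.
by move=> q' /andP[_ qq']; rewrite injAE (negPf qq') !linear0.
Qed.
End IndRetract.

Lemma dim_specht_nil : f [::] != 0%N.
Proof.
pose t : {ffun 'I_N -> 'I_N * 'I_N} := [ffun k => (k, k)].
have tP : istab [::] t by apply/istabP; split.
have : polytab F [::] t \in Sp [::] by apply: specht_polytab.
have S0 s : (s \in colgrp [::] t) = (s == 1%g).
  apply/idP/eqP=> [/colgrpP[_ /SsubP H]|->]; last exact: colgrp1.
  by apply/permP=> k; rewrite H // perm1.
have -> : polytab F [::] t = delta F (rowtab [::] t).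
  rewrite /polytab (eq_bigl _ _ S0) big_pred1_eq odd_perm1 expr0 scale1r.
  by rewrite permtab1.
rewrite dimv_eq0; apply: contraTneq => ->; rewrite memv0; apply/eqP=> /ffunP/(_ (rowtab [::] t)).
by rewrite !ffunE eqxx => /eqP; rewrite oner_eq0.
Qed.

Lemma sum_down_le b : ispart b -> (sumn b <= N)%N -> (\sum_(a <- down b) f a <= f b)%N.
Proof.
move=> pb bN; have [phi [pi [bp GK]]] := res_maps charF pb bN (fun a => mem_down a pb).
apply: (retract_dim (down_uniq pb) (K := phi) (G := pi)) => // a as_ v vS.
by have [_ _ m1 _ _] := bp a as_; apply: m1.
Qed.

(* Both inequalities sum_(a <- down b) f a <= f b and sum_(b <- up l) f b <= (m+1) f l
   are equalities, because up_down lets one compare their sum with the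
   equalities already known for smaller partitions. *)
Lemma dim_branch m : (m <= N)%N ->
  (forall l, ispart l -> sumn l = m ->
     [/\ f l != 0%N, (0 < m)%N -> (\sum_(a <- down l) f a = f l)%N
       & forall a, sqsubset a l -> (\sum_(b <- up a) f b = m * f a)%N]).
Proof.
elim: m => [|m IH] mN.
  move=> l pl sl; have -> : l = [::].
    by apply: size0nil; apply/eqP; rewrite -leqn0 -sl ispart_size.
  split=> //; first exact: dim_specht_nil.
  by move=> a /sqsubset_sumn.
have {}IH := IH (ltnW mN).
have pos b : ispart b -> sumn b = m.+1 -> f b != 0%N.
  move=> pb sb; have [a ab] : exists a, sqsubset a b by apply: down_ex; rewrite ?sb.
  have [pa _ _] := and3P ab.
  have [a0 _ _] := IH a pa (succn_inj (etrans (esym (sqsubset_sumn ab)) sb)).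
  have := sum_down_le pb; rewrite sb => /(_ mN).
  rewrite (bigD1_seq a) ?down_uniq ?mem_down //= -!lt0n => le; move: a0; rewrite -lt0n.
  by move: le; lia.
have main l : ispart l -> sumn l = m ->
    (\sum_(b <- up l) f b = m.+1 * f l)%N /\
    (forall b, sqsubset l b -> (\sum_(a <- down b) f a = f b)%N).
  move=> pl sl; have [l0 resl indl] := IH l pl sl.
  have x0 : 'I_N := Ordinal mN.
  have le1 : (\sum_(b <- up l) f b <= m.+1 * f l)%N.
    have [phi [pi [c [bp cos]]]] :=
      ind_maps charF (erefl m : Ordinal mN = m :> nat) sl pl l0 (fun b => mem_up b pl).
    exact: (ind_dim (erefl m : Ordinal mN = m :> nat) sl (fun b => mem_up b pl) bp cos (up_uniq l)).
  have le2 b : b \in up l -> (\sum_(a <- down b) f a <= f b)%N.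
    rewrite mem_up // => lb; have [_ pb _] := and3P lb.
    by apply: sum_down_le; rewrite // (sqsubset_sumn lb) sl.
  (* By [up_down] the left side is f l plus m times the sum of f over [down l]. The latter sum is f
     l for m > 0, and for m = 0 its factor vanishes. *)
  have E : (\sum_(b <- up l) \sum_(a <- down b) f a = m.+1 * f l)%N.
    rewrite (up_down _ pl) mulSn; congr addn.
    rewrite big_seq (eq_bigr (fun a => m * f a)%N) => [|a]; last by rewrite mem_down // => /indl.
    rewrite -big_distrr /= -big_seq; case: (posnP m) => [->|m0]; first by rewrite !mul0n.
    by rewrite resl.
  have le3 : (\sum_(b <- up l) \sum_(a <- down b) f a <= \sum_(b <- up l) f b)%N.
    by rewrite big_seq [leqRHS]big_seq; apply: leq_sum => b; apply: le2.
  have E2 : (\sum_(b <- up l) f b = m.+1 * f l)%N.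
    by apply/eqP; rewrite eqn_leq le1 -E.
  split=> // b lb; apply/eqP; rewrite eqn_leq le2 ?mem_up //=.
  have bu : b \in up l by rewrite mem_up.
  have := E; rewrite -E2 (bigD1_seq b) ?up_uniq //= [in RHS](bigD1_seq b) ?up_uniq //=.
  have : (\sum_(i <- up l | i != b) \sum_(a <- down i) f a <= \sum_(i <- up l | i != b) f i)%N.
    by rewrite big_seq_cond [leqRHS]big_seq_cond; apply: leq_sum => i /andP[iu _]; apply: le2.
  by lia.
move=> b pb sb; split; first exact: pos.
  move=> _; have [a ab] : exists a, sqsubset a b by apply: down_ex; rewrite ?sb.
  have [pa _ _] := and3P ab.
  exact: (proj2 (main a pa (succn_inj (etrans (esym (sqsubset_sumn ab)) sb)))).
move=> a ab; have [pa _ _] := and3P ab.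
exact: (proj1 (main a pa (succn_inj (etrans (esym (sqsubset_sumn ab)) sb)))).
Qed.

Lemma perm_down b (sa : seq (seq nat)) : ispart b -> uniq sa ->
  (forall a, (a \in sa) = sqsubset a b) -> perm_eq sa (down b).
Proof. by move=> pb us H; apply: uniq_perm => //; [apply: down_uniq|move=> a; rewrite H mem_down]. Qed.

Lemma perm_up l (sb : seq (seq nat)) : ispart l -> uniq sb ->
  (forall b, (b \in sb) = sqsubset l b) -> perm_eq sb (up l).
Proof. by move=> pl us H; apply: uniq_perm => //; [apply: up_uniq|move=> a; rewrite H mem_up]. Qed.

Lemma specht_res b (sa : seq (seq nat)) : ispart b -> (0 < sumn b <= N)%N -> uniq sa ->
  (forall a, (a \in sa) = sqsubset a b) ->
  exists phi pi : seq nat -> 'End(E),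
    [/\ forall a, a \in sa -> branch_pair a b (phi a) (pi a),
        forall a a', a \in sa -> a' \in sa -> forall v, v \in Sp a ->
          pi a' (phi a v) = if a == a' then v else 0 &
        {in Sp b, forall v, \sum_(a <- sa) phi a (pi a v) = v}].
Proof.
move=> pb /andP[b0 bN] us saE; have [phi [pi [bp GK]]] := res_maps charF pb bN saE.
exists phi, pi; split=> //; apply: (retract_id us _ GK).
  by move=> a as_ v vS; have [_ _ m1 _ _] := bp a as_; apply: m1.
rewrite (perm_big _ (perm_down pb us saE)) /=.
by have [_ /(_ b0) -> _] := dim_branch bN pb erefl.
Qed.

Lemma specht_ind_maps l (sb : seq (seq nat)) (x0 : 'I_N) : ispart l -> x0 = sumn l :> nat -> uniq sb ->
  (forall b, (b \in sb) = sqsubset l b) ->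
  exists (phi pi : seq nat -> 'End(E)) (c : seq nat -> F),
    [/\ forall b, b \in sb -> branch_pair l b (phi b) (pi b) /\ c b != 0,
        forall b b', b \in sb -> b' \in sb -> forall v, v \in Sp b ->
          cosum (sumn l) x0 (phi b' \o pi b)%VF v = if b == b' then c b *: v else 0 &
        forall (q : 'I_N), (q <= sumn l)%N -> forall v, v \in Sp l ->
          \sum_(b <- sb) (c b)^-1 *: pi b (permL F (tau x0 q) (phi b v)) = if q == x0 then v else 0].
Proof.
move=> pl x0l us sbE; have lN : (sumn l < N)%N by rewrite -x0l.
have [l0 _ _] := dim_branch (ltnW lN) pl erefl.
have [phi [pi [c [bp cos]]]] := ind_maps charF x0l erefl pl l0 sbE.
exists phi, pi, c; split=> //; apply: (ind_complete x0l erefl sbE bp cos us).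
rewrite (perm_big _ (perm_up pl us sbE)) /=.
(* The equation for [up l] is attached in [dim_branch] to a partition covering l; a box in the first
   row always supplies one. *)
have [b lb] : exists b, sqsubset l b.
  by exists (incr_nth l 0); rewrite -mem_up //; apply/mapP; exists 0%N.
have [_ pb _] := and3P lb; have sbE2 := sqsubset_sumn lb.
by have [_ _ /(_ l lb) ->] := dim_branch lN pb sbE2.
Qed.

End Dims.

(** * Modules spanned by half diagrams *)

Section LiftPerm.
Variable N : nat.
Implicit Types (s : 'S_N) (l : seq nat).

Definition lperm s : 'S_N.+1 := lift_perm ord_max ord_max s.

Lemma lperm_lift s k : lperm s (lift ord_max k) = lift ord_max (s k).
Proof. exact: lift_perm_lift. Qed.

Lemma lperm_max s : lperm s ord_max = ord_max.
Proof. exact: lift_perm_id. Qed.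

Lemma lpermV s : (lperm s)^-1%g = lperm s^-1.
Proof. by rewrite /lperm lift_permV. Qed.

Lemma lperm_inj : injective lperm.
Proof.
move=> s s' E; apply/permP=> k; apply: (@lift_inj _ ord_max).
by rewrite -!lperm_lift E.
Qed.

Lemma lperm_Ssub m s : s \in Ssub N m -> lperm s \in Ssub N.+1 m.
Proof.
move=> /SsubP H; apply/SsubP=> k; case: (unliftP ord_max k) => [j ->|->] mk.
  by rewrite lperm_lift H //; move: mk; rewrite lift_max.
exact: lperm_max.
Qed.

Lemma Ssub_lperm m (s' : 'S_N.+1) : (m <= N)%N -> s' \in Ssub N.+1 m ->
  exists2 s, s \in Ssub N m & s' = lperm s.
Proof.
move=> mN /SsubP H; have s'm : s' ord_max = ord_max by apply: H.
pose f k := odflt k (unlift ord_max (s' (lift ord_max k))).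
have fE k : lift ord_max (f k) = s' (lift ord_max k).
  rewrite /f; case: (unliftP ord_max (s' (lift ord_max k))) => [j -> //|E].
  by have /perm_inj/eqP := etrans E (esym s'm); rewrite eq_sym (negPf (neq_lift _ _)).
have f_inj : injective f.
  by move=> k k' ff; apply: (@lift_inj _ ord_max); apply: (@perm_inj _ s'); rewrite -!fE ff.
exists (perm f_inj).
  apply/SsubP=> k mk; rewrite permE; apply: (@lift_inj _ ord_max).
  by rewrite fE H // lift_max.
apply/permP=> k; case: (unliftP ord_max k) => [j ->|->]; last by rewrite lperm_max.
by rewrite lperm_lift permE fE.
Qed.

Lemma eps_pdiag s : eps (pdiag s) = pdiag (lperm s).
Proof.
apply: diag_ext => w; case: (vtxSP w) => [[v ->]|->|->].
- rewrite eps_lift !pdiagE; case: v => i /=; first by rewrite lperm_lift.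
  by rewrite lpermV lperm_lift.
- by rewrite eps_top pdiagE lperm_max.
- by rewrite eps_bot pdiagE lpermV lperm_max.
Qed.

End LiftPerm.

Section LiftTabloid.
Variables (F : fieldType) (N : nat).
Notation tab n := {ffun 'I_n -> 'I_n * 'I_n}.
Implicit Types (s : 'S_N) (l : seq nat) (t : tab N) (r : tabloid N).

(** The Specht module of l is realized inside a space that depends on N. [liftL] and [restL]
    identify its realizations for N and N + 1. *)
Definition ltabloid r : tabloid N.+1 :=
  [ffun k => obind (fun j => omap (lift ord_max) (r j)) (unlift ord_max k)].
Definition rtabloid (r : tabloid N.+1) : tabloid N :=
  [ffun k => obind (unlift ord_max) (r (lift ord_max k))].

Lemma ltabloidK r : rtabloid (ltabloid r) = r.
Proof.
by apply/ffunP=> k; rewrite !ffunE liftK /=; case: (r k) => //= j; rewrite liftK.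
Qed.

Definition liftL : 'Hom(vec F (tabloid N), vec F (tabloid N.+1)) :=
  lext (fun r : tabloid N => delta F (ltabloid r)).
Definition restL : 'Hom(vec F (tabloid N.+1), vec F (tabloid N)) :=
  lext (fun r : tabloid N.+1 => delta F (rtabloid r)).

Lemma liftLK v : restL (liftL v) = v.
Proof.
rewrite -comp_lfunE -[RHS]id_lfunE; apply: hom_delta_eq => r.
by rewrite comp_lfunE !lext_delta ltabloidK id_lfunE.
Qed.

Lemma liftL_perm s v : liftL (permL F s v) = permL F (lperm s) (liftL v).
Proof.
rewrite -comp_lfunE -[RHS]comp_lfunE; apply: hom_delta_eq => r.
rewrite !comp_lfunE permL_delta !lext_delta; congr delta.
apply/ffunP=> k; rewrite !ffunE; case: (unliftP ord_max k) => [j ->|->].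
  by rewrite lperm_lift !liftK /= ffunE.
by rewrite lperm_max unlift_none.
Qed.

Definition ltab t : tab N.+1 := [ffun k =>
  if unlift ord_max k is Some j then (lift ord_max (t j).1, lift ord_max (t j).2)
  else (ord_max, ord_max)].

Lemma isbox_lift l (b : 'I_N * 'I_N) :
  isbox l (lift ord_max b.1, lift ord_max b.2) = isbox l b.
Proof. by rewrite /isbox !lift_max. Qed.

Lemma istab_ltab l t : (sumn l <= N)%N -> istab l t -> istab l (ltab t).
Proof.
move=> lN /istabP[H1 H2].
have nmax : (@ord_max N < sumn l)%N -> False.
  by rewrite /= ltnNge lN.
apply/istabP; split=> [k|k k'].
  case: (unliftP ord_max k) => [j ->|->]; last by move/nmax=> [].
  by rewrite lift_max ffunE liftK isbox_lift => /H1.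
case: (unliftP ord_max k) => [j ->|->]; last by move/nmax=> [].
case: (unliftP ord_max k') => [j' ->|->]; last by move=> _ /nmax [].
rewrite !lift_max !ffunE !liftK => jl jl' E; congr lift; apply: H2 => //.
have /lift_inj E1 := congr1 fst E; have /lift_inj E2 := congr1 snd E.
by rewrite [t j]surjective_pairing E1 E2 -surjective_pairing.
Qed.

Lemma rowtab_ltab l t : (sumn l <= N)%N -> rowtab l (ltab t) = ltabloid (rowtab l t).
Proof.
move=> lN; apply/ffunP=> k; rewrite !ffunE; case: (unliftP ord_max k) => [j ->|->].
  by rewrite lift_max /= ffunE; case: ifP.
by rewrite /= ltnNge lN.
Qed.

Lemma colgrp_ltab l t : (sumn l <= N)%N -> colgrp l (ltab t) = (@lperm N) @: colgrp l t.
Proof.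
move=> lN.
have tE s k : (ltab t (lperm s (lift ord_max k))).2 = lift ord_max (t (s k)).2.
  by rewrite lperm_lift ffunE liftK.
have tE1 k : (ltab t (lift ord_max k)).2 = lift ord_max (t k).2 by rewrite ffunE liftK.
apply/setP=> s'; apply/idP/imsetP.
  case/colgrpP=> H1 H2; have [s sl s's] := Ssub_lperm lN H2; exists s => //.
  apply/colgrpP; split=> // k kl; apply: (@lift_inj _ ord_max).
  by rewrite -tE -tE1 -s's H1 // lift_max.
case=> s /colgrpP[H1 H2] ->; apply/colgrpP; split; last exact: lperm_Ssub.
move=> k; case: (unliftP ord_max k) => [j ->|-> _]; last by rewrite lperm_max.
by rewrite lift_max tE tE1 => /H1 ->.
Qed.

Lemma liftL_polytab l t : (sumn l <= N)%N ->
  liftL (polytab F l t) = polytab F l (ltab t).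
Proof.
move=> lN; rewrite /polytab colgrp_ltab // big_imset /=; last by move=> s s' _ _ /lperm_inj.
rewrite linear_sum; apply: eq_bigr => s _; rewrite linearZ /= odd_lift_perm addbb addFb.
congr (_ *: _); rewrite -permL_delta liftL_perm lext_delta permL_delta.
by rewrite rowtab_ltab.
Qed.

Lemma liftL_specht l v : (sumn l <= N)%N -> v \in specht F N l -> liftL v \in specht F N.+1 l.
Proof.
move=> lN; move: v; apply: specht_ind => t tl.
by rewrite liftL_polytab // specht_polytab // istab_ltab.
Qed.

Lemma restL_specht l v : ispart l -> (sumn l <= N)%N -> v \in specht F N.+1 l ->
  restL v \in specht F N l /\ liftL (restL v) = v.
Proof.
move=> pl lN vS.
suff [u uS <-] : exists2 u, u \in specht F N l & liftL u = v by rewrite liftLK.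
suff : v \in (liftL @: specht F N l)%VS by case/memv_imgP=> u ? ->; exists u.
rewrite -[v]id_lfunE; move: v vS; apply: specht_ind => t' tl'; rewrite id_lfunE.
have [H1 H2] := istabP _ _ tl'.
pose t : tab N := [ffun k => let b := t' (lift ord_max k) in
   (odflt k (unlift ord_max b.1), odflt k (unlift ord_max b.2))].
have lt (k : 'I_N) : (k < sumn l)%N -> ltab t (lift ord_max k) = t' (lift ord_max k).
  move=> kl; rewrite ffunE liftK ffunE /=; have := H1 (lift ord_max k).
  rewrite lift_max => /(_ kl); case: (t' _) => r c /=; rewrite /isbox /= => /andP[rl cl].
  have rN : (r < N)%N by apply: leq_trans rl (leq_trans (ispart_size pl) lN).
  have cN : (c < N)%N.
    by apply: leq_trans cl (leq_trans (nth_le_sumn _ _) lN).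
  congr pair.
    by case: (unliftP ord_max r) rN => [j ->|->] //=; rewrite ltnn.
  by case: (unliftP ord_max c) cN => [j ->|->] //=; rewrite ltnn.
have ltE (k : 'I_N.+1) : (k < sumn l)%N -> ltab t k = t' k.
  case: (unliftP ord_max k) => [j ->|->]; last by rewrite ltnNge lN.
  by rewrite lift_max => /lt.
have tl : istab l t.
  apply/istabP; split=> [k kl|k k' kl kl' E].
    by rewrite -isbox_lift; have := H1 (lift ord_max k); rewrite lift_max -lt // ffunE liftK => ->.
  apply: (@lift_inj _ ord_max); apply: H2; rewrite ?lift_max // -!lt //.
  by rewrite [LHS]ffunE [RHS]ffunE !liftK E.
have -> : polytab F l t' = liftL (polytab F l t).
  by rewrite liftL_polytab //; apply: polytab_ext => k kl; rewrite ltE.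
by rewrite memv_img // specht_polytab.
Qed.

Lemma restL_perm l s v : ispart l -> (sumn l <= N)%N -> s \in Ssub N (sumn l) ->
  v \in specht F N.+1 l -> restL (permL F (lperm s) v) = permL F s (restL v).
Proof.
move=> pl lN sl vS; have [_ E] := restL_specht pl lN vS.
by rewrite -{1}E -liftL_perm liftLK.
Qed.

End LiftTabloid.

(** * Half diagrams *)

Section HalfDiagrams.
Variable N : nat.
Implicit Types (a b d : diag N) (s : 'S_N) (m : nat).
Local Open Scope nat_scope.

Definition iso_from m d := [forall i : 'I_N, (m <= i) ==> (val d (inr i) == inr i)].
Definition halfd m d := iso_from m d && [forall i : 'I_N, (i < m) ==> isl (val d (inr i))].

Lemma iso_fromP m d : reflect (forall i : 'I_N, m <= i -> val d (inr i) = inr i) (iso_from m d).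
Proof.
apply: (iffP forallP) => H i; first by move=> mi; apply/eqP/(implyP (H i)).
by apply/implyP=> /H->.
Qed.

Lemma halfdP m d : reflect (iso_from m d /\ forall i : 'I_N, i < m -> isl (val d (inr i))) (halfd m d).
Proof.
apply: (iffP andP) => -[-> H]; split=> //; first by move=> i; apply: (implyP (forallP H i)).
by apply/forallP=> i; apply/implyP/H.
Qed.

Lemma nvertE d : nvert d = #|[set i : 'I_N | isl (val d (inr i))]|.
Proof.
pose f (j : 'I_N) := if val d (inr j) is inl i then i else j.
rewrite /nvert -(@card_in_imset _ _ f [set i : 'I_N | isl (val d (inr i))]).
  apply: eq_card => i; rewrite inE; apply/existsP/imsetP=> [[j /eqP dij]|[j]].
    have dji : val d (inr j) = inl i by rewrite -dij diagK.
    by exists j; rewrite ?inE /f dji.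
  rewrite inE /f; case E: (val d (inr j)) => [i'|] // _ ->; exists j.
  by rewrite -E diagK.
move=> j j'; rewrite !inE /f; case E: (val d (inr j)) => [i|] //.
case E': (val d (inr j')) => [i'|] // _ _ ii.
by have /(@diag_inj _ d)[] : val d (inr j) = val d (inr j') by rewrite E E' ii.
Qed.

(** Only the bottom vertices below m can carry vertical arcs, so m such arcs occupy all of them.
    This translates the truncation in [prodI] into [halfd]. *)
Lemma halfd_nvert m d : m <= N -> iso_from m d -> halfd m d = (nvert d == m).
Proof.
move=> mN /[dup] iso /iso_fromP di; rewrite nvertE.
have sub : [set i : 'I_N | isl (val d (inr i))] \subset [set i : 'I_N | i < m].
  by apply/subsetP=> i; rewrite !inE; apply: contraTT; rewrite -leqNgt => /di->.
apply/idP/eqP=> [/halfdP[_ H]|E].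
  rewrite -[RHS](card_ord_lt mN); apply: eq_card => i; rewrite !inE.
  by apply/idP/idP=> [|/H//]; apply: contraTT; rewrite -leqNgt => /di->.
apply/halfdP; split=> // i im.
have /eqP H : [set i : 'I_N | isl (val d (inr i))] == [set i : 'I_N | i < m].
  by rewrite eqEcard sub /= (card_ord_lt mN) -[X in X <= _]E.
have : i \in [set i : 'I_N | i < m] by rewrite inE.
by rewrite -H inE.
Qed.

Lemma iso_Gp m b d : iso_from m d -> iso_from m (dmul b d).
Proof. by move/iso_fromP=> di; apply/iso_fromP=> i /di; apply: Gp_bot. Qed.

Lemma isl_Gp b d (i : 'I_N) : isl (val (dmul b d) (inr i)) -> isl (val d (inr i)).
Proof. by case E: (val d (inr i)) => [j|j] //; rewrite (Gp_bot _ E). Qed.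

Lemma halfd_Gp m b d : iso_from m d -> halfd m (dmul b d) -> halfd m d.
Proof.
move=> di /halfdP[_ H]; apply/halfdP; split=> // i /H; exact: isl_Gp.
Qed.

Lemma isl_rl s v : isl (rl s v) = isl v. Proof. by case: v. Qed.

Lemma isl_pdiag d s (i : 'I_N) : isl (val (dmul d (pdiag s)) (inr (s i))) = isl (val d (inr i)).
Proof. by rewrite -[inr (s i)]/(rl s (inr i)) Gp_pdiag isl_rl. Qed.

Lemma nvert_pdiag d s : nvert (dmul d (pdiag s)) = nvert d.
Proof.
rewrite !nvertE -[RHS](card_imset _ (@perm_inj _ s)); apply: eq_card => i; rewrite inE.
rewrite -[i](permKV s) isl_pdiag; apply/idP/imsetP=> [H|[j]].
  by exists (s^-1%g i); rewrite ?inE.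
by rewrite inE => H /perm_inj ->.
Qed.

Lemma iso_pdiag m d s : s \in Ssub N m -> iso_from m d -> iso_from m (dmul d (pdiag s)).
Proof.
move=> /SsubP sm /iso_fromP di; apply/iso_fromP=> i mi.
have E : inr i = rl s (inr i : vtx N) by rewrite /= sm.
by rewrite E Gp_pdiag di.
Qed.

Lemma halfd_pdiag m d s : m <= N -> s \in Ssub N m -> halfd m d -> halfd m (dmul d (pdiag s)).
Proof.
move=> mN sm hd; have [di _] := halfdP _ _ hd.
by rewrite halfd_nvert ?iso_pdiag // nvert_pdiag -halfd_nvert.
Qed.

Lemma iso_udiag m : iso_from m (udiag N m).
Proof. by apply/iso_fromP=> i mi; rewrite udiagE ltnNge mi. Qed.

Lemma halfd_udiag m : halfd m (udiag N m).
Proof. by apply/halfdP; split=> [|i im]; rewrite ?iso_udiag // udiagE im. Qed.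

Lemma Gp_udiag m d : iso_from m d -> dmul d (udiag N m) = d.
Proof.
move/iso_fromP=> di; apply: (Gp_copy (H := fun i : 'I_N => m <= i)).
- by move=> i mi; exists i; rewrite di // udiagE ltnNge mi.
- by move=> i mi; exists i; rewrite // udiagE ltnNge mi.
- by move=> i; rewrite -ltnNge udiagE => ->.
Qed.

Lemma card_ord_ge m : #|[set i : 'I_N | m <= i]| = N - m.
Proof.
have [mN|Nm] := leqP m N.
  rewrite cardsCs card_ord; congr subn; rewrite -[RHS](card_ord_lt mN).
  by apply: eq_card => i; rewrite !inE -ltnNge.
rewrite (eqP (ltnW Nm : N - m == 0)); apply: eq_card0 => i; rewrite inE leqNgt.
by rewrite (ltn_trans (ltn_ord i)).
Qed.

(** With [Gp_udiag] this gives d u = x^(N-m) d, the origin of the powers of x that are inverted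
    later. *)
Lemma ell_udiag m d : iso_from m d -> loops d (udiag N m) = N - m.
Proof.
move/iso_fromP=> di; rewrite -card_ord_ge.
rewrite (ell_copy (H := fun i : 'I_N => m <= i)) // => i mi.
  by rewrite di // udiagE ltnNge mi.
by rewrite -ltnNge in mi; rewrite udiagE mi.
Qed.

End HalfDiagrams.

Section Tens.
Variable F : fieldType.
Variables A X : finType.

Fact tens_linearr (y : vec F A) : linear (tens y : vec F X -> _).
Proof. by move=> a u v; apply/ffunP=> p; rewrite !ffunE mulrDr !scale_reg mulrCA. Qed.

Fact tens_linearl (v : vec F X) : linear ((@tens F A X)^~ v).
Proof. by move=> a u w; apply/ffunP=> p; rewrite !ffunE mulrDl !scale_reg mulrA. Qed.

HB.instance Definition _ y := GRing.isLinear.Build F _ _ _ (@tens F A X y) (tens_linearr y).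

Definition tensl v y := @tens F A X y v.
HB.instance Definition _ v := GRing.isLinear.Build F _ _ _ (tensl v) (tens_linearl v).

Definition tensL y : 'Hom(vec F X, vec F (A * X)%type) := linfun (tens y).
Lemma tensLE y v : tensL y v = tens y v. Proof. exact: lfunE. Qed.

Lemma tensZl a (y : vec F A) (v : vec F X) : tens (a *: y) v = a *: tens y v.
Proof. by rewrite -![tens _ v]/(tensl v _) linearZ. Qed.
Lemma tensZr a (y : vec F A) (v : vec F X) : tens y (a *: v) = a *: tens y v.
Proof. by rewrite linearZ. Qed.
Lemma tens0l (v : vec F X) : tens (0 : vec F A) v = 0.
Proof. by rewrite -[tens _ v]/(tensl v _) linear0. Qed.
Lemma tens0r (y : vec F A) : tens y (0 : vec F X) = 0.
Proof. exact: linear0. Qed.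
Lemma tensBr (y : vec F A) (u v : vec F X) : tens y (u - v) = tens y u - tens y v.
Proof. exact: linearB. Qed.
Lemma tens_sumr (I : eqType) (r : seq I) (P : pred I) (y : vec F A) (f : I -> vec F X) :
  tens y (\sum_(i <- r | P i) f i) = \sum_(i <- r | P i) tens y (f i).
Proof. exact: linear_sum. Qed.

Lemma tens_delta (a : A) (r : X) : tens (delta F a) (delta F r) = delta F (a, r).
Proof.
by apply/ffunP=> -[a' r']; rewrite !ffunE /= xpair_eqE -natrM mulnb.
Qed.

Lemma tens_ext (V : vectType F) (f : 'Hom(vec F (A * X)%type, V)) (g : 'Hom(vec F X, V)) a :
  (forall r, f (delta F (a, r)) = g (delta F r)) -> forall v, f (tens (delta F a) v) = g v.
Proof.
move=> H v; rewrite -tensLE -comp_lfunE; apply: hom_delta_eq => r.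
by rewrite comp_lfunE tensLE tens_delta H.
Qed.

End Tens.

Section Half.
Variables (F : fieldType) (x : F).

Lemma prodAE n (a b : diag n) : prodA x a b = x ^+ loops a b *: delta F (dmul a b).
Proof. by rewrite dmulE loopsE. Qed.

Lemma prodIE n k (a b : diag n) :
  prodI x k a b = if nvert (dmul a b) == k then x ^+ loops a b *: delta F (dmul a b) else 0.
Proof. by rewrite -prodAE dmulE. Qed.

Definition actL n (X : finType) (M : smod F n X) b : 'End(vec F X) := lext (sact M b).

Lemma actvE n (X : finType) (M : smod F n X) b v : actv M b v = actL M b v.
Proof. by rewrite lextE. Qed.

(* M_n(l), the restriction of M_(n+2)(l) and the module Q isomorphic to both all have
   this shape, for different sets D of diagrams. *)
Record half_spec N (D : pred (diag N)) (l : seq nat)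
    (M : smod F N (diag N * tabloid N)%type) : Prop := HalfSpec {
  half_V : forall d s, D d -> s \in specht F N l -> tens (delta F d) s \in sV M;
  half_Vind : forall (V : vectType F) (U : {vspace V}) (f : 'Hom(_, V)),
    (forall d s, D d -> s \in specht F N l -> f (tens (delta F d) s) \in U) ->
    forall v, v \in sV M -> f v \in U;
  half_W : forall d s p, D d -> s \in specht F N l -> p \in Ssub N (sumn l) ->
    tens (delta F (dmul d (pdiag p))) s - tens (delta F d) (permL F p s) \in sW M;
  half_Wind : forall (V : vectType F) (U : {vspace V}) (f : 'Hom(_, V)),
    (forall d s p, D d -> s \in specht F N l -> p \in Ssub N (sumn l) ->
      f (tens (delta F (dmul d (pdiag p))) s) - f (tens (delta F d) (permL F p s)) \in U) ->
    forall v, v \in sW M -> f v \in U;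
  half_act : forall b d s, D d -> s \in specht F N l ->
    actv M b (tens (delta F d) s) =
      if D (dmul b d) then x ^+ loops b d *: tens (delta F (dmul b d)) s else 0 }.

Hypothesis x0 : x != 0.

(** Each generator is a multiple of a half diagram, and each half diagram d is a generator divided
    by a power of x, since d = d u up to such a power. *)
Lemma Mmod_half N l : (sumn l <= N)%N -> half_spec (halfd (sumn l)) l (Mmod x N l).
Proof.
move=> lN; set m := sumn l.
have ysP y : y \in [seq prodI x m a (udiag N m) | a <- enum {: diag N}] ->
    y = 0 \/ exists d c, halfd m d /\ y = c *: delta F d.
  case/mapP=> a _ ->; rewrite prodIE; case: ifP => [nv|_]; last by left.
  right; exists (dmul a (udiag N m)), (x ^+ loops a (udiag N m)); split=> //.
  by rewrite halfd_nvert // iso_Gp // iso_udiag.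
have ysD d : halfd m d -> exists2 c, c != 0 &
    c *: delta F d \in [seq prodI x m a (udiag N m) | a <- enum {: diag N}].
  move=> hd; have [di _] := halfdP _ _ hd; exists (x ^+ loops d (udiag N m)); first exact: expf_neq0.
  apply/mapP; exists d; rewrite ?mem_enum // prodIE Gp_udiag //.
  by rewrite -halfd_nvert // hd.
have rmulE (d : diag N) c p : halfd m d -> rmulI x m (c *: delta F d) (pdiag p) = c *: delta F (dmul d (pdiag p)).
  move=> hd; have [di _] := halfdP _ _ hd; rewrite /rmulI (bigD1 d) //= !ffunE eqxx scale_reg mulr1.
  rewrite big1 ?addr0 => [|d' d'd]; last by rewrite !ffunE (negPf d'd) scale_reg mulr0 scale0r.
  have nv : nvert d == m by rewrite -halfd_nvert.
  by rewrite prodIE nvert_pdiag nv ell_pdiag expr0 scale1r.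
split.
- move=> d s hd sS; have [c c0 cy] := ysD d hd; rewrite -tensLE.
  apply: (span_mem _ sS) => w wp; rewrite tensLE.
  rewrite -[delta F d](scalerK c0) tensZl rpredZ //; apply: memv_span.
  exact: (allpairs_f _ cy wp).
- move=> V U f H v; apply: span_mem => _ /allpairsP[[y s] /= [yy ss ->]].
  case: (ysP y yy) => [->|[d [c [hd ->]]]]; first by rewrite tens0l linear0 mem0v.
  by rewrite tensZl linearZ /= rpredZ // H // memv_span.
- move=> d s p hd sS pm; have [c c0 cy] := ysD d hd.
  rewrite -[tens _ s]tensLE -[tens _ (permL F p s)]tensLE -[X in _ - X]comp_lfunE.
  apply: (span_memB (f := tensL _ _) (g := (tensL _ _ \o permL F p)%VF) _ sS) => w wp.
  rewrite comp_lfunE !tensLE -[X in X \in _](scalerK c0) rpredZ //.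
  apply: memv_span; apply/mapP; exists (c *: delta F d, (p, w)).
    by apply: allpairs_f => //; apply: allpairs_f => //; rewrite mem_enum.
  by rewrite /= rmulE // !tensZl permactE scalerBr.
- move=> V U f H v; apply: span_mem => _ /mapP[_ /allpairsP[[y _] /= [yy /allpairsP[[p w] /= [pp ww ->]] ->]] ->] /=.
  rewrite mem_enum in pp; rewrite permactE; have wS : w \in specht F N l by apply: memv_span.
  case: (ysP y yy) => [->|[d [c [hd ->]]]].
    rewrite tens0l /rmulI big1 ?tens0l ?subrr ?linear0 ?mem0v // => d _.
    by rewrite ffunE scale0r.
  by rewrite rmulE // !tensZl -scalerBr linearZ /= rpredZ // linearB /= H.
- move=> b d s hd sS; rewrite actvE.
  rewrite (tens_ext (g := tensL _ (prodI x m b d))); last by move=> r; rewrite lext_delta tensLE.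
  have [di _] := halfdP _ _ hd.
  rewrite tensLE prodIE -halfd_nvert ?iso_Gp //; case: ifP => _; last by rewrite tens0l.
  by rewrite tensZl.
Qed.

(** Taken at D = [Pset m], this is the module Q through which the induced and the restricted module
    are compared. *)
Definition half_mod N (D : pred (diag N)) (l : seq nat) : smod F N (diag N * tabloid N)%type :=
  SMod (fun b p => tens (if D (dmul b p.1) then prodA x b p.1 else 0) (delta F p.2))
    <<[seq tens (delta F d) s | d <- enum D, s <- polys F N l]>>%VS
    <<[seq tens (delta F (dmul q.1 (pdiag q.2.1))) q.2.2 - tens (delta F q.1) (permL F q.2.1 q.2.2)
       | q <- [seq (d, r) | d <- enum D,
               r <- [seq (p, w) | p <- enum (Ssub N (sumn l)), w <- polys F N l]]]>>%VS.

Lemma half_modP N (D : pred (diag N)) l : half_spec D l (half_mod D l).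
Proof.
split.
- move=> d s hd sS; rewrite -tensLE; apply: (span_mem _ sS) => w wp; rewrite tensLE.
  by apply: memv_span; apply: allpairs_f => //; rewrite mem_enum.
- move=> V U f H v; apply: span_mem => _ /allpairsP[[d s] /= [dd ss ->]].
  by rewrite mem_enum in dd; rewrite H // memv_span.
- move=> d s p hd sS pm; rewrite -[tens _ s]tensLE -[tens _ (permL F p s)]tensLE.
  rewrite -[X in _ - X]comp_lfunE.
  apply: (span_memB (f := tensL _ _) (g := (tensL _ _ \o permL F p)%VF) _ sS) => w wp.
  rewrite comp_lfunE !tensLE; apply: memv_span; apply/mapP; exists (d, (p, w)) => //.
  by apply: allpairs_f; rewrite ?mem_enum //; apply: allpairs_f => //; rewrite mem_enum.
- move=> V U f H v; apply: span_mem => _ /mapP[_ /allpairsP[[d _] /= [dd /allpairsP[[p w] /= [pp ww ->]] ->]] ->] /=.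
  rewrite mem_enum in pp; rewrite mem_enum in dd.
  by rewrite linearB /= H // memv_span.
- move=> b d s hd sS; rewrite actvE.
  rewrite (tens_ext (g := tensL _ (if D (dmul b d) then prodA x b d else 0))).
    by rewrite tensLE prodAE; case: ifP => _; rewrite ?tens0l ?tensZl.
  by move=> r; rewrite lext_delta tensLE.
Qed.

End Half.

Lemma half_VindB (F : fieldType) (x : F) N (D : pred (diag N)) l
    (M : smod F N (diag N * tabloid N)%type) : half_spec x D l M ->
  forall (V : vectType F) (U : {vspace V}) (f g : 'Hom(_, V)),
    (forall d s, D d -> s \in specht F N l ->
      f (tens (delta F d) s) - g (tens (delta F d) s) \in U) ->
    forall v, v \in sV M -> f v - g v \in U.
Proof.
move=> HM V U f g H v vM; have E w : f w - g w = (f - g) w by rewrite add_lfunE opp_lfunE.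
by rewrite E; move: v vM; apply: (half_Vind HM) => d s Dd sS; rewrite -E H.
Qed.

(** * Homomorphisms of subquotients *)

Section Homs.
Variable F : fieldType.
Variable n : nat.
Implicit Types X Y Z : finType.

(** Stronger than [smod_iso] in that the inverse is a given homomorphism, so these data compose and
    transport exact sequences. *)
Definition iso_data X Y (M : smod F n X) (N : smod F n Y) : Prop :=
  exists (f : 'Hom(vec F X, vec F Y)) (g : 'Hom(vec F Y, vec F X)),
    [/\ ishom M N f, ishom N M g,
        forall v, v \in sV M -> g (f v) - v \in sW M &
        forall v, v \in sV N -> f (g v) - v \in sW N].

Lemma ishom_V X Y (M : smod F n X) (N : smod F n Y) f v : ishom M N f -> v \in sV M -> f v \in sV N.
Proof. by case=> /subvP H _ _ vM; apply: H; apply: memv_img. Qed.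

Lemma ishom_W X Y (M : smod F n X) (N : smod F n Y) f v : ishom M N f -> v \in sW M -> f v \in sW N.
Proof. by case=> _ /subvP H _ vM; apply: H; apply: memv_img. Qed.

Lemma ishomI X Y (M : smod F n X) (N : smod F n Y) (f : 'Hom(vec F X, vec F Y)) :
  (forall v, v \in sV M -> f v \in sV N) -> (forall v, v \in sW M -> f v \in sW N) ->
  (forall b v, v \in sV M -> f (actv M b v) - actv N b (f v) \in sW N) -> ishom M N f.
Proof.
by move=> H1 H2 H3; split=> //; apply/subvP=> _ /memv_imgP[v vM ->]; [apply: H1|apply: H2].
Qed.

Lemma ishom_comp X Y Z (M : smod F n X) (N : smod F n Y) (P : smod F n Z) f g :
  ishom M N f -> ishom N P g -> ishom M P (g \o f)%VF.
Proof.
move=> hf hg; apply: ishomI => [v vM|v vM|b v vM]; rewrite !comp_lfunE.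
- exact: ishom_V hg (ishom_V hf vM).
- exact: ishom_W hg (ishom_W hf vM).
have [_ _ /(_ b v vM) H] := hf; have [_ _ /(_ b _ (ishom_V hf vM)) H'] := hg.
have := rpredD (ishom_W hg H) H'; rewrite linearB /=.
by rewrite addrA subrK.
Qed.

Lemma iso_data_iso X Y (M : smod F n X) (N : smod F n Y) : iso_data M N -> smod_iso M N.
Proof.
case=> f [g [hf hg gf fg]]; exists f; split=> // [v vM fW|].
  by have := rpredB (ishom_W hg fW) (gf v vM); rewrite opprB addrC subrK.
apply/subvP=> v vN; apply/memv_addP; exists (f (g v)).
  by apply: memv_img; apply: ishom_V hg vN.
by exists (v - f (g v)); [rewrite -opprB rpredN fg|rewrite addrC subrK].
Qed.

Lemma iso_data_trans X Y Z (M : smod F n X) (N : smod F n Y) (P : smod F n Z) :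
  iso_data M N -> iso_data N P -> iso_data M P.
Proof.
case=> f [g [hf hg gf fg]] [f' [g' [hf' hg' gf' fg']]].
exists (f' \o f)%VF, (g \o g')%VF; split.
- exact: (ishom_comp hf hf').
- exact: (ishom_comp hg' hg).
- move=> v vM; rewrite !comp_lfunE /=.
  have := rpredD (ishom_W hg (gf' _ (ishom_V hf vM))) (gf v vM).
  by rewrite linearB /= addrA subrK.
- move=> v vP; rewrite !comp_lfunE /=.
  have := rpredD (ishom_W hf' (fg _ (ishom_V hg' vP))) (fg' v vP).
  by rewrite linearB /= addrA subrK.
Qed.

Lemma short_exact_iso X Y Z T (M1 : smod F n X) (Q : smod F n Y) (M3 : smod F n Z)
    (I : smod F n T) : iso_data I Q -> short_exact M1 Q M3 -> short_exact M1 I M3.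
Proof.
case=> h [k [hh hk kh hkI]] [f [g [hf hg fi gs ex]]].
exists (k \o f)%VF, (g \o h)%VF; split.
- exact: ishom_comp hk.
- exact: ishom_comp hg.
- move=> v v1; rewrite comp_lfunE /= => kW; apply: fi => //.
  have := rpredB (ishom_W hh kW) (hkI _ (ishom_V hf v1)).
  by rewrite opprB addrC subrK.
- apply/subvP=> z /(subvP gs)/memv_addP[_ /memv_imgP[q qQ ->] [w wW ->]].
  apply/memv_addP; exists (g (h (k q))).
    by rewrite -[g (h _)]comp_lfunE; apply: memv_img; apply: ishom_V hk qQ.
  exists (w - (g (h (k q)) - g q)).
    by rewrite rpredB // -linearB (ishom_W hg) // hkI.
  by rewrite opprB [RHS]addrCA [_ + (g q - _)]addrC subrK addrC.
- move=> v vI; rewrite comp_lfunE /=; have vQ := ishom_V hh vI; rewrite ex //; split.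
    case/memv_addP=> _ /memv_imgP[a a1 ->] [w wW E].
    apply/memv_addP; exists (k (f a)); first by rewrite -[k _]comp_lfunE memv_img.
    exists (v - k (f a)); last by rewrite addrC subrK.
    have -> : v - k (f a) = k w - (k (h v) - v).
      by rewrite E [k (_ + _)]linearD /= opprB opprD (addrA v) [RHS]addrC subrK.
    by rewrite rpredB ?kh // (ishom_W hk).
  case/memv_addP=> _ /memv_imgP[a a1 ->] [w wW E]; rewrite comp_lfunE /= in E.
  apply/memv_addP; exists (f a); first exact: memv_img.
  exists (h v - f a); last by rewrite addrC subrK.
  have -> : h v - f a = h w + (h (k (f a)) - f a).
    by rewrite E [h (_ + _)]linearD /= [_ + h w]addrC addrA.
  by rewrite rpredD ?(ishom_W hh) // hkI // (ishom_V hf).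
Qed.

End Homs.

Section Bmap.
Variables (F : fieldType) (A X : finType) (V : vectType F).

Definition bmap (f : A -> 'Hom(vec F X, V)) : 'Hom(vec F (A * X)%type, V) :=
  lext (fun p => f p.1 (delta F p.2)).

Lemma bmapE f a v : bmap f (tens (delta F a) v) = f a v.
Proof. by apply: tens_ext => r; rewrite lext_delta. Qed.
End Bmap.

(** * Generators and relations of an induced module *)

Section Ind.
Variables (F : fieldType) (x : F) (n : nat) (X : finType) (M : smod F n X).

Lemma ind_V a v : v \in sV M -> tens (delta F a) v \in sV (ind x M).
Proof.
move=> vM; rewrite -tensLE; rewrite -(span_basis (vbasisP (sV M))) in vM.
apply: (span_mem _ vM) => w wb; rewrite tensLE; apply: memv_span.
by apply: allpairs_f => //; rewrite mem_enum.
Qed.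

Lemma ind_Vind (V : vectType F) (U : {vspace V}) (f : 'Hom(_, V)) :
  (forall a v, v \in sV M -> f (tens (delta F a) v) \in U) ->
  forall v, v \in sV (ind x M) -> f v \in U.
Proof.
move=> H v; apply: span_mem => _ /allpairsP[[a w] /= [_ wb ->]].
by apply: H; apply: vbasis_mem.
Qed.

Lemma ind_W1 a w : w \in sW M -> tens (delta F a) w \in sW (ind x M).
Proof.
move=> wM; rewrite -tensLE; rewrite -(span_basis (vbasisP (sW M))) in wM.
apply: (span_mem _ wM) => w' wb; rewrite tensLE; apply: memv_span.
by rewrite mem_cat; apply/orP; left; apply: allpairs_f => //; rewrite mem_enum.
Qed.

Lemma ind_W2 a b v : v \in sV M ->
  tens (prodA x a (eps b)) v - tens (delta F a) (actv M b v) \in sW (ind x M).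
Proof.
move=> vM; rewrite actvE -[tens _ v]tensLE -[tens _ (actL _ _ _)]tensLE -[X in _ - X]comp_lfunE.
rewrite -(span_basis (vbasisP (sV M))) in vM.
apply: (span_memB (f := tensL _ _) (g := (tensL _ _ \o actL M b)%VF) _ vM) => w wb.
rewrite comp_lfunE !tensLE -actvE; apply: memv_span; rewrite mem_cat; apply/orP; right.
apply/mapP; exists (a, (b, w)) => //.
by apply: allpairs_f; rewrite ?mem_enum //; apply: allpairs_f; rewrite ?mem_enum.
Qed.

Lemma ind_Wind (V : vectType F) (U : {vspace V}) (f : 'Hom(_, V)) :
  (forall a w, w \in sW M -> f (tens (delta F a) w) \in U) ->
  (forall a b v, v \in sV M ->
     f (tens (prodA x a (eps b)) v) - f (tens (delta F a) (actv M b v)) \in U) ->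
  forall v, v \in sW (ind x M) -> f v \in U.
Proof.
move=> H1 H2 v; apply: span_mem => w; rewrite mem_cat => /orP[].
  by case/allpairsP=> [[a w'] /= [_ wb ->]]; apply: H1; apply: vbasis_mem.
case/mapP=> _ /allpairsP[[a _] /= [_ /allpairsP[[b w'] /= [_ wb ->]] ->]] -> /=.
by rewrite linearB /= H2 // vbasis_mem.
Qed.

Lemma ind_act c a v : actv (ind x M) c (tens (delta F a) v) = tens (prodA x c a) v.
Proof.
rewrite actvE (tens_ext (g := tensL _ (prodA x c a))) ?tensLE // => r.
by rewrite lext_delta tensLE.
Qed.

End Ind.

(** * The diagrams that span the induced module *)

Section Pset.
Variable n : nat.
Implicit Types (c : diag n.+1) (d : diag n) (m : nat).
Local Open Scope nat_scope.
Notation lm := (lift (@ord_max n)).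

(* For a diagram d with all bottom vertices below m joined to the top, a * eps d satisfies
   Pset or is zero in the induced module; the bottom vertex n is unconstrained. *)
Definition midiso m c := [forall i : 'I_n, (m <= i) ==> (val c (inr (lm i)) == inr (lm i))].
Definition Pset m c := midiso m c && [forall i : 'I_n, (i < m) ==>
  (isl (val c (inr (lm i))) || (val c (inr (lm i)) == inr ord_max))].

Lemma midisoP m c : reflect (forall i : 'I_n, m <= i -> val c (inr (lm i)) = inr (lm i)) (midiso m c).
Proof.
apply: (iffP forallP) => H i; first by move=> mi; apply/eqP/(implyP (H i)).
by apply/implyP=> /H->.
Qed.

Lemma Pset_midiso m c : Pset m c -> midiso m c.
Proof. by case/andP. Qed.

(** The case j = i is included: a bottom vertex below m that is isolated violates [Pset] as well. *)
Lemma notPsetP m c : midiso m c ->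
  reflect (exists i j : 'I_n, i < m /\ val c (inr (lm i)) = inr (lm j)) (~~ Pset m c).
Proof.
rewrite /Pset => -> /=; rewrite negb_forall; apply: (iffP existsP) => -[i].
  rewrite negb_imply negb_or => /and3P[im]; case E: (val c _) => [k|k] //= _.
  case: (unliftP ord_max k) E => [j ->|->]; last by rewrite eqxx.
  by move=> E _; exists i, j.
case=> j [im E]; exists i; rewrite im E /=; apply/eqP => -[] /eqP.
by rewrite /= /bump leqNgt ltn_ord add0n ltn_eqF.
Qed.

Lemma midiso_Gp m b c : midiso m c -> midiso m (dmul b c).
Proof. by move/midisoP=> H; apply/midisoP=> i /H; apply: Gp_bot. Qed.

Lemma Pset_Gp m b c : midiso m c -> Pset m (dmul b c) -> Pset m c.
Proof.
move=> mc; apply: contraTT => /(notPsetP mc)[i [j [im E]]].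
by apply/(notPsetP (midiso_Gp b mc)); exists i, j; split=> //; apply: Gp_bot.
Qed.

Lemma Pset_pdiag m c (s : 'S_n.+1) : m <= n -> s \in Ssub n.+1 m ->
  Pset m (dmul c (pdiag s)) = Pset m c.
Proof.
move=> mn sm; have [s0 s0m ->] := Ssub_lperm mn sm; clear s sm.
suff H s1 e : s1 \in Ssub n m -> Pset m e -> Pset m (dmul e (pdiag (lperm s1))).
  apply/idP/idP=> [P|]; last exact: H.
  rewrite -(Gp_pdiag1 c) -(mulgV (lperm s0)) -Gp_pdiagM lpermV; apply: H => //.
  exact: SsubV.
clear c s0 s0m.
move=> s1m Pe; have [me _] := andP Pe.
have E (i : 'I_n) : inr (lm (s1 i)) = rl (lperm s1) (inr (lm i)) :> vtx n.+1.
  by rewrite /= lperm_lift.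
have mid : midiso m (dmul e (pdiag (lperm s1))).
  apply/midisoP=> i mi; have := E i; rewrite (SsubP _ _ s1m) // => Ei.
  by rewrite {1}Ei Gp_pdiag (midisoP _ _ me).
apply: contraLR (Pe) => /(notPsetP mid)[i [j [im]]].
rewrite -[i](permKV s1) -[j](permKV s1) !E Gp_pdiag => /(can_inj (rlK _)) H.
apply/(notPsetP me); exists (s1^-1 i)%g, (s1^-1 j)%g; split=> //.
by rewrite (Ssub_lt _ (SsubV s1m)).
Qed.

Lemma midiso_eps m d : iso_from m d -> midiso m (eps d).
Proof.
move/iso_fromP=> di; apply/midisoP=> i mi.
by rewrite -[inr (lm i)]/(liftv (inr i)) eps_lift di.
Qed.

Lemma Pset_eps m d : iso_from m d -> Pset m (eps d) = halfd m d.
Proof.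
move=> di; have E (i : 'I_n) : val (eps d) (inr (lm i)) = liftv (val d (inr i)).
  by rewrite -[inr (lm i)]/(liftv (inr i)) eps_lift.
apply/idP/halfdP=> [P|[_ H]].
  split=> // i im; apply: contraLR P => nl; apply/(notPsetP (midiso_eps di)).
  by rewrite /isl in nl; case F: (val d (inr i)) nl => [k|k] // _; exists i, k; rewrite E F.
apply: contraT => /(notPsetP (midiso_eps di))[i [j [im]]]; rewrite E.
by have := H i im; case: (val d _).
Qed.

Lemma Gp_eps_udiag m c : midiso m c -> dmul c (eps (udiag n m)) = c.
Proof.
move/midisoP=> mc; pose H (k : 'I_n.+1) := if unlift ord_max k is Some i then m <= i else false.
have Hl i : H (lm i) = (m <= i) by rewrite /H liftK.
have HN k : ~~ H k -> val (eps (udiag n m)) (inl k) = inr k.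
  rewrite /H; case: unliftP => [i ->|-> _]; last by rewrite eps_top.
  by rewrite -ltnNge -[inl (lm i)]/(liftv (inl i)) eps_lift udiagE => ->.
apply: (Gp_copy (H := H)) => // k.
all: rewrite /H; case: unliftP => [i ->|//] mi; have E : i < m = false by rewrite ltnNge mi.
  exists (lm i); rewrite mc // liftK; split=> //.
  by rewrite -[inr (lm i)]/(liftv (inr i)) eps_lift udiagE E.
exists (lm i); rewrite ?liftK //.
by rewrite -[inl (lm i)]/(liftv (inl i)) eps_lift udiagE E.
Qed.

Lemma ell_eps_udiag m c : midiso m c -> loops c (eps (udiag n m)) = n - m.
Proof.
move/midisoP=> mc; pose H (k : 'I_n.+1) := if unlift ord_max k is Some i then m <= i else false.
rewrite (ell_copy (H := H)).
- rewrite -card_ord_ge -[RHS](card_imset _ (@lift_inj _ ord_max)); apply: eq_card => k.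
  rewrite inE /H; case: unliftP => [i ->|->].
    by rewrite mem_imset ?inE //; apply: lift_inj.
  by apply/esym/imsetP=> -[i _ /eqP]; rewrite (negPf (neq_lift _ _)).
- move=> k; rewrite /H; case: unliftP => [i ->|//] mi; split; first exact: mc.
  by rewrite -[inl (lm i)]/(liftv (inl i)) eps_lift udiagE ltnNge mi.
- move=> k; rewrite /H; case: unliftP => [i ->|-> _]; last by rewrite eps_top.
  by rewrite -ltnNge -[inl (lm i)]/(liftv (inl i)) eps_lift udiagE => ->.
Qed.

End Pset.

Section Kill.
Variable n : nat.
Implicit Types (b : diag n) (m : nat).
Local Open Scope nat_scope.
Notation lm := (lift (@ord_max n)).

Lemma Gp_top b d (i j : 'I_n) : val b (inl i) = inl j -> val (dmul b d) (inl i) = inl j.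
Proof.
move=> bi; have [ij|ij] := eqVneq i j; last first.
  have : conn b d (embO (inl i)) (embO (inl j)).
    by have := connA b d (inl i); rewrite bi.
  by rewrite Gp_lnk /lnk => /orP[/eqP[E]|/eqP //]; rewrite E eqxx in ij.
rewrite -{}ij in bi *; have := conn_Gp b d (inl i).
suff H w : conn b d (embO (inl i)) w -> w = embO (inl i) by move/H/(@embO_inj _).
apply: (connect_ind (P := fun w => w = embO (inl i))) => // u v -> /stack_relP[] [] [z|z] // [<-].
by rewrite bi => ->.
Qed.

(* c absorbs eps (copy_bot c) on the right, up to loops; this makes c vanish in the
   induced module as soon as it joins two of its first m bottom vertices. *)
Definition copy_fun (c : diag n.+1) (v : vtx n) : vtx n :=
  match v with
  | inl i => if val c (inr (lm i)) is inr k then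
               if unlift ord_max k is Some j then inl j else inr i else inr i
  | inr i => if val c (inr (lm i)) is inr k then
               if unlift ord_max k is Some j then inr j else inl i else inl i
  end.

Lemma copy_invol c : involutive (copy_fun c).
Proof.
move=> v; case: v => i /=.
all: case E: (val c _) => [k|k] /=; rewrite ?E //.
all: case: (unliftP ord_max k) E => [j ->|->] E /=; rewrite ?E ?unlift_none //.
all: by rewrite -E diagK liftK.
Qed.

Definition copy_bot c : diag n := mkdiag (copy_fun c).

Lemma copy_botE c v : val (copy_bot c) v = copy_fun c v.
Proof. exact: mkdiagE (@copy_invol c) v. Qed.

Lemma Gp_copy_bot c : dmul c (eps (copy_bot c)) = c.
Proof.
pose H (k : 'I_n.+1) := if unlift ord_max k is Some i then
  (if val c (inr (lm i)) is inr k' then k' != ord_max else false) else false.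
have HP k : H k -> exists i j, [/\ k = lm i, val c (inr k) = inr (lm j) &
    val c (inr (lm j)) = inr k].
  rewrite /H; case: unliftP => [i ->|//]; case E: (val c _) => [k'|k'] //.
  case: (unliftP ord_max k') E => [j ->|->]; last by rewrite eqxx.
  by move=> E _; exists i, j; split=> //; rewrite -E diagK.
apply: (Gp_copy (H := H)) => k.
- move=> /HP[i [j [-> E E']]]; exists (lm j); rewrite E; split=> //.
    by rewrite /H liftK E' eq_sym neq_lift.
  by rewrite -[inr (lm i)]/(liftv (inr i)) eps_lift copy_botE /copy_fun E liftK.
- move=> /HP[i [j [-> E E']]]; exists (lm j); last by rewrite /H liftK E' eq_sym neq_lift.
  by rewrite -[inl (lm i)]/(liftv (inl i)) eps_lift copy_botE /copy_fun E liftK.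
rewrite /H; case: (unliftP ord_max k) => [i ->|-> _]; last by rewrite eps_top.
rewrite -[inl (lm i)]/(liftv (inl i)) eps_lift copy_botE /=.
case E: (val c _) => [k'|k'] //; rewrite negbK => /eqP->.
by rewrite unlift_none.
Qed.

(** The copied bottom row puts a horizontal arc or an isolated vertex at some top vertex i < m.
    Vertical arcs of the product start at top vertices below m other than i, so fewer than m of them
    are left. *)
Lemma copy_kill m c : m <= n -> midiso m c -> ~~ Pset m c ->
  ~~ halfd m (dmul (copy_bot c) (udiag n m)).
Proof.
move=> mn mc /(notPsetP mc)[i [j [im E]]].
rewrite halfd_nvert ?iso_Gp ?iso_udiag // neq_ltn; apply/orP; left.
rewrite -[X in _ < X](card_ord_lt mn) /nvert; apply: proper_card; apply/properP; split.
  apply/subsetP=> k; rewrite !inE => /existsP[k' /eqP gk]; rewrite ltnNge; apply/negP=> mk.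
  have bk : val (copy_bot c) (inl k) = inl k by rewrite copy_botE /copy_fun (midisoP _ _ mc) // liftK.
  by rewrite (Gp_top _ bk) in gk.
exists i; rewrite inE //; apply/existsP=> -[k' /eqP gk].
have bi : val (copy_bot c) (inl i) = inl j by rewrite copy_botE /copy_fun E liftK.
by rewrite (Gp_top _ bi) in gk.
Qed.

End Kill.

(** * The free bottom vertex *)

Section BottomVertex.
Local Open Scope nat_scope.
Variable n : nat.
Implicit Types (b c d : diag n.+1) (m : nat) (p : 'S_n.+1).
Notation lm := (lift (@ord_max n)).
Notation mx := (@ord_max n).

Lemma inr_lift_max (j : 'I_n) : (inr (lm j) == inr mx :> vtx n.+1) = false.
Proof.
apply/eqP=> E; have := congr1 (fun v : vtx n.+1 => if v is inr k then k else mx) E.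
by move/esym/eqP; rewrite (negPf (neq_lift _ _)).
Qed.

Lemma Pset_iso m c : m <= n -> iso_from m c -> Pset m c = halfd m c.
Proof.
move=> mn ci; have mc : midiso m c.
  by apply/midisoP=> i mi; apply: (iso_fromP _ _ ci); rewrite lift_max.
apply/idP/halfdP=> [P|[_ H]].
  split=> // i im; case: (unliftP mx i) im => [j ->|->]; last by rewrite /= ltnNge mn.
  rewrite lift_max => im; apply: contraLR P => nl; apply/(notPsetP mc).
  case E : (val c (inr (lm j))) nl => [k|k] // _.
  have [kj|] := eqVneq k mx; last first.
    by case: (unliftP mx k) E => [j' ->|-> _]; [exists j, j'|rewrite eqxx].
  have := diagK c (inr (lm j)); rewrite E kj (iso_fromP _ _ ci) //.
  by move/esym/eqP; rewrite inr_lift_max.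
apply: contraT => /(notPsetP mc)[i [j [im E]]].
by have := H (lm i); rewrite lift_max im E => /(_ isT).
Qed.

Lemma Pset_max_iso m c : m <= n -> Pset m c -> val c (inr mx) = inr mx -> halfd m c.
Proof.
move=> mn Pc cm; rewrite -Pset_iso //; apply/iso_fromP=> i mi.
case: (unliftP mx i) mi => [j ->|-> _] //; rewrite lift_max => mj.
exact: (midisoP _ _ (Pset_midiso Pc)).
Qed.

Lemma halfd_max m c : m <= n -> iso_from m c -> val c (inr mx) = inr mx.
Proof. by move=> mn /iso_fromP; apply. Qed.

Lemma Pset_max_cases m c (k : 'I_n.+1) : Pset m c -> val c (inr mx) = inr k -> k != mx ->
  (k < m)%N /\ val c (inr k) = inr mx.
Proof.
move=> Pc cm km; have ck : val c (inr k) = inr mx by rewrite -cm diagK.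
split=> //; rewrite ltnNge; apply/negP=> mk.
case: (unliftP mx k) ck km mk => [j ->|->]; last by rewrite eqxx.
rewrite lift_max => ck _ mj; have := midisoP _ _ (Pset_midiso Pc) j mj; rewrite ck.
by move/esym/eqP; rewrite inr_lift_max.
Qed.

Lemma dmul_max c p : p mx = mx -> val (dmul c (pdiag p)) (inr mx) = rl p (val c (inr mx)).
Proof. by move=> pm; rewrite -[inr mx]/(inr mx) -{1}pm -[inr (p mx)]/(rl p (inr mx)) Gp_pdiag. Qed.

Section Tau.
Variables (m : nat) (x0 : 'I_n.+1).
Hypotheses (mn : m <= n) (x0m : x0 = m :> nat).

(** Moves the bottom vertex n to position m: diagrams in which it is joined to the top become half
    diagrams with m + 1 vertical arcs. It is the identity for m = n. *)
Definition last_swap : 'S_n.+1 := tperm x0 mx.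

Lemma last_swap2 : (last_swap * last_swap)%g = 1%g. Proof. exact: tperm2. Qed.

Lemma last_swapC p : p \in Ssub n.+1 m -> (p * last_swap)%g = (last_swap * p)%g.
Proof.
move=> /SsubP pm; have px : p x0 = x0 by apply: pm; rewrite x0m.
have pmx : p mx = mx by apply: pm.
have J : (last_swap ^ p)%g = last_swap by rewrite /last_swap tpermJ px pmx.
by rewrite [RHS]conjgC J.
Qed.

Lemma iso_last_swap c : midiso m c -> iso_from m.+1 (dmul c (pdiag last_swap)).
Proof.
move=> mc; apply/iso_fromP=> i mi.
have iso (j : 'I_n.+1) : m <= j -> j != mx -> val c (inr j) = inr j.
  case: (unliftP mx j) => [k ->|->]; last by rewrite eqxx.
  by rewrite lift_max => mk _; apply: (midisoP _ _ mc).
have ix : i != x0 by apply: contraTneq mi => ->; rewrite x0m ltnn.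
have [im|im] := eqVneq i mx.
  have xm : x0 != mx by rewrite -im eq_sym.
  have E : inr mx = rl last_swap (inr x0) :> vtx n.+1 by rewrite /= /last_swap tpermL.
  by rewrite im {1}E Gp_pdiag iso // x0m.
have E : inr i = rl last_swap (inr i) :> vtx n.+1 by rewrite /= /last_swap tpermD // eq_sym.
by rewrite {1}E Gp_pdiag iso // ltnW.
Qed.

Lemma halfd_last_swap c : midiso m c ->
  halfd m.+1 (dmul c (pdiag last_swap)) = Pset m c && isl (val c (inr mx)).
Proof.
move=> mc; have iso := iso_last_swap mc.
have sw (j : 'I_n.+1) : isl (val (dmul c (pdiag last_swap)) (inr (last_swap j))) = isl (val c (inr j)).
  exact: isl_pdiag.
have sx : last_swap x0 = mx by rewrite /last_swap tpermL.
have sm : last_swap mx = x0 by rewrite /last_swap tpermR.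
have slt (j : 'I_n) : j < m -> last_swap (lm j) = lm j.
  move=> jm; rewrite /last_swap tpermD //; last exact: neq_lift.
  by apply: contraTneq jm => xj; rewrite -(lift_max j) -xj x0m ltnn.
apply/halfdP/andP=> [[_ H]|[Pc cm]].
  split; last by rewrite -sw sm H // x0m.
  apply: contraT => /(notPsetP mc)[i [j [im E]]].
  have := H (lm i); rewrite lift_max -(slt i im) sw E => /(_ (ltnW _)).
  by move=> K; have := K im.
split=> // i; rewrite ltnS leq_eqVlt => /orP[/eqP im|im].
  have -> : i = x0 by apply: val_inj; rewrite /= im x0m.
  by rewrite -sm sw.
case: (unliftP mx i) im => [j ->|->]; last by rewrite /= ltnNge mn.
rewrite lift_max => jm; rewrite -(slt j jm) sw.
case E : (val c (inr (lm j))) => [k|k] //.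
have [kx|] := eqVneq k mx.
  by have := diagK c (inr (lm j)); rewrite E kx => E'; rewrite E' in cm.
case: (unliftP mx k) E => [k' ->|->]; last by rewrite eqxx.
move=> E _; have /negP[] : ~~ Pset m c by apply/(notPsetP mc); exists j, k'.
exact: Pc.
Qed.

End Tau.

Section Arc.
Variables (m : nat) (j0 : 'I_n).
Hypothesis j0m : m = j0.+1.
Notation i0 := (lm j0).

Let mn : m <= n. Proof. by rewrite j0m. Qed.

(** A permutation in S_m brings any arc between the bottom vertex n and a vertex below m to the end
    m - 1. The permutations keeping this end are those of S_(m-1), whence the restriction of S^l. *)
Definition join_arc d := addarc i0 mx d.
Definition cut_arc d := forget (pred2 i0 mx) d.

Let iso_i0 d : iso_from j0 d -> val d (inr i0) = inr i0.
Proof. by move/iso_fromP; apply; rewrite lift_max. Qed.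
Let iso_mx d : iso_from j0 d -> val d (inr mx) = inr mx.
Proof. by move/iso_fromP; apply; rewrite ltnW /=. Qed.

Lemma arc_i0 d : val (join_arc d) (inr i0) = inr mx.
Proof. by rewrite addarcE /arc_fun eqxx. Qed.

Lemma arc_max d : val (join_arc d) (inr mx) = inr i0.
Proof. by rewrite -(arc_i0 d) diagK. Qed.

Lemma unarc_arc d : iso_from j0 d -> cut_arc (join_arc d) = d.
Proof. by move=> di; apply: forget_addarc; [apply: iso_i0|apply: iso_mx]. Qed.

Lemma arc_unarc c : val c (inr mx) = inr i0 -> join_arc (cut_arc c) = c.
Proof. by move=> cm; apply: addarc_forget; rewrite -cm diagK. Qed.

Lemma arc_out d v : iso_from j0 d -> ~~ bot (pred2 i0 mx) v -> val (join_arc d) v = val d v.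
Proof.
move=> di vb; rewrite -{2}(unarc_arc di) /cut_arc forget_out //.
exact: closed_addarc.
Qed.

Let bot_lm (i : 'I_n) : i != j0 -> ~~ bot (pred2 i0 mx) (inr (lm i)).
Proof.
move=> ij; rewrite /= negb_or; apply/andP; split; last by rewrite eq_sym neq_lift.
by rewrite (inj_eq (@lift_inj _ _)).
Qed.

Lemma Pset_arc d : iso_from j0 d -> Pset m (join_arc d) = halfd j0 d.
Proof.
move=> di; have mc : midiso m (join_arc d).
  apply/midisoP=> i mi; rewrite arc_out //; last first.
    by apply: bot_lm; apply: contraTneq mi => ->; rewrite j0m ltnn.
  by apply: (iso_fromP _ _ di); rewrite lift_max (leq_trans _ mi) // j0m.
rewrite -(Pset_iso (ltnW (ltn_ord j0)) di).
have md : midiso j0 d by apply/midisoP=> i ji; apply: (iso_fromP _ _ di); rewrite lift_max.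
apply/idP/idP; apply: contraTT.
  move=> /(notPsetP md)[i [j [ij E]]]; apply/(notPsetP mc); exists i, j.
  split; first by rewrite j0m ltnS ltnW.
  by rewrite arc_out // bot_lm // neq_ltn ij.
move=> /(notPsetP mc)[i [j [im E]]]; apply/(notPsetP md); exists i, j.
have ij : i != j0 by apply: contraTneq isT => ij; move: E; rewrite ij arc_i0 => /esym/eqP; rewrite inr_lift_max.
split; first by rewrite ltn_neqAle ij -ltnS -j0m.
by rewrite -E arc_out // bot_lm.
Qed.

Lemma iso_unarc c : Pset m c -> val c (inr mx) = inr i0 -> iso_from j0 (cut_arc c).
Proof.
move=> Pc cm; have cY : closed_bot (pred2 i0 mx) c.
  move=> l /pred2P[]->; [exists mx|exists i0]; rewrite //= ?eqxx ?orbT //.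
  by rewrite -cm diagK.
apply/iso_fromP=> i ji; have [bi|nb] := boolP (bot (pred2 i0 mx) (inr i)).
  by rewrite forgetE bi.
rewrite forget_out //; case: (unliftP mx i) ji nb => [j ->|->]; last by rewrite /= eqxx orbT.
rewrite lift_max => ji nb; apply: (midisoP _ _ (Pset_midiso Pc)).
rewrite j0m ltn_neqAle ji andbT; apply: contraNneq nb => jj.
by rewrite /= (val_inj jj : j0 = j) eqxx.
Qed.

Lemma halfd_unarc c : Pset m c -> val c (inr mx) = inr i0 -> halfd j0 (cut_arc c).
Proof.
by move=> Pc cm; rewrite -Pset_arc ?iso_unarc // arc_unarc.
Qed.

Lemma dmul_arc b d : iso_from j0 d ->
  dmul b (join_arc d) = join_arc (dmul b d) /\ loops b (join_arc d) = loops b d.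
Proof. by move=> di; apply: Gp_addarc; [apply: iso_i0|apply: iso_mx]. Qed.

Lemma arc_pdiag d p : iso_from j0 d -> p \in Ssub n.+1 j0 ->
  join_arc (dmul d (pdiag p)) = dmul (join_arc d) (pdiag p).
Proof.
move=> di pj; have p0 : p i0 = i0 by apply: (SsubP _ _ pj); rewrite lift_max.
have px : p mx = mx by apply: (SsubP _ _ pj); rewrite ltnW /=.
have dpi := iso_pdiag pj di; apply: diag_ext => v.
have E0 : inr i0 = rl p (inr i0) :> vtx n.+1 by rewrite /= p0.
have Ex : inr mx = rl p (inr mx) :> vtx n.+1 by rewrite /= px.
have [->|vi] := eqVneq v (inr i0).
  rewrite (arc_i0 (dmul d (pdiag p))).
  by have := Gp_pdiag (join_arc d) p (inr i0); rewrite -E0 (arc_i0 d) -Ex => ->.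
have [->|vx] := eqVneq v (inr mx).
  rewrite (arc_max (dmul d (pdiag p))).
  by have := Gp_pdiag (join_arc d) p (inr mx); rewrite -Ex (arc_max d) -E0 => ->.
have vb : ~~ bot (pred2 i0 mx) v by rewrite bot2 negb_or vi vx.
rewrite arc_out //; rewrite -[v](rlVK p) in vb *; move: (rl _ v) vb => u ub.
have ub' : ~~ bot (pred2 i0 mx) u.
  apply: contra ub; rewrite !bot2 => /orP[] /eqP->; rewrite /= ?p0 ?px eqxx ?orbT //.
by rewrite !Gp_pdiag arc_out.
Qed.

Lemma unarc_pdiag c p : Pset m c -> val c (inr mx) = inr i0 -> p \in Ssub n.+1 j0 ->
  cut_arc (dmul c (pdiag p)) = dmul (cut_arc c) (pdiag p).
Proof.
move=> Pc cm pj; have di := iso_unarc Pc cm.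
rewrite -{1}(arc_unarc cm) -arc_pdiag // unarc_arc //; exact: iso_pdiag.
Qed.

End Arc.
End BottomVertex.

(** * Half diagrams under the slide *)

Section SlideHalf.
Variable n : nat.
Implicit Types (b c : diag n.+1) (d : diag n.+2) (m : nat) (p : 'S_n.+1).
Local Open Scope nat_scope.
Notation lm := (lift ord_max).

Lemma slv_lm (i : 'I_n) : slv (inr (lm i)) = inr (lm (lm i)).
Proof. by rewrite /slv liftK. Qed.

Lemma slk_None (w : vtx n.+2) : slk w = None -> w = inr ord_max \/ w = inr (lm ord_max).
Proof.
case: w => i //; rewrite /slk; case: (unliftP ord_max i) => [j ->|->]; last by left.
by case: (unliftP ord_max j) => [k ->|->] /=; [rewrite ?liftK|right].
Qed.

Lemma iso_fixes m d : m <= n -> iso_from m d -> fixes_out (@slk n) d.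
Proof.
move=> mn /iso_fromP di w /slk_None[] ->; apply: di; first exact: leqW.
by rewrite lift_max.
Qed.

Lemma bot_cases (Q : 'I_n.+2 -> Prop) : (forall i : 'I_n, Q (lm (lm i))) ->
  Q ord_max -> Q (lm ord_max) -> forall i, Q i.
Proof.
move=> H1 H2 H3 i; case: (unliftP ord_max i) => [j ->|-> //].
by case: (unliftP ord_max j) => [k ->|->].
Qed.

Lemma halfd_unslide m c : m <= n -> Pset m c -> halfd m (unslide c).
Proof.
move=> mn Pc; have mc := Pset_midiso Pc.
have E (i : 'I_n) : val (unslide c) (inr (lm (lm i))) = slv (val c (inr (lm i))).
  by rewrite -slv_lm (push_in (@slvK n) (@slkK n)).
have out w : slk w = None -> val (unslide c) w = w.
  exact: (push_out (@slvK n) (@slkK n)).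
apply/halfdP; split.
  apply/iso_fromP; apply: bot_cases => [i||].
  - by rewrite !lift_max E => mi; rewrite (midisoP _ _ mc) // slv_lm.
  - by move=> _; apply: out; rewrite /= unlift_none.
  - by move=> _; apply: out; rewrite /= liftK /= unlift_none.
apply: bot_cases => [i||]; last 2 first.
- by rewrite /= ltnNge (leqW mn).
- by rewrite lift_max /= ltnNge mn.
rewrite !lift_max E => im; apply: contraLR Pc => nl; apply/(notPsetP mc).
case F: (val c (inr (lm i))) nl => [k|k] //; rewrite /slv.
by case: (unliftP ord_max k) F => [j ->|->] // F _; exists i, j.
Qed.

(** A bottom vertex below m that was joined to the last top vertex is now joined to the bottom
    vertex n, which is the exception allowed by [Pset]. *)
Lemma Pset_slide m d : m <= n -> halfd m d -> Pset m (slide d).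
Proof.
move=> mn /halfdP[di dl]; have fd := iso_fixes mn di.
have E v : slv (val (slide d) v) = val d (slv v) by apply: (pull_fix (@slvK n) (@slkK n)).
have ms : midiso m (slide d).
  apply/midisoP=> i mi; apply: (pcan_inj (@slvK n)); rewrite E slv_lm.
  by rewrite (iso_fromP _ _ di) // !lift_max.
apply: contraT => /(notPsetP ms)[i [j [im F]]].
have := E (inr (lm i)); rewrite F !slv_lm => H.
by have := dl (lm (lm i)); rewrite -H !lift_max => /(_ im).
Qed.

Lemma unslideK c : slide (unslide c) = c.
Proof. exact: (pull_push (@slvK n) (@slkK n)). Qed.

Lemma slideK m d : m <= n -> iso_from m d -> unslide (slide d) = d.
Proof. by move=> mn /(iso_fixes mn); apply: (push_pull (@slvK n) (@slkK n)). Qed.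

Lemma slv_rl (p0 : 'S_n) v : slv (rl (lperm p0) v) = rl (lperm (lperm p0)) (slv v).
Proof.
case: v => // i; case: (unliftP ord_max i) => [j ->|->].
  by rewrite slv_lm /= lperm_lift liftK !lperm_lift.
by rewrite /= lperm_max unlift_none.
Qed.

Lemma slide_pdiag m d (p0 : 'S_n) : m <= n -> iso_from m d ->
  slide (dmul d (pdiag (lperm (lperm p0)))) = dmul (slide d) (pdiag (lperm p0)).
Proof.
move=> mn di; have fd := iso_fixes mn di.
have E v : slv (val (slide d) v) = val d (slv v) by apply: (pull_fix (@slvK n) (@slkK n)).
apply: diag_ext => v; rewrite -[v](rlVK (lperm p0)); move: (rl _ v) => {}v.
rewrite Gp_pdiag /slide (pullE (@slvK n) (@slkK n)) slv_rl Gp_pdiag -E -slv_rl.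
by rewrite slvK.
Qed.

(** The truncations of the two actions match: since the slide and its inverse preserve the two
    conditions, a product is dropped in Q exactly when it is dropped in the restricted module. *)
Lemma halfd_eps m b d : m <= n -> iso_from m d ->
  Pset m (dmul b (slide d)) = halfd m (dmul (eps b) d).
Proof.
move=> mn di; have fd := iso_fixes mn di; have di' := iso_Gp (eps b) di.
rewrite -(slide_Gp b fd); apply/idP/idP; last exact: Pset_slide.
by move/(halfd_unslide mn); rewrite (slideK mn di').
Qed.

End SlideHalf.

Section SlideIso.
Variables (F : fieldType) (x : F) (n : nat) (l : seq nat).
Notation m := (sumn l).
Variable Q : smod F n.+1 (diag n.+1 * tabloid n.+1)%type.
Variable R : smod F n.+2 (diag n.+2 * tabloid n.+2)%type.
Hypotheses (pl : ispart l) (mn : (m <= n)%N).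
Hypothesis HQ : half_spec x (@Pset n m) l Q.
Hypothesis HR : half_spec x (halfd m) l R.

Let slide_map : 'Hom(vec F (diag n.+2 * tabloid n.+2)%type, vec F (diag n.+1 * tabloid n.+1)%type) :=
  bmap (fun d => (tensL _ (delta F (slide d)) \o restL F n.+1)%VF).

Let unslide_map : 'Hom(vec F (diag n.+1 * tabloid n.+1)%type, vec F (diag n.+2 * tabloid n.+2)%type) :=
  bmap (fun c => (tensL _ (delta F (unslide c)) \o liftL F n.+1)%VF).

Let slide_mapE d s : slide_map (tens (delta F d) s) = tens (delta F (slide d)) (restL F n.+1 s).
Proof. by rewrite /slide_map bmapE comp_lfunE tensLE. Qed.

Let unslide_mapE c s : unslide_map (tens (delta F c) s) = tens (delta F (unslide c)) (liftL F n.+1 s).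
Proof. by rewrite /unslide_map bmapE comp_lfunE tensLE. Qed.

Let mn1 : (m <= n.+1)%N. Proof. exact: leqW. Qed.

Let restS s : s \in specht F n.+2 l -> restL F n.+1 s \in specht F n.+1 l.
Proof. by move=> sS; have [] := restL_specht pl mn1 sS. Qed.

Let actR b v : actv (res R) b v = actL R (eps b) v.
Proof. by rewrite -actvE. Qed.

Lemma unslide_map_inv v : v \in sV R -> unslide_map (slide_map v) - v \in sW R.
Proof.
rewrite -[unslide_map _]comp_lfunE -[X in _ - X]id_lfunE; move: v.
apply: (half_VindB HR) => d s hd sS; rewrite comp_lfunE id_lfunE slide_mapE unslide_mapE.
have [di _] := halfdP _ _ hd; rewrite (slideK mn di).
by have [_ ->] := restL_specht pl mn1 sS; rewrite subrr mem0v.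
Qed.

Lemma slide_map_inv v : v \in sV Q -> slide_map (unslide_map v) - v \in sW Q.
Proof.
rewrite -[slide_map _]comp_lfunE -[X in _ - X]id_lfunE; move: v.
apply: (half_VindB HQ) => c s Pc sS; rewrite comp_lfunE id_lfunE unslide_mapE slide_mapE.
by rewrite unslideK liftLK subrr mem0v.
Qed.

Lemma slide_map_hom : ishom (res R) Q slide_map.
Proof.
apply: ishomI.
- apply: (half_Vind HR) => d s hd sS; rewrite slide_mapE; apply: (half_V HQ).
    exact: Pset_slide.
  exact: restS.
- apply: (half_Wind HR) => d s p hd sS pm; rewrite !slide_mapE.
  have [di _] := halfdP _ _ hd.
  have [p1 p1m pE] := Ssub_lperm mn1 pm; have [p0 p0m p1E] := Ssub_lperm mn p1m.
  rewrite pE (restL_perm pl mn1 p1m sS) p1E (slide_pdiag _ mn di).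
  apply: (half_W HQ); [exact: Pset_slide|exact: restS|by rewrite -p1E].
- move=> b v; rewrite actR actvE -[slide_map (actL _ _ _)]comp_lfunE -[X in _ - X]comp_lfunE.
  move: v; apply: (half_VindB HR) => d s hd sS; rewrite comp_lfunE [X in _ - X]comp_lfunE.
  have [di _] := halfdP _ _ hd; have fd := iso_fixes mn di.
  rewrite -!actvE slide_mapE (half_act HR _ hd sS) (half_act HQ _ (Pset_slide mn hd) (restS sS)).
  rewrite (halfd_eps b mn di); case: ifP => _; last by rewrite hom0 subrr mem0v.
  by rewrite homZ slide_mapE (slide_Gp b fd) (slide_ell b fd) subrr mem0v.
Qed.

Lemma unslide_map_hom : ishom Q (res R) unslide_map.
Proof.
have isoU (c : diag n.+1) : Pset m c -> iso_from m (unslide c).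
  by move=> Pc; have /halfdP[] := halfd_unslide mn Pc.
apply: ishomI.
- apply: (half_Vind HQ) => c s Pc sS; rewrite unslide_mapE; apply: (half_V HR).
    exact: halfd_unslide.
  exact: liftL_specht.
- apply: (half_Wind HQ) => c s p Pc sS pm; rewrite !unslide_mapE liftL_perm.
  have [p0 p0m pE] := Ssub_lperm mn pm.
  have -> : unslide (dmul c (pdiag p)) = dmul (unslide c) (pdiag (lperm p)).
    rewrite -[RHS](slideK mn); last by rewrite iso_pdiag ?lperm_Ssub ?isoU.
    by rewrite pE (slide_pdiag _ mn (isoU _ Pc)) unslideK.
  apply: (half_W HR); [exact: halfd_unslide|exact: liftL_specht|exact: lperm_Ssub].
- move=> b v; rewrite actR actvE -[unslide_map (actL _ _ _)]comp_lfunE -[X in _ - X]comp_lfunE.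
  move: v; apply: (half_VindB HQ) => c s Pc sS; rewrite comp_lfunE [X in _ - X]comp_lfunE.
  have hu := halfd_unslide mn Pc; have fu := iso_fixes mn (isoU _ Pc).
  rewrite -!actvE unslide_mapE (half_act HQ _ Pc sS) (half_act HR _ hu (liftL_specht mn1 sS)).
  rewrite -(halfd_eps b mn (isoU _ Pc)) unslideK; case: ifP => _; last by rewrite hom0 subrr mem0v.
  rewrite homZ unslide_mapE (slide_ell b fu) unslideK.
  have -> : unslide (dmul b c) = dmul (eps b) (unslide c).
    by rewrite -{1}(unslideK c) -(slide_Gp b fu) (slideK mn (iso_Gp _ (isoU _ Pc))).
  by rewrite subrr mem0v.
Qed.

Lemma slide_iso : iso_data Q (res R).
Proof.
exists unslide_map, slide_map; split; [exact: unslide_map_hom|exact: slide_map_hom|..].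
- exact: slide_map_inv.
- exact: unslide_map_inv.
Qed.

End SlideIso.

Opaque dmul loops eps mkdiag delta tens.

(** * The induced module *)

Section IndHalf.
Variables (F : fieldType) (x : F) (n : nat) (l : seq nat).
Notation m := (sumn l).
Variable M : smod F n (diag n * tabloid n)%type.
Variable Q : smod F n.+1 (diag n.+1 * tabloid n.+1)%type.
Hypotheses (x0 : x != 0) (pl : ispart l) (mn : (m <= n)%N).
Hypothesis HM : half_spec x (halfd m) l M.
Hypothesis HQ : half_spec x (@Pset n m) l Q.

Definition prodP (a c : diag n.+1) : vec F (diag n.+1) := if Pset m (dmul a c) then prodA x a c else 0.

Definition ind_map : 'Hom(vec F (diag n.+1 * (diag n * tabloid n))%type, vec F (diag n.+1 * tabloid n.+1)%type) :=
  bmap (fun a => bmap (fun d => (tensL _ (prodP a (eps d)) \o liftL F n)%VF)).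

Lemma ind_mapE a d s : ind_map (tens (delta F a) (tens (delta F d) s)) =
  if Pset m (dmul a (eps d)) then x ^+ loops a (eps d) *: tens (delta F (dmul a (eps d))) (liftL F n s)
  else 0.
Proof.
rewrite /ind_map !bmapE comp_lfunE tensLE /prodP prodAE.
by case: ifP => _; [rewrite tensZl|rewrite tens0l].
Qed.

(** The factor x^-(n-m) compensates for c eps(u) = x^(n-m) c. *)
Definition ind_inv : 'Hom(vec F (diag n.+1 * tabloid n.+1)%type, vec F (diag n.+1 * (diag n * tabloid n))%type) :=
  bmap (fun c => x ^- (n - m) *: (tensL _ (delta F c) \o (tensL _ (delta F (udiag n m)) \o restL F n)))%VF.

Lemma ind_invE c s : ind_inv (tens (delta F c) s) =
  x ^- (n - m) *: tens (delta F c) (tens (delta F (udiag n m)) (restL F n s)).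
Proof. by rewrite /ind_inv bmapE scale_lfunE comp3_lfunE !tensLE. Qed.

Let xu k : x ^+ k != 0. Proof. exact: expf_neq0. Qed.

Let u := udiag n m.
Let hu : halfd m u. Proof. exact: halfd_udiag. Qed.

Let halfd_iso (d : diag n) : halfd m d -> iso_from m d. Proof. by case/halfdP. Qed.

(** Write d as x^-(n-m) d u and move d across the tensor sign: the elements a (x) u (x) s already
    span modulo the relations. *)
Lemma tens_reduce a d s : halfd m d -> s \in specht F n l ->
  tens (delta F a) (tens (delta F d) s) -
  x ^- (n - m) *: tens (prodA x a (eps d)) (tens (delta F u) s) \in sW (ind x M).
Proof.
move=> hd sS; have di := halfd_iso hd.
have E : tens (delta F d) s = x ^- (n - m) *: actv M d (tens (delta F u) s).
  rewrite (half_act HM) // Gp_udiag // hd ell_udiag // scalerA mulVf ?scale1r //.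
rewrite E tensZr -scalerBr rpredZ // -opprB rpredN; apply: ind_W2.
exact: (half_V HM).
Qed.

(** Up to a power of x, c is c eps(b) with b = [copy_bot c]; moved across the tensor sign, b
    annihilates u by [copy_kill]. *)
Lemma tens_kill c s : midiso m c -> ~~ Pset m c -> s \in specht F n l ->
  tens (delta F c) (tens (delta F u) s) \in sW (ind x M).
Proof.
move=> mc nP sS; have := ind_W2 x c (copy_bot c) (half_V HM hu sS).
rewrite (half_act HM) // (negPf (copy_kill mn mc nP)) tens0r subr0.
rewrite prodAE Gp_copy_bot tensZl => H.
by rewrite -[X in X \in _](scalerK (xu (loops c (eps (copy_bot c))))) rpredZ.
Qed.

(** The exponents of x agree by [ellA]. If b d drops out of M, its product with a drops out of Q,
    because [Pset] cannot be regained by left multiplication. *)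
Lemma ind_map_assoc (a : diag n.+1) (b d : diag n) s : halfd m d -> s \in specht F n l ->
  ind_map (tens (prodA x a (eps b)) (tens (delta F d) s)) =
  ind_map (tens (delta F a) (actv M b (tens (delta F d) s))).
Proof.
move=> hd sS; rewrite (half_act HM b hd sS) prodAE tensZl homZ ind_mapE GpA Gp_eps.
have di := halfd_iso hd; have dbi := iso_Gp b di.
have E : (loops a (eps b) + loops (dmul a (eps b)) (eps d) = loops b d + loops a (eps (dmul b d)))%N.
  by rewrite -Gp_eps -(ell_eps b d); apply: ellA.
have hP : Pset m (dmul a (eps (dmul b d))) -> halfd m (dmul b d).
  by move/(Pset_Gp (midiso_eps dbi)); rewrite Pset_eps.
case: (boolP (halfd m (dmul b d))) => [hbd|nbd]; last first.
  by rewrite tens0r hom0 (negPf (contra hP nbd)) scaler0.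
rewrite tensZr homZ ind_mapE; case: ifP => _; last by rewrite !scaler0.
by rewrite !scalerA -!exprD E.
Qed.

Lemma ind_half_ind (V : vectType F) (U : {vspace V}) (f g : 'Hom(_, V)) :
  (forall a d s, halfd m d -> s \in specht F n l ->
    f (tens (delta F a) (tens (delta F d) s)) - g (tens (delta F a) (tens (delta F d) s)) \in U) ->
  forall v, v \in sV (ind x M) -> f v - g v \in U.
Proof.
move=> H v vM; have E w : f w - g w = (f - g) w by rewrite add_lfunE opp_lfunE.
rewrite E; move: v vM; apply: ind_Vind => a v vM; rewrite -tensLE -comp_lfunE; move: v vM.
by apply: (half_Vind HM) => d s hd sS; rewrite comp_lfunE tensLE -E H.
Qed.

Lemma ind_map_hom : ishom (ind x M) Q ind_map.
Proof.
have mapV a d s : halfd m d -> s \in specht F n l ->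
    ind_map (tens (delta F a) (tens (delta F d) s)) \in sV Q.
  move=> hd sS; rewrite ind_mapE; case: ifP => P; last exact: mem0v.
  by rewrite rpredZ // (half_V HQ) // liftL_specht.
apply: ishomI.
- apply: ind_Vind => a v vM; rewrite -tensLE -comp_lfunE; move: v vM.
  by apply: (half_Vind HM) => d s hd sS; rewrite comp_lfunE tensLE mapV.
- apply: ind_Wind => [a w wM|a b v vM].
    rewrite -tensLE -comp_lfunE; move: w wM; apply: (half_Wind HM) => d s p hd sS pm.
    rewrite comp_lfunE [X in _ - X]comp_lfunE !tensLE !ind_mapE -Gp_eps eps_pdiag.
    have pm' := lperm_Ssub pm; rewrite -GpA Pset_pdiag //; case: ifP => P; last by rewrite subrr mem0v.
    have := ellA a (eps d) (pdiag (lperm p)); rewrite !ell_pdiag add0n addn0 => <-.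
    rewrite -scalerBr rpredZ // liftL_perm (half_W HQ) //.
    exact: liftL_specht.
  rewrite -[tens _ v]tensLE actvE -[tens _ (actL _ _ _)]tensLE.
  rewrite -[ind_map (tensL _ _ v)]comp_lfunE -[X in _ - X]comp3_lfunE.
  move: v vM; apply: (half_VindB HM) => d s hd sS.
  rewrite comp3_lfunE comp_lfunE !tensLE -actvE ind_map_assoc // subrr mem0v //.
move=> c v; rewrite !actvE -[ind_map (actL _ _ _)]comp_lfunE -[X in _ - X]comp_lfunE.
move: v; apply: ind_half_ind => a d s hd sS.
rewrite comp_lfunE [X in _ - X]comp_lfunE /= -!actvE ind_act ind_mapE.
rewrite prodAE tensZl homZ ind_mapE GpA.
have E : (loops c a + loops (dmul c a) (eps d) = loops a (eps d) + loops c (dmul a (eps d)))%N.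
  exact: ellA.
case: (boolP (Pset m (dmul a (eps d)))) => P; last first.
  have nP : Pset m (dmul c (dmul a (eps d))) = false.
    by apply: contraNF P; apply: Pset_Gp; apply: midiso_Gp; apply: midiso_eps; apply: halfd_iso.
  by rewrite nP actvE scaler0 hom0 subrr mem0v.
rewrite actvE homZ -actvE (half_act HQ) //; last exact: liftL_specht.
case: ifP => _; last by rewrite !scaler0 subrr mem0v.
by rewrite !scalerA -!exprD E subrr mem0v.
Qed.

Lemma ind_inv_map v : v \in sV (ind x M) -> ind_inv (ind_map v) - v \in sW (ind x M).
Proof.
rewrite -[ind_inv _]comp_lfunE -[X in _ - X]id_lfunE; move: v; apply: ind_half_ind => a d s hd sS.
rewrite comp_lfunE id_lfunE ind_mapE -opprB rpredN.
have H := tens_reduce a hd sS; move: H; rewrite prodAE tensZl scalerA => H.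
case: ifP => [P|/negbT nP].
  by rewrite homZ ind_invE liftLK scalerA [X in X *: _]mulrC.
rewrite hom0 subr0; have := tens_kill (midiso_Gp a (midiso_eps (halfd_iso hd))) nP sS.
move=> /(rpredZ (x ^- (n - m) * x ^+ loops a (eps d)))/(rpredD H).
by rewrite subrK.
Qed.

Lemma ind_map_inv v : v \in sV Q -> ind_map (ind_inv v) - v \in sW Q.
Proof.
rewrite -[ind_map _]comp_lfunE -[X in _ - X]id_lfunE; move: v.
apply: (half_VindB HQ) => c s Pc sS; rewrite comp_lfunE id_lfunE ind_invE homZ ind_mapE.
have mc := Pset_midiso Pc.
rewrite Gp_eps_udiag // Pc ell_eps_udiag // scalerA mulVf // scale1r.
by have [_ ->] := restL_specht pl mn sS; rewrite subrr mem0v.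
Qed.

Lemma ind_inv_hom : ishom Q (ind x M) ind_inv.
Proof.
have restS s : s \in specht F n.+1 l -> restL F n s \in specht F n l.
  by move=> sS; have [] := restL_specht pl mn sS.
apply: ishomI.
- apply: (half_Vind HQ) => c s Pc sS; rewrite ind_invE rpredZ //; apply: ind_V.
  by apply: (half_V HM) => //; apply: restS.
- apply: (half_Wind HQ) => c s p Pc sS pm; have [p0 p0m pE] := Ssub_lperm mn pm.
  rewrite !ind_invE -scalerBr rpredZ // pE (restL_perm pl mn p0m sS).
  have sS' := restS s sS; set s' := restL F n s in sS' *.
  (* The permutation travels through the generator: c p (x) u (x) s = c (x) p u (x) s = c (x) u p
     (x) s = c (x) u (x) p s. *)
  have := ind_W2 x c (pdiag p0) (half_V HM hu sS'); rewrite (half_act HM) //.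
  rewrite /u Gp_pdiag_udiag; last by move=> i; apply: (SsubP _ _ p0m).
  rewrite halfd_pdiag // ell_pdiagl scale1r prodAE eps_pdiag ell_pdiag scale1r => H1.
  have := ind_W1 x c (half_W HM hu sS' p0m); rewrite tensBr => /(rpredD H1).
  by rewrite addrA subrK.
- move=> b v; rewrite !actvE -[ind_inv (actL _ _ _)]comp_lfunE -[X in _ - X]comp_lfunE.
  move: v; apply: (half_VindB HQ) => c s Pc sS; rewrite !comp_lfunE -!actvE.
  rewrite (half_act HQ) // ind_invE actvE homZ -actvE ind_act prodAE tensZl.
  have sS' := restS s sS.
  case: (boolP (Pset m (dmul b c))) => [P|nP].
    by rewrite homZ ind_invE !scalerA [X in X *: _ - _]mulrC subrr mem0v.
  rewrite hom0 sub0r rpredN scalerA rpredZ //; apply: tens_kill => //.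
  exact: midiso_Gp (Pset_midiso Pc).
Qed.

Lemma ind_half_iso : iso_data (ind x M) Q.
Proof.
exists ind_map, ind_inv; split; [exact: ind_map_hom|exact: ind_inv_hom|..].
- exact: ind_inv_map.
- exact: ind_map_inv.
Qed.

End IndHalf.

(** * The exact sequence *)

(** The splitting is one of vector spaces: r and k are linear maps compatible with the relations,
    with no condition on the action of diagrams. Exactness in the middle comes from decomposing v as
    (v - k (g v)) + k (g v). *)
Lemma short_exact_split (F : fieldType) n (X Y Z : finType) (M1 : smod F n X) (M2 : smod F n Y)
    (M3 : smod F n Z) (f : 'Hom(vec F X, vec F Y)) (g : 'Hom(vec F Y, vec F Z))
    (r : 'Hom(vec F Y, vec F X)) (k : 'Hom(vec F Z, vec F Y)) :
  ishom M1 M2 f -> ishom M2 M3 g ->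
  (forall v, v \in sW M2 -> r v \in sW M1) ->
  (forall v, v \in sV M1 -> r (f v) - v \in sW M1) ->
  (forall v, v \in sV M3 -> k v \in sV M2) ->
  (forall v, v \in sW M3 -> k v \in sW M2) ->
  (forall v, v \in sV M3 -> g (k v) - v \in sW M3) ->
  (forall v, v \in sV M1 -> g (f v) \in sW M3) ->
  (forall v, v \in sV M2 -> v - k (g v) \in (f @: sV M1 + sW M2)%VS) ->
  short_exact M1 M2 M3.
Proof.
move=> hf hg rW rf kV kW gk gf ex; exists f, g; split=> //.
- by move=> v v1 /rW H; have := rpredB H (rf v v1); rewrite opprB addrC subrK.
- apply/subvP=> v v3; apply/memv_addP; exists (g (k v)); first by rewrite memv_img ?kV.
  by exists (v - g (k v)); [rewrite -opprB rpredN gk|rewrite addrC subrK].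
- move=> v v2; split=> [gW|/memv_addP[_ /memv_imgP[u u1 ->] [w wW ->]]].
    rewrite -(subrK (k (g v)) v) rpredD ?ex //; apply: subvP (addvSr _ _) _ _; exact: kW.
  by rewrite linearD /= rpredD ?gf // (ishom_W hg).
Qed.

(** * Direct sums of the diagram modules *)

Section Dsum.
Variables (F : fieldType) (n : nat) (X : finType) (s : seq (smod F n X)).
Notation Ms k := (nth (smod0 F n X) s k).

Lemma injkE N (k : 'I_N) (v : vec F X) : injk k v = tens (delta F k) v.
Proof.
by apply/ffunP=> -[j p]; rewrite !ffunE /=; case: eqP => _; rewrite ?mul1r ?mul0r.
Qed.

Lemma dsum_V (k : 'I_(size s)) v : v \in sV (Ms k) -> tens (delta F k) v \in sV (dsum s).
Proof.
move=> vM; rewrite -tensLE; rewrite -(span_basis (vbasisP (sV (Ms k)))) in vM.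
apply: (span_mem _ vM) => w wb; rewrite tensLE -injkE; apply: memv_span.
by apply: allpairs_f_dep => //; rewrite mem_enum.
Qed.

Lemma dsum_W (k : 'I_(size s)) v : v \in sW (Ms k) -> tens (delta F k) v \in sW (dsum s).
Proof.
move=> vM; rewrite -tensLE; rewrite -(span_basis (vbasisP (sW (Ms k)))) in vM.
apply: (span_mem _ vM) => w wb; rewrite tensLE -injkE; apply: memv_span.
by apply: allpairs_f_dep => //; rewrite mem_enum.
Qed.

Lemma dsum_Vind (V : vectType F) (U : {vspace V}) (f : 'Hom(_, V)) :
  (forall (k : 'I_(size s)) v, v \in sV (Ms k) -> f (tens (delta F k) v) \in U) ->
  forall v, v \in sV (dsum s) -> f v \in U.
Proof.
move=> H v; apply: span_mem => _ /allpairsPdep[k [w [_ wb ->]]].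
by rewrite injkE H // vbasis_mem.
Qed.

Lemma dsum_Wind (V : vectType F) (U : {vspace V}) (f : 'Hom(_, V)) :
  (forall (k : 'I_(size s)) v, v \in sW (Ms k) -> f (tens (delta F k) v) \in U) ->
  forall v, v \in sW (dsum s) -> f v \in U.
Proof.
move=> H v; apply: span_mem => _ /allpairsPdep[k [w [_ wb ->]]].
by rewrite injkE H // vbasis_mem.
Qed.

Lemma dsum_act b (k : 'I_(size s)) v :
  actv (dsum s) b (tens (delta F k) v) = tens (delta F k) (actv (Ms k) b v).
Proof.
rewrite !actvE (tens_ext (g := (tensL _ (delta F k) \o actL (Ms k) b)%VF)).
  by rewrite comp_lfunE tensLE.
by move=> r; rewrite comp_lfunE !lext_delta tensLE -injkE.
Qed.

End Dsum.


Lemma sum_tens_single (F : fieldType) (K A : finType) (k : K) (v : vec F A) :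
  \sum_k' tens (delta F k') (if k == k' then v else 0) = tens (delta F k) v.
Proof.
rewrite (bigD1 k) //= eqxx big1 ?addr0 // => k' kk.
by rewrite eq_sym (negPf kk) tens0r.
Qed.

Section HalfSum.
Variables (F : fieldType) (x : F) (N : nat).

Record half_sum_spec (K : finType) (pt : K -> seq nat)
    (M : smod F N (K * (diag N * tabloid N))%type) : Prop := HalfSumSpec {
  half_sum_V : forall k d s, halfd (sumn (pt k)) d -> s \in specht F N (pt k) ->
    tens (delta F k) (tens (delta F d) s) \in sV M;
  half_sum_Vind : forall (V : vectType F) (U : {vspace V}) (f : 'Hom(_, V)),
    (forall k d s, halfd (sumn (pt k)) d -> s \in specht F N (pt k) ->
      f (tens (delta F k) (tens (delta F d) s)) \in U) ->
    forall v, v \in sV M -> f v \in U;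
  half_sum_W : forall k d s p, halfd (sumn (pt k)) d -> s \in specht F N (pt k) ->
    p \in Ssub N (sumn (pt k)) ->
    tens (delta F k) (tens (delta F (dmul d (pdiag p))) s) -
    tens (delta F k) (tens (delta F d) (permL F p s)) \in sW M;
  half_sum_Wind : forall (V : vectType F) (U : {vspace V}) (f : 'Hom(_, V)),
    (forall k d s p, halfd (sumn (pt k)) d -> s \in specht F N (pt k) ->
      p \in Ssub N (sumn (pt k)) ->
      f (tens (delta F k) (tens (delta F (dmul d (pdiag p))) s)) -
      f (tens (delta F k) (tens (delta F d) (permL F p s))) \in U) ->
    forall v, v \in sW M -> f v \in U;
  half_sum_act : forall b k d s, halfd (sumn (pt k)) d -> s \in specht F N (pt k) ->
    actv M b (tens (delta F k) (tens (delta F d) s)) =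
      if halfd (sumn (pt k)) (dmul b d)
      then x ^+ loops b d *: tens (delta F k) (tens (delta F (dmul b d)) s) else 0 }.

Lemma half_sum_VindB (K : finType) (pt : K -> seq nat) M : half_sum_spec pt M ->
  forall (V : vectType F) (U : {vspace V}) (f g : 'Hom(_, V)),
  (forall k d s, halfd (sumn (pt k)) d -> s \in specht F N (pt k) ->
     f (tens (delta F k) (tens (delta F d) s)) - g (tens (delta F k) (tens (delta F d) s)) \in U) ->
  forall v, v \in sV M -> f v - g v \in U.
Proof.
move=> HM V U f g H v vM; have E w : f w - g w = (f - g) w by rewrite add_lfunE opp_lfunE.
by rewrite E; move: v vM; apply: (half_sum_Vind HM) => k d s hd sS; rewrite -E H.
Qed.

Variable sa : seq (seq nat).
Notation K := 'I_(size [seq Mmod x N a | a <- sa]).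
Definition summand (k : K) : seq nat := nth [::] sa k.

Let summand_lt (k : K) : (k < size sa)%N.
Proof. by have := ltn_ord k; move: (nat_of_ord k) => i; rewrite size_map. Qed.

Lemma summand_enum : [seq summand k | k : K] = sa.
Proof.
by rewrite /image_mem /summand (map_comp (nth [::] sa) val) val_enum_ord size_map; apply: mkseq_nth.
Qed.

Hypotheses (x0 : x != 0) (saN : forall a, a \in sa -> (sumn a <= N)%N).

Lemma half_sumP : half_sum_spec summand (dsum [seq Mmod x N a | a <- sa]).
Proof.
have half (k : K) : half_spec x (halfd (sumn (summand k))) (summand k)
    (nth (smod0 F N _) [seq Mmod x N a | a <- sa] k).
  rewrite (nth_map [::]) ?summand_lt //; apply: (Mmod_half x0); rewrite saN //.
  exact/mem_nth/summand_lt.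
split.
- by move=> k d s hd sS; apply/dsum_V/(half_V (half k)).
- move=> V U f H; apply: dsum_Vind => k v vM; rewrite -tensLE -comp_lfunE; move: v vM.
  by apply: (half_Vind (half k)) => d s hd sS; rewrite comp_lfunE tensLE H.
- by move=> k d s p hd sS pm; rewrite -tensBr; apply/dsum_W/(half_W (half k)).
- move=> V U f H; apply: dsum_Wind => k v vM; rewrite -tensLE -comp_lfunE; move: v vM.
  apply: (half_Wind (half k)) => d s p hd sS pm.
  by rewrite comp_lfunE [X in _ - X]comp_lfunE !tensLE H.
- move=> b k d s hd sS; rewrite dsum_act (half_act (half k) _ hd sS).
  by case: ifP => _; rewrite ?tensZr ?tens0r.
Qed.

End HalfSum.

Opaque halfd Pset midiso iso_from pdiag permL specht join_arc cut_arc.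

Lemma loops_pdiag n (b c : diag n) (p : 'S_n) : loops b (dmul c (pdiag p)) = loops b c.
Proof. by have := ellA b c (pdiag p); rewrite !ell_pdiag addn0 add0n => ->. Qed.

Lemma midiso_last_swap n m (x0 : 'I_n.+1) (d : diag n.+1) : (m <= n)%N -> x0 = m :> nat ->
  iso_from m.+1 d -> midiso m (dmul d (pdiag (last_swap x0))).
Proof.
move=> mn x0m /iso_fromP di; apply/midisoP=> i mi.
have sx : last_swap x0 ord_max = x0 by apply: tpermR.
have [ix|ix] := eqVneq (lift ord_max i) x0.
  have := Gp_pdiag d (last_swap x0) (inr ord_max); rewrite di /= ?sx -?ix //.
  by rewrite (leq_ltn_trans mi).
have E : last_swap x0 (lift ord_max i) = lift ord_max i.
  by apply: tpermD; rewrite ?neq_lift // eq_sym.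
have := Gp_pdiag d (last_swap x0) (inr (lift ord_max i)); rewrite di /= ?E //.
rewrite -[bump n i]/(nat_of_ord (lift ord_max i)) lift_max ltn_neqAle mi andbT -x0m.
by apply: contraNneq ix => xi; apply/eqP/val_inj; rewrite [LHS]lift_max.
Qed.

Lemma scale_sum2B_mem (F : fieldType) (V : vectType F) (W : {vspace V}) (I J : finType)
    (P : pred J) (A B : I -> J -> V) a z :
  z = a *: \sum_i \sum_(j | P j) B i j -> (forall i j, P j -> A i j - B i j \in W) ->
  a *: \sum_i \sum_(j | P j) A i j - z \in W.
Proof.
move=> -> H; rewrite -scalerBr rpredZ // -sumrB rpred_sum // => i _.
by rewrite -sumrB rpred_sum // => j; apply: H.
Qed.

Section EnumIn.
Variables (T : eqType) (K : finType) (pt : K -> T) (s : seq T).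
Hypothesis ptE : [seq pt k | k : K] = s.

Lemma enum_in_mem k : pt k \in s.
Proof. by rewrite -ptE; apply: codom_f. Qed.

Lemma enum_in_sum (V : nmodType) (G : T -> V) : \sum_k G (pt k) = \sum_(a <- s) G a.
Proof. by rewrite -ptE big_image. Qed.

Lemma enum_in_eq k k' : uniq s -> (pt k == pt k') = (k == k').
Proof. by rewrite -ptE => /injectiveP/inj_eq. Qed.

Lemma enum_in_ex a : a \in s -> exists k, pt k = a.
Proof. by rewrite -ptE => /codomP[k ->]; exists k. Qed.
End EnumIn.

(** * The quotient with m + 1 vertical arcs *)

Section UpMaps.
Variables (F : fieldType) (x : F) (n : nat) (l : seq nat) (sb : seq (seq nat)).
Notation m := (sumn l).
Notation N := n.+1.
Notation E := (vec F (tabloid N)).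
Notation Sp a := (specht F N a).
Notation T c s := (tens (delta F (c : diag N)) s).
Variable Q : smod F N (diag N * tabloid N)%type.
Hypotheses (mn : (m <= n)%N) (HQ : half_spec x (@Pset n m) l Q).
Variables (x0 : 'I_N) (lft dwn : seq nat -> 'End(E)) (c : seq nat -> F).
Hypotheses (x0m : x0 = m :> nat) (sbE : forall b, (b \in sb) = sqsubset l b) (usb : uniq sb).
Hypothesis bp : forall b, b \in sb -> branch_pair l b (lft b) (dwn b) /\ c b != 0.
Hypothesis cos : forall b b', b \in sb -> b' \in sb -> forall v, v \in Sp b ->
  cosum m x0 (lft b' \o dwn b)%VF v = if b == b' then c b *: v else 0.
Hypothesis complete : forall (q : 'I_N), (q <= m)%N -> forall v, v \in Sp l ->
  \sum_(b <- sb) (c b)^-1 *: dwn b (permL F (tau x0 q) (lft b v)) = if q == x0 then v else 0.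

Variables (K : finType) (pt : K -> seq nat) (M3 : smod F N (K * (diag N * tabloid N))%type).
Hypotheses (ptE : [seq pt k | k : K] = sb) (HM3 : half_sum_spec x pt M3).
Notation gen k d s := (tens (delta F (k : K)) (T d s)).
Notation ls := (last_swap x0).
Notation sw d := (dmul (d : diag N) (pdiag ls)).

Let sumb b : b \in sb -> sumn b = m.+1.
Proof. by rewrite sbE => /sqsubset_sumn. Qed.

Let swK (d : diag N) : sw (sw d) = d.
Proof. by rewrite Gp_pdiagM last_swap2 Gp_pdiag1. Qed.

Let halfd_iso k (d : diag N) : halfd k d -> iso_from k d. Proof. by case/halfdP. Qed.

Let Pset_sw (d : diag N) : halfd m.+1 d -> Pset m (sw d).
Proof.
move=> hd; have mid := midiso_last_swap mn x0m (halfd_iso hd).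
by have := halfd_last_swap mn x0m mid; rewrite swK hd => /esym/andP[].
Qed.

(** A half diagram with m + 1 vertical arcs tensored with S^l over S_m is the same as one tensored
    over S_(m+1) with the induced module; the maps [lft] yield its components in the summands
    S^b. *)
Definition upg : 'Hom(vec F (diag N * tabloid N)%type, vec F (K * (diag N * tabloid N))%type) :=
  bmap (fun d => if halfd m.+1 (sw d) then
    \sum_(k : K) (tensL _ (delta F k) \o (tensL _ (delta F (sw d)) \o lft (pt k)))%VF else 0).

Lemma upgE d s : upg (T d s) =
  if halfd m.+1 (sw d) then \sum_(k : K) gen k (sw d) (lft (pt k) s) else 0.
Proof.
rewrite /upg bmapE; case: ifP => _; last by rewrite zero_lfunE.
by rewrite sum_lfunE; apply: eq_bigr => k _; rewrite comp3_lfunE !tensLE.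
Qed.

(** The sum over the cosets of S_m makes this section compatible with the relations for all of
    S_(m+1), although [dwn] commutes only with S_m. *)
Definition upk : 'Hom(vec F (K * (diag N * tabloid N))%type, vec F (diag N * tabloid N)%type) :=
  bmap (fun k => bmap (fun d => (c (pt k))^-1 *:
    \sum_(q : 'I_N | (q <= m)%N) (tensL _ (delta F (sw (dmul d (pdiag (tau x0 q))))) \o
       (dwn (pt k) \o permL F (tau x0 q)))%VF)).

Lemma upkE (k : K) d s : upk (gen k d s) = (c (pt k))^-1 *:
  \sum_(q : 'I_N | (q <= m)%N)
    T (sw (dmul d (pdiag (tau x0 q)))) (dwn (pt k) (permL F (tau x0 q) s)).
Proof.
rewrite /upk !bmapE scale_lfunE sum_lfunE; congr (_ *: _); apply: eq_bigr => q _.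
by rewrite comp3_lfunE tensLE.
Qed.

Let bpk (k : K) : branch_pair l (pt k) (lft (pt k)) (dwn (pt k)) /\ c (pt k) != 0.
Proof. exact/bp/(enum_in_mem ptE). Qed.

Let lftS (k : K) s : s \in Sp l -> lft (pt k) s \in Sp (pt k).
Proof. by have [[_ _ H _ _] _] := bpk k; apply: H. Qed.

Let dwnS (k : K) s : s \in Sp (pt k) -> dwn (pt k) s \in Sp l.
Proof. by have [[_ _ _ H _] _] := bpk k; apply: H. Qed.

Let sumk (k : K) : sumn (pt k) = m.+1. Proof. exact/sumb/(enum_in_mem ptE). Qed.

Let tauS (k : K) (q : 'I_N) s : (q <= m)%N -> s \in Sp (pt k) -> permL F (tau x0 q) s \in Sp (pt k).
Proof. by move=> qm; apply: specht_stable; rewrite sumk tau_Ssub. Qed.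

Let halfd_tau (q : 'I_N) (d : diag N) : (q <= m)%N -> halfd m.+1 d ->
  halfd m.+1 (dmul d (pdiag (tau x0 q))).
Proof. by move=> qm; apply: halfd_pdiag; rewrite ?tau_Ssub. Qed.

Let act_gen k b (d : diag N) s : halfd m.+1 (sw d) -> s \in Sp l ->
  actL M3 b (gen k (sw d) (lft (pt k) s)) = if halfd m.+1 (dmul b (sw d)) then
    x ^+ loops b d *: gen k (dmul b (sw d)) (lft (pt k) s) else 0.
Proof.
move=> hd sS; rewrite -actvE (half_sum_act HM3); rewrite ?sumk ?loops_pdiag //; exact: lftS.
Qed.

Lemma upg_hom : ishom Q M3 upg.
Proof.
apply: ishomI.
- apply: (half_Vind HQ) => d s Pd sS; rewrite upgE; case: ifP => hd; last exact: mem0v.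
  by apply: rpred_sum => k _; apply: (half_sum_V HM3); rewrite ?sumk ?lftS.
- apply: (half_Wind HQ) => d s p Pd sS pm; rewrite !upgE.
  have -> : sw (dmul d (pdiag p)) = dmul (sw d) (pdiag p).
    by rewrite !Gp_pdiagM (last_swapC mn x0m pm).
  have pm1 : p \in Ssub N m.+1 by apply: Ssub_sub pm.
  have iso := iso_last_swap x0m (Pset_midiso Pd).
  have -> : halfd m.+1 (dmul (sw d) (pdiag p)) = halfd m.+1 (sw d).
    have E1 := halfd_nvert (mn : (m.+1 <= N)%N) (iso_pdiag pm1 iso).
    by rewrite E1 (nvert_pdiag (sw d)) -halfd_nvert.
  case: ifP => hd; last by rewrite subrr mem0v.
  rewrite -sumrB; apply: rpred_sum => k _; have [[e1 _ _ _ _] _] := bpk k.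
  rewrite e1 //; apply: (half_sum_W HM3); rewrite ?sumk //; exact: lftS.
- move=> b v; rewrite !actvE -[upg (actL _ _ _)]comp_lfunE -[X in _ - X]comp_lfunE.
  move: v; apply: (half_VindB HQ) => d s Pd sS; rewrite comp_lfunE [X in _ - X]comp_lfunE.
  rewrite -!actvE (half_act HQ _ Pd sS).
  have mid := Pset_midiso Pd; have midb := midiso_Gp b mid.
  have hb := halfd_last_swap mn x0m midb; have swb : sw (dmul b d) = dmul b (sw d) by exact: GpA.
  have U : upg (T (dmul b d) s) = if halfd m.+1 (dmul b (sw d)) then
      \sum_k gen k (dmul b (sw d)) (lft (pt k) s) else 0 by rewrite upgE swb.
  have actU : actv M3 b (upg (T d s)) = x ^+ loops b d *: upg (T (dmul b d) s).
    rewrite U actvE; have := upgE d s; case: (boolP (halfd m.+1 (sw d))) => [hd|nd] ->.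
      rewrite hom_sum (eq_bigr _ (fun k _ => act_gen k b hd sS)).
      by case: ifP => _; [rewrite scaler_sumr|rewrite big1 ?scaler0].
    case: ifP => [hb'|_]; last by rewrite linear0 scaler0.
    by have := halfd_Gp (iso_last_swap x0m mid) hb'; rewrite (negPf nd).
  rewrite {}actU; case: ifP hb => [_ _|_]; first by rewrite linearZ subrr mem0v.
  by rewrite swb U => ->; rewrite linear0 scaler0 subrr mem0v.
Qed.

Lemma upk_V v : v \in sV M3 -> upk v \in sV Q.
Proof.
move: v; apply: (half_sum_Vind HM3) => k d s; rewrite sumk => hd sS.
rewrite upkE rpredZ // rpred_sum // => q qm; apply: (half_V HQ).
  exact/Pset_sw/halfd_tau.
exact/dwnS/tauS.
Qed.

Lemma upk_W v : v \in sW M3 -> upk v \in sW Q.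
Proof.
move: v; apply: (half_sum_Wind HM3) => k d s p; rewrite sumk => hd sS pm.
rewrite !upkE -scalerBr rpredZ // (reindex_inj (@perm_inj _ p)) /=.
rewrite (eq_bigl (fun q : 'I_N => (q <= m)%N)) => [|q]; last first.
  by rewrite -[(p q <= m)%N]ltnS (Ssub_lt _ pm).
(* p permutes the cosets: after reindexing, corresponding terms differ by r in S_m, which is a
   relation of Q. *)
rewrite -sumrB; apply: rpred_sum => q qm; have rm := tau_coset x0m qm pm.
set r := (tau x0 q * p * tau x0 (p q))%g in rm.
have E1 : (p * tau x0 (p q))%g = (tau x0 q * r)%g by rewrite /r !mulgA tau2 mul1g.
have E2 : (tau x0 q * p)%g = (r * tau x0 (p q))%g by rewrite /r -mulgA tau2 mulg1.
clearbody r; have pqm : (p q <= m)%N by rewrite -ltnS (Ssub_lt _ pm).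
have [[_ e2 _ _ _] _] := bpk k.
have -> : sw (dmul (dmul d (pdiag p)) (pdiag (tau x0 (p q)))) =
    dmul (sw (dmul d (pdiag (tau x0 q)))) (pdiag r).
  by rewrite !Gp_pdiagM !mulgA E1 -!mulgA (last_swapC mn x0m rm).
have -> : permL F (tau x0 q) (permL F p s) = permL F r (permL F (tau x0 (p q)) s).
  by rewrite !permLM E2.
rewrite (e2 r rm); apply: (half_W HQ) => //; first exact/Pset_sw/halfd_tau.
exact/dwnS/tauS.
Qed.

Let upg_upk_gen k d s : halfd m.+1 d ->
  upg (upk (gen k d s)) = (c (pt k))^-1 *: \sum_k' \sum_(q : 'I_N | (q <= m)%N)
    gen k' (dmul d (pdiag (tau x0 q))) (lft (pt k') (dwn (pt k) (permL F (tau x0 q) s))).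
Proof.
move=> hd; rewrite upkE homZ hom_sum exchange_big; congr (_ *: _).
by apply: eq_bigr => q qm; rewrite upgE swK halfd_tau.
Qed.

Let gen_cosum k d s : s \in Sp (pt k) ->
  gen k d s = (c (pt k))^-1 *: \sum_k' \sum_(q : 'I_N | (q <= m)%N)
    gen k' d (permL F (tau x0 q) (lft (pt k') (dwn (pt k) (permL F (tau x0 q) s)))).
Proof.
move=> sS; have cosk (k' : K) : \sum_(q : 'I_N | (q <= m)%N)
    gen k' d (permL F (tau x0 q) (lft (pt k') (dwn (pt k) (permL F (tau x0 q) s)))) =
    gen k' d (if k == k' then c (pt k) *: s else 0).
  rewrite -(enum_in_eq ptE k k' usb) -(cos (enum_in_mem ptE k) (enum_in_mem ptE k') sS) cosumE.
  by rewrite !tens_sumr; apply: eq_bigr => q _; rewrite comp_lfunE.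
rewrite (eq_bigr _ (fun k' _ => cosk k')).
have -> : \sum_k' gen k' d (if k == k' then c (pt k) *: s else 0) =
    \sum_k' tens (delta F k') (if k == k' then T d (c (pt k) *: s) else 0).
  by apply: eq_bigr => k' _; case: (k == k'); rewrite ?tens0r.
rewrite sum_tens_single !tensZr scalerA mulVf ?scale1r //.
by have [] := bpk k.
Qed.

(** The relations over S_(m+1) move each [tau q] from the diagram to the tabloid. What appears is
    the relative trace of [lft] after [dwn]: the scalar c on the given summand and 0 on the
    others. *)
Lemma upg_upk v : v \in sV M3 -> upg (upk v) - v \in sW M3.
Proof.
rewrite -[upg _]comp_lfunE -[X in _ - X]id_lfunE; move: v.
apply: (half_sum_VindB HM3) => k d s; rewrite sumk => hd sS.
rewrite comp_lfunE id_lfunE upg_upk_gen //.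
apply: (scale_sum2B_mem (gen_cosum d sS)) => k' q qm.
apply: (half_sum_W HM3); rewrite ?sumk ?tau_Ssub //.
by apply/lftS/dwnS/tauS.
Qed.

Lemma upg_kill d s : Pset m d -> ~~ isl (val d (inr ord_max)) -> upg (T d s) = 0.
Proof.
move=> Pd nd; rewrite upgE (halfd_last_swap mn x0m (Pset_midiso Pd)).
by rewrite (negPf nd) andbF.
Qed.

(** By the completeness relation only the term q = x0 survives. There [tau] is the identity and the
    two swaps cancel, so equality holds without passing to the quotient. *)
Lemma upk_upg d s : Pset m d -> isl (val d (inr ord_max)) -> s \in Sp l ->
  upk (upg (T d s)) = T d s.
Proof.
move=> Pd dl sS; rewrite upgE (halfd_last_swap mn x0m (Pset_midiso Pd)) Pd dl /=.
rewrite hom_sum (eq_bigr _ (fun k _ => upkE k _ _)).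
rewrite (eq_bigr (fun k : K => \sum_(q : 'I_N | (q <= m)%N)
  T (sw (dmul (sw d) (pdiag (tau x0 q))))
    ((c (pt k))^-1 *: dwn (pt k) (permL F (tau x0 q) (lft (pt k) s))))); last first.
  by move=> k _; rewrite scaler_sumr; apply: eq_bigr => q _; rewrite tensZr.
rewrite exchange_big /= (bigD1 x0) ?x0m //= [X in _ + X]big1 => [|q /andP[qm qx]].
  rewrite -tens_sumr (enum_in_sum ptE (fun b => (c b)^-1 *: dwn b (permL F (tau x0 x0) (lft b s)))).
  by rewrite complete ?x0m // eqxx addr0 /tau tperm1 Gp_pdiag1 swK.
rewrite -tens_sumr (enum_in_sum ptE (fun b => (c b)^-1 *: dwn b (permL F (tau x0 q) (lft b s)))).
by rewrite complete // (negPf qx) tens0r.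
Qed.

End UpMaps.

(** * The submodule where the free bottom vertex is not joined to the top *)

Section DownMaps.
Variables (F : fieldType) (x : F) (n : nat) (l : seq nat) (sa : seq (seq nat)).
Notation m := (sumn l).
Notation N := n.+1.
Notation mx := (@ord_max n).
Notation E := (vec F (tabloid N)).
Notation Sp a := (specht F N a).
Notation T c s := (tens (delta F (c : diag N)) s).
Variable Q : smod F N (diag N * tabloid N)%type.
Hypotheses (mn : (m <= n)%N) (HQ : half_spec x (@Pset n m) l Q).
Hypotheses (saE : forall a, (a \in sa) = sqsubseteq a l) (usa : uniq sa).
(* For m = 0 the only a is l, and i0, arcd and unarcd are irrelevant. *)
Variables (i0 : 'I_N) (arcd unarcd : diag N -> diag N) (inc prj : seq nat -> 'End(E)).
Hypothesis arcP : (0 < m)%N -> exists j0 : 'I_n,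
  [/\ m = j0.+1, i0 = lift mx j0, arcd = join_arc j0 & unarcd = cut_arc j0].
Hypothesis bp : forall a, a \in sa -> a != l -> branch_pair a l (inc a) (prj a).
Hypothesis ortho : forall a a', a \in sa -> a' \in sa -> a != l -> a' != l ->
  forall v, v \in Sp a -> prj a' (inc a v) = if a == a' then v else 0.
Hypothesis complete : (0 < m)%N ->
  {in Sp l, forall v, \sum_(a <- sa | a != l) inc a (prj a v) = v}.

Variables (K : finType) (pt : K -> seq nat) (M1 : smod F N (K * (diag N * tabloid N))%type).
Hypotheses (ptE : [seq pt k | k : K] = sa) (HM1 : half_sum_spec x pt M1).
Notation gen k d s := (tens (delta F (k : K)) (T d s)).

Let sum_pt k : pt k != l -> (sumn (pt k)).+1 = m.
Proof.
have := enum_in_mem ptE k; rewrite saE => /orP[/sqsubset_sumn -> //|/eqP->].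
by rewrite eqxx.
Qed.

Lemma pt_cases k : pt k = l \/ pt k != l /\ exists j0 : 'I_n,
  [/\ m = j0.+1, sumn (pt k) = j0, i0 = lift mx j0, arcd = join_arc j0 & unarcd = cut_arc j0].
Proof.
have [->|kl] := eqVneq (pt k) l; [by left|right; split=> //].
have sk := sum_pt kl; have [j0 [mj ij aj uj]] := arcP (ltac:(by rewrite -sk)).
by exists j0; split=> //; apply: succn_inj; rewrite sk.
Qed.

Let bpk k : pt k != l -> branch_pair (pt k) l (inc (pt k)) (prj (pt k)).
Proof. exact/bp/(enum_in_mem ptE). Qed.

Let incS k s : pt k != l -> s \in Sp (pt k) -> inc (pt k) s \in Sp l.
Proof. by move=> kl; have [_ _ H _ _] := bpk kl; apply: H. Qed.

Let prjS k s : pt k != l -> s \in Sp l -> prj (pt k) s \in Sp (pt k).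
Proof. by move=> kl; have [_ _ _ H _] := bpk kl; apply: H. Qed.

Definition downf : 'Hom(vec F (K * (diag N * tabloid N))%type, vec F (diag N * tabloid N)%type) :=
  bmap (fun k => bmap (fun d => if pt k == l then tensL _ (delta F d)
    else (tensL _ (delta F (arcd d)) \o inc (pt k))%VF)).

Lemma downfE k d s : downf (gen k d s) = if pt k == l then T d s else T (arcd d) (inc (pt k) s).
Proof. by rewrite /downf !bmapE; case: ifP => _; rewrite ?comp_lfunE tensLE. Qed.

Lemma downf_hom : ishom M1 Q downf.
Proof.
apply: ishomI.
- apply: (half_sum_Vind HM1) => k d s; rewrite downfE.
  have [->|[kl [j0 [mj sk _ aj _]]]] := pt_cases k => hd sS.
    rewrite eqxx; apply: (half_V HQ) => //; have [di _] := halfdP _ _ hd.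
    by rewrite Pset_iso.
  rewrite (negPf kl) aj; rewrite sk in hd; have [di _] := halfdP _ _ hd.
  by apply: (half_V HQ); [rewrite Pset_arc|apply: incS].
- apply: (half_sum_Wind HM1) => k d s p; rewrite !downfE.
  have [->|[kl [j0 [mj sk _ aj _]]]] := pt_cases k => hd sS pm.
    rewrite eqxx; apply: (half_W HQ) => //; have [di _] := halfdP _ _ hd.
    by rewrite Pset_iso.
  have [e1 _ _ _ _] := bpk kl; rewrite (negPf kl) aj (e1 _ pm).
  rewrite sk in hd pm; have [di _] := halfdP _ _ hd; rewrite (arc_pdiag di pm).
  apply: (half_W HQ); [by rewrite Pset_arc|exact: incS|].
  by apply: Ssub_sub pm; rewrite mj.
- move=> b v; rewrite !actvE -[downf (actL _ _ _)]comp_lfunE -[X in _ - X]comp_lfunE.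
  move: v; apply: (half_sum_VindB HM1) => k d s hd sS; rewrite comp_lfunE [X in _ - X]comp_lfunE.
  rewrite -!actvE (half_sum_act HM1 _ hd sS) downfE.
  have [kl|[kl [j0 [mj sk _ aj _]]]] := pt_cases k.
    rewrite kl in hd sS *; have [di _] := halfdP _ _ hd.
    rewrite eqxx (half_act HQ) ?Pset_iso ?iso_Gp //.
    by case: ifP => _; rewrite ?homZ ?downfE ?kl ?eqxx ?hom0 subrr mem0v.
  have iS := incS kl sS; rewrite sk in hd *; have [di _] := halfdP _ _ hd.
  have Pa : Pset m (join_arc j0 d) by rewrite Pset_arc.
  rewrite (negPf kl) aj (half_act HQ _ Pa iS).
  have [-> ->] := dmul_arc b di; rewrite Pset_arc ?iso_Gp //.
  by case: ifP => _; rewrite ?homZ ?downfE ?(negPf kl) ?aj ?hom0 subrr mem0v.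
Qed.

(** [tau i0 q] carries the far end q of the arc at n to its standard position. Another permutation
    doing the same would differ by an element fixing both ends, which the tensor product over
    S_(m-1) absorbs. *)
Definition cut_term k (c : diag N) : 'Hom(E, vec F (diag N * tabloid N)%type) :=
  if pt k == l then if val c (inr mx) == inr mx then tensL _ (delta F c) else 0
  else if val c (inr mx) is inr q then
    if q != mx then
      (tensL _ (delta F (unarcd (dmul c (pdiag (tau i0 q))))) \o
        (prj (pt k) \o permL F (tau i0 q)))%VF
    else 0
  else 0.

Definition downr : 'Hom(vec F (diag N * tabloid N)%type, vec F (K * (diag N * tabloid N))%type) :=
  bmap (fun c => \sum_k (tensL _ (delta F k) \o cut_term k c)%VF).

Lemma downrE c s : downr (T c s) = \sum_k tens (delta F k) (cut_term k c s).
Proof. by rewrite /downr bmapE sum_lfunE; apply: eq_bigr => k _; rewrite comp_lfunE tensLE. Qed.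

Lemma cut_term_same k c s : pt k = l ->
  cut_term k c s = if val c (inr mx) == inr mx then T c s else 0.
Proof. by rewrite /cut_term => ->; rewrite eqxx; case: ifP => _; rewrite ?tensLE ?zero_lfunE. Qed.

Lemma cut_term_bottom k (c : diag N) q s : pt k != l -> val c (inr mx) = inr q ->
  cut_term k c s = if q != mx then
    T (unarcd (dmul c (pdiag (tau i0 q)))) (prj (pt k) (permL F (tau i0 q) s)) else 0.
Proof.
rewrite /cut_term => /negPf-> ->.
by case: ifP => _; rewrite ?zero_lfunE // comp3_lfunE tensLE.
Qed.

Lemma cut_term_top k (c : diag N) q s : pt k != l -> val c (inr mx) = inl q -> cut_term k c s = 0.
Proof. by rewrite /cut_term => /negPf-> ->; rewrite zero_lfunE. Qed.

Lemma downr_downf v : v \in sV M1 -> downr (downf v) - v \in sW M1.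
Proof.
rewrite -[downr _]comp_lfunE -[X in _ - X]id_lfunE; move: v.
apply: (half_sum_VindB HM1) => k d s hd sS; rewrite comp_lfunE id_lfunE downfE.
suff -> : downr (if pt k == l then T d s else T (arcd d) (inc (pt k) s)) = gen k d s.
  by rewrite subrr mem0v.
have cut c' s' : (forall k', cut_term k' c' s' = if pt k == pt k' then T d s else 0) ->
    downr (T c' s') = gen k d s.
  move=> H; rewrite downrE -sum_tens_single; apply: eq_bigr => k' _.
  by rewrite H (enum_in_eq ptE k k' usa).
have [kl|[kl [j0 [mj sk ij aj uj]]]] := pt_cases k.
  have [di _] := halfdP _ _ hd; rewrite kl in di *; have dm := halfd_max mn di.
  rewrite eqxx; apply: cut => k'; rewrite kl.
  have [k'l|k'l] := eqVneq (pt k') l; first by rewrite cut_term_same // dm eqxx.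
  by rewrite (cut_term_bottom s k'l dm) eqxx.
rewrite sk in hd; have [di _] := halfdP _ _ hd.
have jm : lift mx j0 != mx by rewrite eq_sym neq_lift.
have t1 : tau i0 (lift mx j0) = 1%g by rewrite -ij; apply: tperm1.
have am := arc_max j0 d; rewrite (negPf kl) aj; apply: cut => k'.
have [k'l|k'l] := eqVneq (pt k') l.
  by rewrite cut_term_same // am inr_lift_max k'l (negPf kl).
rewrite (cut_term_bottom _ k'l am) jm t1 Gp_pdiag1 permL1 uj (unarc_arc di).
rewrite ortho ?(enum_in_mem ptE) //.
by case: ifP => _; rewrite ?tens0r.
Qed.

Let tau_arc (j0 q : 'I_n.+1) (c : diag n.+1) : val c (inr mx) = inr q -> q != mx -> j0 != mx ->
  val (dmul c (pdiag (tau j0 q))) (inr mx) = inr j0.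
Proof.
move=> cq qm jm; rewrite dmul_max; last by rewrite /tau tpermD.
by rewrite cq /= /tau tpermL.
Qed.

Lemma downr_W v : v \in sW Q -> downr v \in sW M1.
Proof.
move: v; apply: (half_Wind HQ) => c s p Pc sS pm; rewrite !downrE -sumrB.
have pmx : p mx = mx by apply: (SsubP _ _ pm).
have cp := dmul_max c pmx; apply: rpred_sum => k _.
have cutE A B : cut_term k (dmul c (pdiag p)) s = A -> cut_term k c (permL F p s) = B ->
    tens (delta F k) A - tens (delta F k) B \in sW M1 ->
    tens (delta F k) (cut_term k (dmul c (pdiag p)) s) -
    tens (delta F k) (cut_term k c (permL F p s)) \in sW M1 by move=> <- <-.
have [kl|[kl [j0 [mj sk ij aj uj]]]] := pt_cases k.
  have E : (rl p (val c (inr mx)) == inr mx) = (val c (inr mx) == inr mx).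
    by rewrite -{2}pmx -[inr (p mx)]/(rl p (inr mx)) (can_eq (rlK p)).
  apply: (cutE _ _ (cut_term_same _ _ kl) (cut_term_same _ _ kl)).
  rewrite cp E; case: eqP => cm; last by rewrite !tens0r subrr mem0v.
  by apply: (half_sum_W HM1); rewrite ?kl //; apply: Pset_max_iso.
case cq : (val c (inr mx)) => [q|q]; rewrite cq in cp.
  apply: (cutE _ _ (cut_term_top _ kl cp) (cut_term_top _ kl cq)).
  by rewrite tens0r subrr mem0v.
apply: (cutE _ _ (cut_term_bottom _ kl cp) (cut_term_bottom _ kl cq)).
have -> : (p q != mx) = (q != mx) by rewrite -{1}pmx (inj_eq (@perm_inj _ p)).
have [->|qmx] := eqVneq q mx; first by rewrite /= tens0r subrr mem0v.
rewrite /=; have [qm _] := Pset_max_cases Pc cq qmx.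
have i0j : i0 = j0 :> nat by rewrite ij lift_max.
have qj : (q <= j0)%N by rewrite -ltnS -mj.
have pj : p \in Ssub N j0.+1 by rewrite -mj.
(* Relabelling by p moves the end of the arc from q to p q; the discrepancy r between the two
   normalizations lies in S_(m-1). *)
have rm := tau_coset i0j qj pj; set r := (tau i0 q * p * tau i0 (p q))%g in rm.
have E1 : (p * tau i0 (p q))%g = (tau i0 q * r)%g by rewrite /r !mulgA tau2 mul1g.
have E2 : (tau i0 q * p)%g = (r * tau i0 (p q))%g by rewrite /r -mulgA tau2 mulg1.
clearbody r; have tq : tau i0 q \in Ssub N m by rewrite mj; apply: tau_Ssub.
have tpq : tau i0 (p q) \in Ssub N m.
  by rewrite mj; apply: tau_Ssub => //; rewrite -ltnS (Ssub_lt _ pj).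
have Pt : Pset m (dmul c (pdiag (tau i0 q))) by rewrite Pset_pdiag.
have i0m : i0 != mx by rewrite ij eq_sym neq_lift.
have ct := tau_arc cq qmx i0m; rewrite {2}ij in ct.
have [_ e2 _ _ _] := bpk kl.
have -> : unarcd (dmul (dmul c (pdiag p)) (pdiag (tau i0 (p q)))) =
    dmul (unarcd (dmul c (pdiag (tau i0 q)))) (pdiag r).
  by rewrite !Gp_pdiagM E1 -Gp_pdiagM uj (unarc_pdiag mj Pt ct rm).
have -> : permL F (tau i0 q) (permL F p s) = permL F r (permL F (tau i0 (p q)) s).
  by rewrite !permLM E2.
rewrite -sk in rm; rewrite (e2 r rm); apply: (half_sum_W HM1) => //.
  by rewrite sk uj; apply: (halfd_unarc mj Pt ct).
apply: prjS => //; exact: specht_stable.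
Qed.

(** If n is joined to q < m, a relation of Q moves q to the position m - 1. Then [complete] splits s
    into its components for S_(m-1), and each comes from a half diagram by restoring the arc. *)
Lemma down_exact c s : Pset m c -> s \in Sp l -> ~~ isl (val c (inr mx)) ->
  T c s \in (downf @: sV M1 + sW Q)%VS.
Proof.
move=> Pc sS; case cq : (val c (inr mx)) => [q|q] // _.
have [qmx|qmx] := eqVneq q mx.
  rewrite qmx in cq; have /(enum_in_ex ptE)[k kl] : l \in sa by rewrite saE /sqsubseteq eqxx orbT.
  have -> : T c s = downf (gen k c s) by rewrite downfE kl eqxx.
  apply: subvP (addvSl _ _) _ _; apply: memv_img; apply: (half_sum_V HM1); rewrite kl //.
  exact: Pset_max_iso.
have [qm _] := Pset_max_cases Pc cq qmx.
have [j0 [mj ij aj uj]] := arcP (leq_ltn_trans (leq0n _) qm).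
have i0j : i0 = j0 :> nat by rewrite ij lift_max.
have qj : (q <= j0)%N by rewrite -ltnS -mj.
have tq : tau i0 q \in Ssub N m by rewrite mj; apply: tau_Ssub.
have Pt : Pset m (dmul c (pdiag (tau i0 q))) by rewrite Pset_pdiag.
have i0m : i0 != mx by rewrite ij eq_sym neq_lift.
have ct := tau_arc cq qmx i0m; rewrite {2}ij in ct.
have := half_W HQ Pt sS tq; rewrite Gp_pdiagM tau2 Gp_pdiag1 => H.
rewrite -[T c s](subrK (T (dmul c (pdiag (tau i0 q))) (permL F (tau i0 q) s))).
apply: rpredD; first by apply: subvP (addvSr _ _) _ H.
apply: subvP (addvSl _ _) _ _.
have s'S : permL F (tau i0 q) s \in Sp l by apply: specht_stable.
set c' := dmul c _ in Pt ct *; set s' := permL F _ s in s'S *; clearbody c' s'.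
rewrite -(complete _ s'S) ?mj // big_mkcond /=.
rewrite -(enum_in_sum ptE (fun a => if a != l then inc a (prj a s') else 0)) tens_sumr.
apply: rpred_sum => k _; case: ifPn => [kl|_]; last by rewrite tens0r mem0v.
have -> : T c' (inc (pt k) (prj (pt k) s')) = downf (gen k (unarcd c') (prj (pt k) s')).
  by rewrite downfE (negPf kl) aj uj (arc_unarc ct).
apply: memv_img; apply: (half_sum_V HM1); last exact: prjS.
have -> : sumn (pt k) = j0 by apply: succn_inj; rewrite sum_pt.
by rewrite uj; apply: (halfd_unarc mj Pt ct).
Qed.

End DownMaps.

(** * Assembling the exact sequence *)

Section ExactSequence.
Variables (F : fieldType) (x : F) (n : nat) (l : seq nat) (sa sb : seq (seq nat)).
Notation m := (sumn l).
Notation N := n.+1.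
Notation E := (vec F (tabloid N)).
Notation Sp a := (specht F N a).
Hypothesis charF : [pchar F] =i pred0.
Hypotheses (pl : ispart l) (mn : (m <= n)%N).
Hypotheses (usa : uniq sa) (saE : forall a, (a \in sa) = sqsubseteq a l).
Hypotheses (usb : uniq sb) (sbE : forall b, (b \in sb) = sqsubset l b).

Lemma specht_res_proper : exists inc prj : seq nat -> 'End(E),
  [/\ forall a, a \in sa -> a != l -> branch_pair a l (inc a) (prj a),
      forall a a', a \in sa -> a' \in sa -> a != l -> a' != l ->
        forall v, v \in Sp a -> prj a' (inc a v) = if a == a' then v else 0 &
      (0 < m)%N -> {in Sp l, forall v, \sum_(a <- sa | a != l) inc a (prj a v) = v}].
Proof.
(* The summand a = l comes from an isolated bottom vertex n and has no part in the restriction of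
   S^l. *)
pose sa' := [seq a <- sa | a != l].
have saE' a : (a \in sa') = sqsubset a l.
  rewrite mem_filter saE /sqsubseteq; case: eqVneq => [->|_] /=; last by rewrite orbF.
  by apply/esym/negP=> /sqsubset_sumn /eqP; rewrite -[X in X == _]addn0 -addn1 eqn_add2l.
have [m0|m0] := posnP m.
  have no a : a \in sa -> a != l -> False.
    move=> as_ al; have : a \in sa' by rewrite mem_filter al.
    by rewrite saE' => /sqsubset_sumn; rewrite m0.
  by exists (fun=> 0), (fun=> 0); split=> // [a as_ /(no a as_)|a a' as_ _ /(no a as_)].
have mN : (0 < m <= N)%N by rewrite m0 leqW.
have [inc [prj [bp ortho complete]]] := specht_res charF pl mN (filter_uniq _ usa) saE'.
exists inc, prj; split=> [a as_ al|a a' as_ as'_ al al'|_ v vS].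
- by apply: bp; rewrite mem_filter al.
- by apply: ortho; rewrite mem_filter ?al ?al'.
by rewrite -big_filter complete.
Qed.

Variable Q : smod F N (diag N * tabloid N)%type.
Hypothesis HQ : half_spec x (@Pset n m) l Q.
Variables (K1 K3 : finType) (pt1 : K1 -> seq nat) (pt3 : K3 -> seq nat).
Variables (M1 : smod F N (K1 * (diag N * tabloid N))%type)
  (M3 : smod F N (K3 * (diag N * tabloid N))%type).
Hypotheses (ptE1 : [seq pt1 k | k : K1] = sa) (ptE3 : [seq pt3 k | k : K3] = sb).
Hypotheses (HM1 : half_sum_spec x pt1 M1) (HM3 : half_sum_spec x pt3 M3).

Lemma half_exact : short_exact M1 Q M3.
Proof.
have [inc [prj [bp ortho complete]]] := specht_res_proper.
have [i0 [arcd [unarcd arcP]]] : exists (i0 : 'I_N) (arcd unarcd : diag N -> diag N),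
    (0 < m)%N -> exists j0 : 'I_n, [/\ m = j0.+1, i0 = lift ord_max j0,
      arcd = join_arc j0 & unarcd = cut_arc j0].
  (* For m = 0 no bottom vertex below m can be joined to n, and arbitrary values fill the places of
     the arc operations. *)
  have [m0|m0] := posnP m; first by exists ord0, id, id.
  have jn : (m.-1 < n)%N by rewrite prednK.
  exists (lift ord_max (Ordinal jn)), (join_arc (Ordinal jn)), (cut_arc (Ordinal jn)) => _.
  by exists (Ordinal jn); split=> //; rewrite /= prednK.
pose x0 : 'I_N := inord m.
have x0m : x0 = m :> nat by rewrite inordK.
have [lft [dwn [c [bp3 cos comp3]]]] := specht_ind_maps charF pl x0m usb sbE.
pose f := downf l arcd inc pt1 : 'Hom(_, vec F (diag N * tabloid N)%type).
pose g := upg l x0 lft pt3 : 'Hom(vec F (diag N * tabloid N)%type, _).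
pose r := downr l i0 unarcd prj pt1 : 'Hom(vec F (diag N * tabloid N)%type, _).
pose k := upk l x0 dwn c pt3 : 'Hom(_, vec F (diag N * tabloid N)%type).
have fhom : ishom M1 Q f by exact: (downf_hom mn HQ saE arcP bp ptE1 HM1).
have ghom : ishom Q M3 g by exact: (upg_hom mn HQ x0m sbE bp3 ptE3 HM3).
have gkill c' s : Pset m c' -> ~~ isl (val c' (inr ord_max)) -> g (tens (delta F c') s) = 0.
  by move=> Pc nc; apply: (upg_kill mn lft x0m).
apply: (short_exact_split (f := f) (g := g) (r := r) (k := k)) => //.
- by move=> v; apply: (downr_W mn HQ saE arcP bp ptE1 HM1).
- by move=> v; apply: (downr_downf mn saE usa arcP ortho ptE1 HM1).
- by move=> v; apply: (upk_V mn HQ x0m sbE bp3 ptE3 HM3).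
- by move=> v; apply: (upk_W mn HQ x0m sbE bp3 ptE3 HM3).
- by move=> v; apply: (upg_upk mn x0m sbE usb bp3 cos ptE3 HM3).
- move=> v; rewrite -comp_lfunE; move: v.
  apply: (half_sum_Vind HM1) => k1 d s hd sS; rewrite comp_lfunE /f downfE.
  have [kl|[kl [j0 [mj sk ij aj uj]]]] := pt_cases saE arcP ptE1 k1.
    rewrite kl in hd *; have [di _] := halfdP _ _ hd; rewrite eqxx gkill ?mem0v ?Pset_iso //.
    by rewrite (halfd_max mn di).
  rewrite (negPf kl); rewrite sk in hd; have [di _] := halfdP _ _ hd.
  by rewrite aj gkill ?mem0v ?Pset_arc // arc_max.
- move=> v vQ; have -> : v - k (g v) = v - (k \o g)%VF v by rewrite comp_lfunE.
  rewrite -[X in X - _]id_lfunE; move: v vQ; apply: (half_VindB HQ) => c' s Pc sS.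
  rewrite comp_lfunE id_lfunE; have [cl|cl] := boolP (isl (val c' (inr ord_max))).
    by rewrite /k /g (upk_upg mn x0m comp3 ptE3 Pc cl sS) subrr mem0v.
  rewrite gkill // hom0 subr0.
  exact: (down_exact mn HQ saE arcP bp complete ptE1 HM1).
Qed.

End ExactSequence.

Theorem theorem3p4 (F : fieldType) (x : F) (n t : nat) (l : seq nat) :
  [pchar F] =i pred0 -> x != 0 -> (1 <= t <= n)%N -> is_partition (n - t) l ->
  smod_iso (ind x (Mmod x n l)) (res (Mmod x n.+2 l)) /\
  (forall sa sb : seq (seq nat),
     uniq sa -> (forall a, (a \in sa) = sqsubseteq a l) ->
     uniq sb -> (forall b, (b \in sb) = sqsubset l b) ->
     short_exact (dsum [seq Mmod x n.+1 a | a <- sa])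
                 (ind x (Mmod x n l))
                 (dsum [seq Mmod x n.+1 b | b <- sb])).
Proof.
move=> charF x_neq0 tn /andP[pl /eqP ml].
have mn : (sumn l <= n)%N by rewrite ml leq_subr.
have HQ := half_modP x (@Pset n (sumn l)) l.
have indQ := ind_half_iso x_neq0 pl mn (Mmod_half x_neq0 mn) HQ.
split.
  apply: (iso_data_iso (iso_data_trans indQ _)); apply: (slide_iso pl mn HQ).
  exact: (Mmod_half x_neq0 (leqW (leqW mn))).
move=> sa sb usa saE usb sbE; apply: (short_exact_iso indQ).
have saN a : a \in sa -> (sumn a <= n.+1)%N.
  rewrite saE => /orP[/sqsubset_sumn E|/eqP->]; last exact: leqW.
  by rewrite ltnW // ltnS (leq_trans _ mn) // E.
have sbN b : b \in sb -> (sumn b <= n.+1)%N by rewrite sbE => /sqsubset_sumn->.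
exact: (half_exact charF pl mn usa saE usb sbE HQ (summand_enum x n.+1 sa)
  (summand_enum x n.+1 sb) (half_sumP x_neq0 saN) (half_sumP x_neq0 sbN)).
Qed.
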